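(* For any $\alpha,\beta,\gamma\in\{-1,1\}$, the following hold for the $(3,2)$-configuration $\mathcal{E}_{\alpha,\beta,\gamma}$ and its dual arrangement $\mathcal{N}^{\alpha,\beta,\gamma}$: (1) The combinatorics of $\mathcal{E}_{\alpha,\beta,\gamma}$ is $$\begin{array}{l}\big\{\{V_1,S_1,S_5\},\{V_1,S_2,S_{14}^\gamma\},\{V_1,S_3,S_6^\alpha\},\{V_1,S_4,S_9^\beta\},\{V_1,S_7^\alpha,S_8^\alpha\},\{V_1,S_{10}^\beta,S_{11}^\beta\},\{V_1,S_{12}^\gamma,S_{13}^\gamma\},\\ \{V_2,S_1,S_4\},\{V_2,S_2,S_{11}^\beta\},\{V_2,S_3,S_7^\alpha\},\{V_2,S_5,S_{13}^\gamma\},\{V_2,S_6^\alpha,S_8^\alpha\},\{V_2,S_9^\beta,S_{10}^\beta\},\{V_2,S_{12}^\gamma,S_{14}^\gamma\},\\ \{V_3,S_1,S_8^\alpha\},\{V_3,S_2,S_3\},\{V_3,S_4,S_{10}^\beta\},\{V_3,S_5,S_{12}^\gamma\},\{V_3,S_6^\alpha,S_7^\alpha\},\{V_3,S_9^\beta,S_{11}^\beta\},\{V_3,S_{13}^\gamma,S_{14}^\gamma\}\big\}.\end{array}$$ (2) $\mathcal{E}_{\alpha,\beta,\gamma}$ is stable. (3) If $\alpha',\beta',\gamma'\in\{-1,1\}$ are such that $\alpha\beta\gamma\neq\alpha'\beta'\gamma'$, then there is no homeomorphism between the pairs $(\mathbb{CP}^2,\mathcal{N}^{\alpha,\beta,\gamma})$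 and $(\mathbb{CP}^2,\mathcal{N}^{\alpha',\beta',\gamma'})$.
   Context: For $\alpha,\beta,\gamma\in\{-1,1\}$, $\mathcal{E}_{\alpha,\beta,\gamma}$ is the configuration of 17 points of $\mathbb{RP}^2$ with vertex set $\mathcal{V}=\{V_1,V_2,V_3\}$, where $V_1=(0:0:1)$, $V_2=(1:0:0)$, $V_3=(0:1:0)$, and set of surrounding-points $\mathcal{S}_{\alpha,\beta,\gamma}$ consisting of $S_1=(1:2:1)$, $S_2=(2:1:1)$, $S_3=(2:-4:1)$, $S_4=(-4:2:1)$, $S_5=(5:10:-2)$; $S_6^\alpha=(2:-4:\alpha\sqrt2)$, $S_7^\alpha=(\alpha\sqrt2:-4:1)$, $S_8^\alpha=(1:-2\alpha\sqrt2:1)$; $S_9^\beta=(-4:2:\beta\sqrt2)$, $S_{10}^\beta=(-4:\beta\sqrt2:1)$, $S_{11}^\beta=(-2\beta\sqrt2:1:1)$; $S_{12}^\gamma=(5:5\gamma:-2)$, $S_{13}^\gamma=(5\gamma:5:-1)$, $S_{14}^\gamma=(10:5:-2\gamma)$. (It is a $(3,2)$-configuration: each surrounding-point carries weight $1\in\mathbb{Z}/2\mathbb{Z}$, each vertex weight $0$, no surrounding-point lies on a line joining two vertices, and on each line joining a vertex and a surrounding-point the weights sum to $0$.) The combinatorics of such a configuration is the collection of all triples of collinear points of $\mathcal{V}\sqcup\mathcal{S}_{\alpha,\beta,\gamma}$. The configuration is stable if every bijection of $\mathcal{V}\sqcup\mathcal{S}_{\alpha,\beta,\gamma}$ preserving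 the combinatorics maps $\mathcal{V}$ onto $\mathcal{V}$. For a point $P=(a:b:c)$, $P^\bullet=\{ax+by+cz=0\}\subset\mathbb{CP}^2$. The dual arrangement $\mathcal{N}^{\alpha,\beta,\gamma}$ is the set of the 17 lines $P^\bullet$, $P\in\mathcal{V}\sqcup\mathcal{S}_{\alpha,\beta,\gamma}$. A homeomorphism of pairs is a homeomorphism of $\mathbb{CP}^2$ mapping the union of the lines of the first arrangement onto the union of the lines of the second. *)

(* Defs.v *)
From HB Require Import structures.
From mathcomp Require Import all_boot all_order all_algebra all_fingroup generic_quotient.
From mathcomp Require Import boolp classical_sets functions.
From mathcomp Require Import reals topology normedtype.
From mathcomp.real_closed Require Import complex.
From mathcomp Require Import ring.

Set Implicit Arguments.
Unset Strict Implicit.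
Unset Printing Implicit Defensive.
Import Order.TTheory GRing.Theory Num.Theory.
Import numFieldTopology.Exports.
Local Open Scope classical_set_scope.
Local Open Scope ring_scope.
Local Open Scope quotient_scope.

Section ProjectivePlane.
Variable K : numFieldType.

Definition nonzero : set 'rV[K]_3 := [set v | v != 0].

Definition proportional (u v : nonzero) : bool :=
  `[< exists2 k : K, k != 0 & \val u = k *: \val v >].

Lemma proportional_refl : reflexive proportional.
Proof. by move=> u; apply/asboolP; exists 1; rewrite ?oner_eq0 ?scale1r. Qed.

Lemma proportional_sym : symmetric proportional.
Proof.
have H u v : proportional u v -> proportional v u.
  move=> /asboolP[k k0 e]; apply/asboolP; exists k^-1; first by rewrite invr_eq0.
  by rewrite e scalerA mulVf // scale1r.
by move=> u v; apply/idP/idP; apply: H.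
Qed.

Lemma proportional_trans : transitive proportional.
Proof.
move=> v u w /asboolP[k k0 e] /asboolP[l l0 e']; apply/asboolP.
by exists (k * l); rewrite ?mulf_neq0 // e e' scalerA.
Qed.

Canonical proportional_equiv :=
  EquivRel proportional proportional_refl proportional_sym proportional_trans.

Definition proj_plane := {eq_quot proportional}.

(* Quotient topology of the subspace topology on K^3 \ {0}. *)
HB.instance Definition _ :=
  Topological.copy proj_plane (quotient_topology proj_plane).
HB.instance Definition _ := Quotient.on proj_plane.

Definition homog (v : 'rV[K]_3) (v0 : v != 0) : proj_plane :=
  \pi_proj_plane (exist _ v (mem_set v0) : nonzero).

(* Homogeneous coordinates of P, chosen up to a nonzero factor; every use
   below is invariant under rescaling. *)
Definition hcoords (P : proj_plane) : 'rV[K]_3 := \val (repr P).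

Definition line (u : 'rV[K]_3) : set proj_plane :=
  [set P | \sum_(i < 3) u 0 i * hcoords P 0 i = 0].

Definition collinear (P Q S : proj_plane) : Prop :=
  exists2 u : 'rV[K]_3, u != 0 & [/\ line u P, line u Q & line u S].

Lemma hcoords_homog v (v0 : v != 0) :
  exists2 k, k != 0 & hcoords (homog v0) = k *: v.
Proof.
have /asboolP[k k0 e] : proportional (repr (homog v0)) (exist _ v (mem_set v0)).
  by apply/(@eqquotP _ proportional_equiv); exact: (reprK (homog v0)).
by exists k.
Qed.

Lemma line_homog u v (v0 : v != 0) :
  line u (homog v0) <-> \sum_(i < 3) u 0 i * v 0 i = 0.
Proof.
rewrite /line /=; have [k k0 ->] := hcoords_homog v0.
under eq_bigr do rewrite mxE mulrCA.
rewrite -mulr_sumr; split=> [/eqP|->]; last by rewrite mulr0.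
by rewrite mulf_eq0 (negPf k0) => /eqP.
Qed.

Definition det3 (u v w : 'rV[K]_3) : K :=
  \det (\matrix_(i < 3, j < 3) [:: u; v; w]`_j 0 i).

Lemma collinear_homog u v w (u0 : u != 0) (v0 : v != 0) (w0 : w != 0) :
  collinear (homog u0) (homog v0) (homog w0) <-> det3 u v w = 0.
Proof.
rewrite /collinear; split.
  case=> l l0 [/line_homog h1 /line_homog h2 /line_homog h3].
  apply/eqP/det0P; exists l => //; apply/rowP=> j; rewrite !mxE.
  rewrite -[RHS](_ : \sum_(i < 3) l 0 i * [:: u; v; w]`_j 0 i = 0).
    by apply: eq_bigr => i _; rewrite mxE.
  by case: j => [[|[|[|]]]].
move=> /eqP/det0P[l l0 e]; exists l => //.
have H (j : 'I_3) : \sum_(i < 3) l 0 i * [:: u; v; w]`_j 0 i = 0.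
  have /rowP/(_ j) := e; rewrite !mxE => h; rewrite -[RHS]h.
  by apply: eq_bigr => i _; rewrite mxE.
by split; apply/line_homog; [apply: (H 0)|apply: (H 1)|apply: (H ord_max)].
Qed.

Lemma homog_eq u v (u0 : u != 0) (v0 : v != 0) :
  homog u0 = homog v0 -> forall i j, u 0 i * v 0 j = u 0 j * v 0 i.
Proof.
move=> /eqquotP/asboolP[k _ /= ->] i j; rewrite !mxE; ring.
Qed.

End ProjectivePlane.

(* A (t,m)-configuration with n surrounding-points: the index inl i stands for
   the vertex V_(i+1) and inr j for the surrounding-point S_(j+1). 'Z_m is Z/m
   only for m >= 2; m = 2 is the only value used. *)
Record configuration (R : realType) (t n m : nat) := Configuration {
  pt : 'I_t + 'I_n -> proj_plane R;
  wt : 'I_t + 'I_n -> 'Z_m;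
  pt_inj : injective pt;
  wt_vertex : forall i : 'I_t, wt (inl i) = 0;
  surrounding_off_lines : forall (i i' : 'I_t) (j : 'I_n), i != i' ->
    ~ collinear (pt (inl i)) (pt (inl i')) (pt (inr j));
  wt_sum : forall (i : 'I_t) (j : 'I_n),
    \sum_(p | `[< collinear (pt (inl i)) (pt (inr j)) (pt p) >]) wt p = 0
}.

Section Configurations.
Variables (R : realType) (t n m : nat).
Implicit Type E : configuration R t n m.

Definition combinatorics E : {set {set 'I_t + 'I_n}} :=
  [set T | `[< exists p q s, [/\ uniq [:: p; q; s], T = [set p; q; s]%SET
    & collinear (pt E p) (pt E q) (pt E s)] >]]%SET.

Definition vertices : {set 'I_t + 'I_n} := [set inl i | i : 'I_t]%SET.

Definition stable E : Prop :=
  forall f : {perm 'I_t + 'I_n},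
    [set f @: T | T : {set 'I_t + 'I_n} in combinatorics E]%SET
      = combinatorics E ->
    (f @: vertices = vertices)%SET.

Definition dual_line (P : proj_plane R) : set (proj_plane R[i]) :=
  line (map_mx (real_complex R) (hcoords P)).

Definition dual_arrangement E : set (set (proj_plane R[i])) :=
  range (fun p => dual_line (pt E p)).

End Configurations.

Definition homeomorphic_pairs (T : topologicalType) (N N' : set (set T)) : Prop :=
  exists f g : T -> T,
    [/\ cancel f g, cancel g f, continuous f, continuous g
      & f @` (\bigcup_(L in N) L) = \bigcup_(L in N') L].

Section Example.
Variable R : realType.

Local Notation r2 := (Num.sqrt 2 : R).

Definition row3 (x y z : R) : 'rV[R]_3 := \row_(i < 3) [:: x; y; z]`_i.

Definition E_coords (alpha beta gamma : R) (p : 'I_3 + 'I_14) : 'rV[R]_3 :=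
  match p with
  | inl i =>
    [:: row3 0 0 1;
        row3 1 0 0;
        row3 0 1 0]`_i
  | inr j =>
    [:: row3 1 2 1;
        row3 2 1 1;
        row3 2 (- 4) 1;
        row3 (- 4) 2 1;
        row3 5 10 (- 2);
        row3 2 (- 4) (alpha * r2);
        row3 (alpha * r2) (- 4) 1;
        row3 1 (- 2 * alpha * r2) 1;
        row3 (- 4) 2 (beta * r2);
        row3 (- 4) (beta * r2) 1;
        row3 (- 2 * beta * r2) 1 1;
        row3 5 (5 * gamma) (- 2);
        row3 (5 * gamma) 5 (- 1);
        row3 10 5 (- 2 * gamma)]`_j
  end.

Lemma row3_neq0 x y z : [|| x != 0, y != 0 | z != 0] -> row3 x y z != 0.
Proof.
apply: contraTneq => /rowP e.
have := (e 0, e 1, e ord_max); rewrite !mxE /= => -[[-> ->] ->].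
by rewrite eqxx.
Qed.

Lemma E_coords_neq0 a b c p : E_coords a b c p != 0.
Proof.
case: p => [[[|[|[|//]]] ?]|j]; try by apply: row3_neq0; rewrite /= oner_eq0 ?orbT.
by case: j; do 14!
  [case=> [?|]; [by apply: row3_neq0; rewrite /= ?oppr_eq0 ?oner_eq0 ?pnatr_eq0 ?orbT|]].
Qed.

Definition E_pt (a b c : R) (p : 'I_3 + 'I_14) : proj_plane R :=
  homog (E_coords_neq0 a b c p).

Definition E_wt (p : 'I_3 + 'I_14) : 'Z_2 := if p is inr _ then 1 else 0.

(* The axioms of a configuration are checked by computation on coordinates in
   Z[sqrt 2], the pair (x, y) standing for x + y sqrt 2. *)
Definition ev (x : int * int) : R := x.1%:~R + x.2%:~R * r2.
Definition zadd (x y : int * int) := (x.1 + y.1, x.2 + y.2).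
Definition zopp (x : int * int) := (- x.1, - x.2).
Definition zmul (x y : int * int) :=
  (x.1 * y.1 + (x.2 * y.2 + x.2 * y.2), x.1 * y.2 + x.2 * y.1).

Definition z0 : int * int := (0, 0).
Definition zi (x : int) : int * int := (x, 0).
Definition zr (x : int) : int * int := (0, x).

Definition zcoords (a b c : int) : seq (seq (int * int)) :=
  [:: [:: z0; z0; zi 1]; [:: zi 1; z0; z0]; [:: z0; zi 1; z0];
    [:: zi 1; zi 2; zi 1]; [:: zi 2; zi 1; zi 1]; [:: zi 2; zi (- 4); zi 1];
    [:: zi (- 4); zi 2; zi 1]; [:: zi 5; zi 10; zi (- 2)];
    [:: zi 2; zi (- 4); zr a]; [:: zr a; zi (- 4); zi 1];
    [:: zi 1; zr (- 2 * a); zi 1];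
    [:: zi (- 4); zi 2; zr b]; [:: zi (- 4); zr b; zi 1];
    [:: zr (- 2 * b); zi 1; zi 1];
    [:: zi 5; zi (5 * c); zi (- 2)]; [:: zi (5 * c); zi 5; zi (- 1)];
    [:: zi 10; zi 5; zi (- 2 * c)]].

Definition code (p : 'I_3 + 'I_14) : nat :=
  match p with inl i => i | inr j => (3 + j)%N end.

Lemma sqr_r2 : r2 * r2 = 2.
Proof. by rewrite -expr2 sqr_sqrtr ?ler0n. Qed.

Lemma evD x y : ev (zadd x y) = ev x + ev y.
Proof. by rewrite /ev /= !intrD; ring. Qed.

Lemma evN x : ev (zopp x) = - ev x.
Proof. by rewrite /ev /= !intrN; ring. Qed.

Lemma evM x y : ev (zmul x y) = ev x * ev y.
Proof.
rewrite /ev /= !intrD !intrM; set p := x.1%:~R; set q := x.2%:~R.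
set u := y.1%:~R; set v := y.2%:~R.
rewrite (_ : q * v + q * v = r2 * r2 * (q * v)); first by ring.
by rewrite sqr_r2; ring.
Qed.

Lemma ev_eq0 x : (ev x == 0) = (x == z0).
Proof.
apply/eqP/eqP=> [|->]; last by rewrite /ev /= mul0r addr0.
case: x => x y; rewrite /ev /= => /eqP; rewrite addr_eq0 => /eqP e.
have e2 : x * x = 2 * (y * y).
  apply: (@intr_inj R); rewrite !intrM e mulrNN mulrACA sqr_r2; ring.
have {e2} : (`|x| ^ 2 = 2 * `|y| ^ 2)%N.
  by rewrite -!mulnn -!abszM e2 abszM.
have [y0 _|y0 /(congr1 (logn 2))] := eqVneq y 0.
  by move: e; rewrite y0 mul0r oppr0 => /eqP; rewrite intr_eq0 => /eqP ->.
have l2 : logn 2 2 = 1%N by [].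
rewrite lognM // ?expn_gt0 ?absz_gt0 ?y0 // !lognX l2 => /(congr1 odd).
by rewrite oddD !oddM.
Qed.

Lemma ev_z0 : ev z0 = 0.
Proof. by apply/eqP; rewrite ev_eq0. Qed.

Lemma E_coords_ev (a b c : int) p (i : 'I_3) :
  E_coords a%:~R b%:~R c%:~R p 0 i
  = ev (nth z0 (nth [::] (zcoords a b c) (code p)) i).
Proof.
have eI (k : int) : ev (zi k) = k%:~R by rewrite /ev /= mul0r addr0.
have eR (k : int) : ev (zr k) = k%:~R * r2 by rewrite /ev /= add0r.
have H (x y z : R) (u v w : int * int) : x = ev u -> y = ev v -> z = ev w ->
    row3 x y z 0 i = ev (nth z0 [:: u; v; w] i).
  by move=> -> -> ->; rewrite mxE; case: i => [[|[|[|]]]].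
case: p => [[[|[|[|//]]] ?]|j]; try by apply: H; rewrite ?ev_z0 ?eI.
by case: j; do 14!
  [case=> [?|]; [by apply: H; rewrite ?eI ?eR ?intrM ?intrN|]].
Qed.

Lemma det3E (u v w : 'rV[R]_3) : det3 u v w =
   u 0 0 * (v 0 1 * w 0 ord_max - v 0 ord_max * w 0 1)
   - v 0 0 * (u 0 1 * w 0 ord_max - u 0 ord_max * w 0 1)
   + w 0 0 * (u 0 1 * v 0 ord_max - u 0 ord_max * v 0 1).
Proof.
have E0 : ord0 = 0 :> 'I_3 by [].
have E1 : lift ord0 ord0 = 1 :> 'I_3 by apply: val_inj.
have E2 : lift ord0 (lift ord0 ord0) = ord_max :> 'I_3 by apply: val_inj.
have E3 : lift 1 ord0 = 0 :> 'I_3 by apply: val_inj.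
have E4 : lift (ord_max : 'I_3) ord0 = 0 :> 'I_3 by apply: val_inj.
have E5 : lift 1 (lift ord0 ord0) = ord_max :> 'I_3 by apply: val_inj.
have E6 : lift (ord_max : 'I_3) (lift ord0 ord0) = 1 :> 'I_3 by apply: val_inj.
rewrite /det3 (expand_det_row _ 0) !big_ord_recl big_ord0 /cofactor.
rewrite !(expand_det_row _ ord0) !big_ord_recl !big_ord0 /cofactor !det_mx11.
rewrite !mxE /= ?E1 ?E2 ?E3 ?E4 ?E5 ?E6 ?E0 /bump /=.
rewrite ?E1 ?E2 ?E3 ?E4 ?E5 ?E6 ?E0.
ring.
Qed.

Section Check.
Variables a b c : int.
Let P : 'I_3 + 'I_14 -> proj_plane R := E_pt a%:~R b%:~R c%:~R.
Let x k i := nth z0 (nth [::] (zcoords a b c) k) i.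
Definition zminor k l i j :=
  zadd (zmul (x k i) (x l j)) (zopp (zmul (x k j) (x l i))).
Definition zdet k l n :=
  zadd (zadd (zmul (x k 0) (zminor l n 1 2)) (zopp (zmul (x l 0) (zminor k n 1 2))))
       (zmul (x n 0) (zminor k l 1 2)).
Definition zcol k l n := zdet k l n == z0.

Definition zcheck :=
  [&& all (fun k => all (fun l => [|| k == l, zminor k l 0 1 != z0,
        zminor k l 0 2 != z0 | zminor k l 1 2 != z0]) (iota 0 17)) (iota 0 17),
      all (fun k => all (fun l => (k == l) || all (fun n => ~~ zcol k l n) (iota 3 14))
        (iota 0 3)) (iota 0 3)
    & all (fun k => all (fun l => ~~ odd (count (zcol k l) (iota 3 14)))
        (iota 3 14)) (iota 0 3)].

Lemma collinear_E_pt p q s :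
  `[< collinear (P p) (P q) (P s) >] = zcol (code p) (code q) (code s).
Proof.
apply/asboolP/idP => [/collinear_homog|h].
  rewrite det3E !E_coords_ev -!(evM, evN, evD) => /eqP; rewrite ev_eq0; exact.
by apply/collinear_homog/eqP; rewrite det3E !E_coords_ev -!(evM, evN, evD) ev_eq0.
Qed.

Lemma E_pt_neq p q (i j : 'I_3) :
  zminor (code p) (code q) i j != z0 ->
  P p <> P q.
Proof.
move=> h /homog_eq/(_ i j) /eqP; apply/negP.
by rewrite -subr_eq0 !E_coords_ev -!(evM, evN, evD) ev_eq0.
Qed.

Lemma code_inj : injective code.
Proof.
case=> [i|i] [j|j] /=.
- by move=> /val_inj ->.
- by move=> e; have := ltn_ord i; rewrite e.
- by move=> e; have := ltn_ord j; rewrite -e.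
- by move=> /addnI/val_inj ->.
Qed.

Lemma code_iota p : code p \in iota 0 17.
Proof. by rewrite mem_iota; case: p => i //=; rewrite ?ltn_add2l // (ltn_trans (ltn_ord i)). Qed.

Lemma code_inl (i : 'I_3) : code (inl i) \in iota 0 3.
Proof. by rewrite mem_iota /=. Qed.

Lemma code_inr (j : 'I_14) : code (inr j) \in iota 3 14.
Proof. by rewrite mem_iota /= ltn_add2l. Qed.

Hypothesis check : zcheck.

Lemma E_pt_inj_int : injective P.
Proof.
move=> p q e; apply: code_inj; apply/eqP; case/and3P: check => h _ _.
have /allP/(_ _ (code_iota q)) := allP h _ (code_iota p).
case/or4P=> // H; exfalso.
- exact: (@E_pt_neq p q 0 1 H e).
- exact: (@E_pt_neq p q 0 ord_max H e).
- exact: (@E_pt_neq p q 1 ord_max H e).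
Qed.

Lemma E_off_lines_int (i i' : 'I_3) (j : 'I_14) : i != i' ->
  ~ collinear (P (inl i)) (P (inl i')) (P (inr j)).
Proof.
move=> ii' /asboolP; rewrite collinear_E_pt; apply/negP.
case/and3P: check => _ h _.
have /predU1P[/val_inj e|h'] := allP (allP h _ (code_inl i)) _ (code_inl i').
  by rewrite e eqxx in ii'.
exact: (allP h' _ (code_inr j)).
Qed.

Lemma E_wt_sum_int (i : 'I_3) (j : 'I_14) :
  \sum_(p | `[< collinear (P (inl i)) (P (inr j)) (P p) >]) E_wt p = 0.
Proof.
under eq_bigl do rewrite collinear_E_pt.
rewrite big_sumType /= big1 // add0r sumr_const.
set n := #|_|.
have -> : n = count (zcol (code (inl i)) (code (inr j))) (iota 3 14).
  rewrite /n -sum1_card (iotaDl 3 0 14) count_map -sum1_count.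
  by rewrite -[iota 0 14]/(index_iota 0 14) big_mkord.
case/and3P: check => _ _ h.
have h' := allP h _ (code_inl i); have ev2 := allP h' _ (code_inr j).
rewrite -(even_halfK ev2).
by rewrite -muln2 mulrnA mulrn_pchar.
Qed.

End Check.

Lemma zcheck_sign a b c :
  a \in [:: -1; 1 : int] -> b \in [:: -1; 1 : int] -> c \in [:: -1; 1 : int] ->
  zcheck a b c.
Proof.
rewrite !inE => /orP[]/eqP-> /orP[]/eqP-> /orP[]/eqP->; by vm_compute.
Qed.

Lemma sign_int (a : R) : a \in [:: -1; 1] ->
  exists2 k : int, k \in [:: -1; 1] & a = k%:~R.
Proof.
by rewrite !inE => /orP[]/eqP->; [exists (-1)|exists 1]; rewrite ?intrN.
Qed.

Section Config.
Variables (a b c : R).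
Hypotheses (ha : a \in [:: -1; 1]) (hb : b \in [:: -1; 1]) (hc : c \in [:: -1; 1]).

Lemma E_pt_inj : injective (E_pt a b c).
Proof.
have [[[k hk ->] [l hl ->]] [n hn ->]] :=
  (sign_int ha, sign_int hb, sign_int hc).
exact/E_pt_inj_int/zcheck_sign.
Qed.

Lemma E_wt_vertex (i : 'I_3) : E_wt (inl i) = 0.
Proof. by []. Qed.

Lemma E_off_lines (i i' : 'I_3) (j : 'I_14) : i != i' ->
  ~ collinear (E_pt a b c (inl i)) (E_pt a b c (inl i')) (E_pt a b c (inr j)).
Proof.
have [[[k hk ->] [l hl ->]] [n hn ->]] :=
  (sign_int ha, sign_int hb, sign_int hc).
exact/E_off_lines_int/zcheck_sign.
Qed.

Lemma E_wt_sum (i : 'I_3) (j : 'I_14) :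
  \sum_(p | `[< collinear (E_pt a b c (inl i)) (E_pt a b c (inr j))
                  (E_pt a b c p) >]) E_wt p = 0.
Proof.
have [[[k hk ->] [l hl ->]] [n hn ->]] :=
  (sign_int ha, sign_int hb, sign_int hc).
exact/E_wt_sum_int/zcheck_sign.
Qed.

Definition E_config : configuration R 3 14 2 :=
  Configuration E_pt_inj E_wt_vertex E_off_lines E_wt_sum.

End Config.

End Example.

Arguments E_config {R} a b c _ _ _.

(* One-based names: Vx k is V_k for 1 <= k <= 3, Sp k is S_k for 1 <= k <= 14. *)
Definition Vx (k : nat) : 'I_3 + 'I_14 := inl (inord k.-1).
Definition Sp (k : nat) : 'I_3 + 'I_14 := inr (inord k.-1).

(* Main.v *)
(** Let [l_1, ..., l_14] be the equations of the lines dual to the surrounding-points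
    and [phi = (l_1 ... l_14) / l_r ^ 14], which has no zero or pole off these lines.
    On the line dual to a vertex the surrounding lines meet in pairs, so [phi] restricts
    there to a square [q_i ^ 2].  At the corner of the triangle [V_1 V_2 V_3] lying on
    the sides [i] and [k] the ratio [q_i / q_k] is a sign, and the product of these three
    signs, the holonomy around the triangle of the double cover [y ^ 2 = phi], does not
    depend on the choice of the [q_i]; it equals [alpha * beta * gamma].

    A homeomorphism [f] of the pairs maps lines to lines, because a line without finitely
    many points is connected; hence it preserves concurrence, and by stability it maps the
    triangle to the triangle.  Near a smooth point of a surrounding line neither [phi] nor
    [phi' o f] has a continuous square root off the line.  The complement of the line is
    there the product of a punctured disc and a disc, on which two functions without a
    square root have a product with one.  So [phi * (phi' o f)] has a square root locally
    off the arrangement, therefore globally on any disc meeting each surrounding line in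
    isolated points.  A disc whose boundary runs along the triangle shows that the two
    holonomies multiply to 1. *)

Require Import Defs.
From mathcomp Require Import all_boot all_order all_algebra perm generic_quotient.
From mathcomp Require Import boolp classical_sets cardinality reals.
From mathcomp Require Import topology normedtype realfun.
From mathcomp.real_closed Require Import complex.
From mathcomp Require Import ring lra.
Set Implicit Arguments.
Unset Strict Implicit.
Unset Printing Implicit Defensive.
Import Order.TTheory GRing.Theory Num.Theory.
Import numFieldNormedType.Exports.
Local Open Scope classical_set_scope.
Local Open Scope ring_scope.

(** * Square roots of continuous functions *)

(** A homeomorphism is only continuous: it carries neither equations nor orientations, so near a
    line the one thing known about [phi' o f] is whether it has a continuous square root. That is a
    condition modulo 2, blind to orientation, which is why the invariant is a sign.

    As 14 is even, [l_r ^ 14] is a square, and the line of [l_r] behaves like the other surrounding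
    lines.

    On the side [i], [q_i] times the matching [q'_k o f] is an explicit root of [phi * (phi' o f)],
    but roots on different sides are unrelated until a root on a whole disc ties them together. The
    obvious disc, a real triangle, will not do: a real line meets it in a segment. Multiplying two
    coordinates by [i] and [1 + i] turns it away from the real plane. A surrounding line then meets
    the disc in points that are not real, and a point that is not real lies on at most one real
    line. So the disc misses the crossings of surrounding lines, where the local structure would be
    more complicated, and only smooth points have to be studied. *)

Section ContinuousAt.
Variables (T : topologicalType) (K : numFieldType).
Implicit Types (f g : T -> K) (x : T).

Lemma at_cst (U : topologicalType) (c : U) x : {for x, continuous (fun _ : T => c)}.
Proof. exact: cst_continuous. Qed.

Lemma at_id x : {for x, continuous (@id T)}.
Proof. by move=> A. Qed.

Lemma at_comp (U V : topologicalType) (f : T -> U) (g : U -> V) x :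
  {for x, continuous f} -> {for f x, continuous g} ->
  {for x, continuous (fun y => g (f y))}.
Proof. exact: continuous_comp. Qed.

Lemma at_pair (U V : topologicalType) (f : T -> U) (g : T -> V) x :
  {for x, continuous f} -> {for x, continuous g} ->
  {for x, continuous (fun y => (f y, g y))}.
Proof. exact: cvg_pair. Qed.

Lemma atD f g x : {for x, continuous f} -> {for x, continuous g} ->
  {for x, continuous (fun y => f y + g y)}.
Proof. by move=> cf cg; apply: cvgD. Qed.

Lemma atN f x : {for x, continuous f} -> {for x, continuous (fun y => - f y)}.
Proof. by move=> cf; apply: cvgN. Qed.

Lemma atM f g x : {for x, continuous f} -> {for x, continuous g} ->
  {for x, continuous (fun y => f y * g y)}.
Proof. by move=> cf cg; apply: cvgM. Qed.

Lemma atV f x : {for x, continuous f} -> f x != 0 ->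
  {for x, continuous (fun y => (f y)^-1)}.
Proof. by move=> cf f0; apply: cvgV. Qed.

Lemma at_near (U : topologicalType) (f g : T -> U) x :
  (\forall y \near x, f y = g y) -> {for x, continuous f} -> {for x, continuous g}.
Proof.
move=> e cf; rewrite /prop_for /continuous_at -(nbhs_singleton e).
exact: cvg_trans (near_eq_cvg e) cf.
Qed.

Lemma at_prod (I : Type) (r : seq I) (F : I -> T -> K) x :
  (forall i, {for x, continuous (F i)}) ->
  {for x, continuous (fun y => \prod_(i <- r) F i y)}.
Proof.
move=> cF; elim: r => [|i r IH].
  have -> : (fun y => \prod_(i <- [::]) F i y) = fun=> 1.
    by apply/funext => y; rewrite big_nil.
  exact: at_cst.
have -> : (fun y => \prod_(j <- i :: r) F j y) =
          fun y => F i y * \prod_(j <- r) F j y.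
  by apply/funext => y; rewrite big_cons.
exact: atM.
Qed.

Lemma at_open (U : topologicalType) (f : T -> U) x (A : set U) :
  {for x, continuous f} -> open A -> A (f x) -> \forall y \near x, A (f y).
Proof. by move=> cf oA Afx; apply: cf; exact: open_nbhs_nbhs. Qed.

End ContinuousAt.

(* Opaque below: unification otherwise unfolds the operations of [R[i]] to pairs. *)
Definition Cx (R : realType) : numFieldType := R[i].

(** * Complex numbers and continuous square roots *)

Section ComplexSqrt.
Variable R : realType.
Local Notation C := (Cx R).

Definition toC (x : R) : C := real_complex R x.
Definition Re (z : C) : R := complex.Re (z : R[i]).
Definition Im (z : C) : R := complex.Im (z : R[i]).
Definition iC : C := Complex (0 : R) 1.

Lemma complex_ext (x y : C) : Re x = Re y -> Im x = Im y -> x = y.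
Proof. by case: x y => [a b] [c d] /= ; rewrite /Re /Im /= => -> ->. Qed.

Lemma Re_toC x : Re (toC x) = x. Proof. by []. Qed.
Lemma Im_toC x : Im (toC x) = 0. Proof. by []. Qed.
Lemma Re_iC : Re iC = 0. Proof. by []. Qed.
Lemma Im_iC : Im iC = 1. Proof. by []. Qed.
Lemma Re0 : Re 0 = 0. Proof. by []. Qed.
Lemma Im0 : Im 0 = 0. Proof. by []. Qed.
Lemma Re1 : Re 1 = 1. Proof. by []. Qed.
Lemma Im1 : Im 1 = 0. Proof. by []. Qed.
Lemma toC0 : toC 0 = 0. Proof. exact: rmorph0. Qed.
Lemma toC1 : toC 1 = 1. Proof. exact: rmorph1. Qed.

Lemma ReD (x y : C) : Re (x + y) = Re x + Re y.
Proof. by case: x y => [? ?] []. Qed.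

Lemma ImD (x y : C) : Im (x + y) = Im x + Im y.
Proof. by case: x y => [? ?] []. Qed.

Lemma ReN (x : C) : Re (- x) = - Re x. Proof. by case: x. Qed.
Lemma ImN (x : C) : Im (- x) = - Im x. Proof. by case: x. Qed.

Lemma ReB (x y : C) : Re (x - y) = Re x - Re y.
Proof. by rewrite ReD ReN. Qed.

Lemma ReM (x y : C) : Re (x * y) = Re x * Re y - Im x * Im y.
Proof. by case: x y => [? ?] []. Qed.

Lemma ImM (x y : C) : Im (x * y) = Re x * Im y + Im x * Re y.
Proof. by case: x y => [? ?] []. Qed.

Lemma ReM_iC (z : C) : Re (z * iC) = - Im z. Proof. exact: ReiNIm. Qed.

Lemma Re2 (x : C) : Re (2 * x) = 2 * Re x.
Proof. by rewrite mulr_natl mulr2n ReD mulr_natl mulr2n. Qed.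

Lemma Re_mk x y : Re (toC x + toC y * iC) = x.
Proof. by rewrite ReD ReM Re_toC Im_toC Re_iC mulr0 mul0r subr0 addr0. Qed.

Lemma Im_mk x y : Im (toC x + toC y * iC) = y.
Proof. by rewrite ImD ImM !Im_toC Im_iC mul0r addr0 mulr1 add0r. Qed.

Lemma toC_eq0 x : (toC x == 0) = (x == 0).
Proof. by apply/eqP/eqP => [/(congr1 Re)|->]. Qed.

Lemma toC_lt (x y : R) : (toC x < toC y) = (x < y). Proof. exact: ltcR. Qed.

(** The order of the complex numbers is partial: [~~ (z <= 0)] describes the plane slit along the
    closed negative real axis, and [~~ (0 <= z)] the plane slit along the positive one. *)
Lemma npos_ReIm (z : C) : (z <= 0) = (Im z == 0) && (Re z <= 0).
Proof. by rewrite [LHS]lecE eq_sym. Qed.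

Lemma nneg_ReIm (z : C) : (0 <= z) = (Im z == 0) && (0 <= Re z).
Proof. by rewrite [LHS]lecE. Qed.

Lemma pos_toC (e : C) : 0 < e -> exists2 r, 0 < r & e = toC r.
Proof.
move=> e0; have /complex_realP[r er] : (e : R[i]) \is Num.real by apply: gtr0_real.
by exists r => //; rewrite -toC_lt -[toC r]er.
Qed.

Lemma norm_toC (x : R) : `|toC x| = toC `|x|.
Proof. by rewrite /toC (normc_def (x%:C)%C) /= expr0n addr0 sqrtr_sqr. Qed.

Lemma norm_real (z : C) : `|z| = toC (Re `|z|).
Proof. by rewrite /Re (normc_def (z : R[i])). Qed.

Lemma norm_Re (z : C) : toC `|Re z| <= `|z|. Proof. exact: normc_ge_Re. Qed.

Lemma norm_lt_ReIm (z : C) (e : R) : 0 < e -> `|Re z| < e -> `|Im z| < e ->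
  `|z| < toC (2 * e).
Proof.
move=> e0 h1 h2; rewrite (normc_def (z : R[i])) [X in X < _]/(toC _) toC_lt.
rewrite -[2 * e]gtr0_norm ?mulr_gt0 // -sqrtr_sqr ltr_sqrt ?exprn_gt0 ?mulr_gt0 //.
have := ltr_pM (normr_ge0 _) (normr_ge0 _) h1 h1.
have := ltr_pM (normr_ge0 _) (normr_ge0 _) h2 h2.
by rewrite -!normrM -!expr2 !ger0_norm ?sqr_ge0 // /Re /Im; nra.
Qed.

Lemma sqrt_ex (x : C) : exists d : C, d ^+ 2 = x.
Proof. by exists (sqrtc (x : R[i])); exact: sqr_sqrtc. Qed.

Opaque Cx.

Lemma Re_continuous : continuous Re.
Proof.
move=> x; apply/(@cvgrPdist_lt R R C (nbhs x)) => e e0.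
have e0C : 0 < toC e by rewrite toC_lt.
near=> y.
have h : `|x - y| < toC e by near: y; apply/nbhs_ballP; exists (toC e).
rewrite -toC_lt; apply: le_lt_trans h.
by rewrite -ReB norm_Re.
Unshelve. all: by end_near. Qed.

Lemma Im_continuous : continuous Im.
Proof.
move=> x; apply/(@cvgrPdist_lt R R C (nbhs x)) => e e0.
have e0C : 0 < toC e by rewrite toC_lt.
near=> y.
have h : `|x - y| < toC e by near: y; apply/nbhs_ballP; exists (toC e).
rewrite -toC_lt; apply: le_lt_trans h.
have -> : Im x - Im y = - Re ((x - y) * iC).
  by rewrite ReM_iC opprK; case: (x) (y) => [? ?] [].
rewrite normrN (le_trans (norm_Re _)) // normrM.
rewrite [`|iC|](_ : _ = 1) ?mulr1 //.
by rewrite (normc_def (iC : R[i])) /= expr0n expr1n add0r sqrtr1.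
Unshelve. all: by end_near. Qed.

Lemma real_complex_continuous : continuous toC.
Proof.
move=> x; apply/(@cvgrPdist_lt C C R (nbhs x)) => e e0.
have [e' e'0 ->] := pos_toC e0.
near=> y.
have h : `|x - y| < e' by near: y; apply/nbhs_ballP; exists e'.
by rewrite -[X in X < _]/`|toC x - toC y| /toC -rmorphB norm_toC toC_lt.
Unshelve. all: by end_near. Qed.

(* The principal square root, continuous off the negative real axis. *)
Definition psqrt (z : C) : C :=
  (z + `|z|) / toC (Num.sqrt (Re (2 * (`|z| + z)))).

Lemma psqrt_den (z : C) : ~~ (z <= 0) -> 0 < Re (2 * (`|z| + z)).
Proof.
rewrite [z <= 0]lecE /= negb_and Re2 ReD (normc_def (z : R[i])).
case: z => x y; rewrite /Re /=.
rewrite eq_sym => h.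
have [y0|y0] := eqVneq y 0.
  move: h; rewrite y0 eqxx /= -ltNge expr0n addr0 sqrtr_sqr => x0.
  rewrite gtr0_norm //; lra.
have : `|x| < Num.sqrt (x ^+ 2 + y ^+ 2).
  rewrite -sqrtr_sqr ltr_sqrt ?ltrDl ?exprn_even_gt0 //.
  by rewrite ltr_wpDl ?sqr_ge0 // exprn_even_gt0.
by have := ler_norm (- x); rewrite normrN; lra.
Qed.

(** Since [|z| ^ 2] is [z] times its conjugate, [(z + |z|) ^ 2] equals [z] times [2 |z| + 2 Re z],
    which is the square of the denominator. *)
Lemma sqr_psqrt (z : C) : ~~ (z <= 0) -> psqrt z ^+ 2 = z.
Proof.
move=> /psqrt_den d0.
rewrite /psqrt expr_div_n -[toC _ ^+ 2]rmorphXn /= sqr_sqrtr; last exact: ltW.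
have -> : (z + `|z|) ^+ 2 = z * toC (Re (2 * (`|z| + z))).
  have h2 : 2 * toC (Re z) = z + (z : R[i])^*%C by rewrite -[LHS]addcJ.
  have -> : toC (Re (2 * (`|z| + z))) = 2 * `|z| + 2 * toC (Re z).
    rewrite Re2 ReD mulrDr /toC rmorphD !rmorphM rmorph_nat.
    by rewrite [in RHS]norm_real.
  by rewrite h2 sqrrD sqr_normc; ring.
by rewrite mulfK // -[X in X != 0]/(toC _) toC_eq0 gt_eqF.
Qed.

Lemma psqrt1 : psqrt 1 = 1.
Proof.
rewrite /psqrt normr1 (_ : Re (2 * (1 + 1)) = 2 ^+ 2); last first.
  by rewrite Re2 ReD Re1; ring.
rewrite sqrtr_sqr ger0_norm // /toC rmorph_nat divff //.
by rewrite (pnatr_eq0 R[i] 2).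
Qed.

Lemma psqrt_continuous (z : C) : ~~ (z <= 0) -> {for z, continuous psqrt}.
Proof.
move=> z0; have d0 := psqrt_den z0.
have cn : {for z, continuous (fun z : C => `|z|)} by exact: (@norm_continuous C C).
have ci : {for z, continuous (fun z : C => z)} by exact: cvg_id.
refine (@atM C C (fun z => z + `|z|)
  (fun z => (toC (Num.sqrt (Re (2 * (`|z| + z)))))^-1) _ (atD ci cn) (atV _ _)).
  refine (@at_comp _ _ _ _ toC _ _ (@real_complex_continuous _)).
  refine (@at_comp _ _ _ _ Num.sqrt _ _ (@sqrt_continuous _ _)).
  refine (@at_comp _ _ _ _ Re _ _ (@Re_continuous _)).
  exact: (atM (@at_cst C C _ _) (atD cn ci)).
by rewrite toC_eq0 gt_eqF // sqrtr_gt0.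
Qed.

Lemma open_slit : open [set z : C | ~~ (z <= 0)].
Proof.
rewrite (_ : mkset _ = (Im @^-1` [set~ 0]) `|` (Re @^-1` [set x | 0 < x])).
  apply: openU.
    apply: open_comp => [x _|]; first exact: Im_continuous.
    exact/closed_openC/closed_eq.
  apply: open_comp => [x _|]; first exact: Re_continuous.
  exact: open_gt.
apply/seteqP; split=> z /=; rewrite npos_ReIm negb_and -ltNge.
  by move=> /orP[/eqP|]; [left|right].
by move=> [/eqP|] ->; rewrite ?orbT.
Qed.

(** The root is a total function, continuous at the points of [W] within all of [T] and not only
    within the subspace. Its values off [W] are arbitrary. *)
Definition has_sqrt (T : topologicalType) (h : T -> C) (W : set T) :=
  exists g : T -> C, forall x, W x -> g x ^+ 2 = h x /\ {for x, continuous g}.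

Lemma connected_sqr1 (T : topologicalType) (A : set T) (k : T -> C) :
  connected A -> (forall x, A x -> k x ^+ 2 = 1 /\ {for x, continuous k}) ->
  forall x y, A x -> A y -> k x = k y.
Proof.
move=> cA hk x y Ax Ay.
have kpm z : A z -> k z = 1 \/ k z = -1.
  by move=> /hk[/eqP]; rewrite sqrf_eq1 => /orP[]/eqP; [left|right].
pose u z := Re (k z).
have uE z : A z -> k z = toC (u z).
  by move=> /kpm[]; rewrite /u => ->; rewrite /toC ?ReN Re1 ?rmorphN rmorph1.
have ck : connected (u @` A).
  apply: connected_continuous_connected => //.
  apply: continuous_in_subspaceT => z /set_mem /hk[_ ckz].
  exact: (@at_comp _ _ _ k Re _ ckz (@Re_continuous _)).
have e : u @` A `&` [set u x] = u @` A.
  apply: ck.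
  - by exists (u x); split=> //; exists x.
  - exists (~` [set - u x]); first exact/closed_openC/closed_eq.
    apply/seteqP; split=> _ [[z Az <-]] h; split=> //; try by exists z.
      move=> /= e; have := h; rewrite /= e => /eqP.
      rewrite eqNr => /eqP u0; have := hk _ Az; rewrite uE // e u0 oppr0 /toC rmorph0 expr0n.
      by case=> /eqP; rewrite eq_sym oner_eq0.
    have /eqP := (hk _ Az).1; rewrite -(hk _ Ax).1 eqf_sqr.
    by rewrite /u => /orP[]/eqP e; [rewrite /= e|case: h; rewrite /= /u e ReN].
  - by exists [set u x] => //; exact: closed_eq.
have : (u @` A `&` [set u x]) (u y) by rewrite e; exists y.
by rewrite !uE // => -[_ ->].
Qed.

(** The quotient of the two roots squares to 1, hence is constant on a connected set. All signs
    compared later, on overlaps, half-planes and sides of the triangle, come from here. *)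
Lemma sqrt_sign (T : topologicalType) (A : set T) (h g1 g2 : T -> C) :
  connected A -> (forall x, A x -> h x != 0) ->
  (forall x, A x -> g1 x ^+ 2 = h x /\ {for x, continuous g1}) ->
  (forall x, A x -> g2 x ^+ 2 = h x /\ {for x, continuous g2}) ->
  exists2 s : C, s ^+ 2 = 1 & forall x, A x -> g1 x = s * g2 x.
Proof.
move=> cA h0 hg1 hg2.
have [[x0 Ax0]|A0] := pselect (exists x, A x); last first.
  by exists 1; rewrite ?expr1n // => x Ax; case: A0; exists x.
have g0 x : A x -> g2 x != 0.
  by move=> Ax; have := h0 x Ax; rewrite -(hg2 x Ax).1 sqrf_eq0.
have hk x : A x -> (g1 x / g2 x) ^+ 2 = 1 /\ {for x, continuous (fun x => g1 x / g2 x)}.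
  move=> Ax; have [[e1 c1] [e2 c2]] := (hg1 x Ax, hg2 x Ax); split.
    by rewrite expr_div_n e1 e2 divff // h0.
  exact: (atM c1 (atV c2 (g0 x Ax))).
exists (g1 x0 / g2 x0); first by have [] := hk _ Ax0.
move=> x Ax; rewrite (connected_sqr1 cA hk Ax0 Ax) divfK //; exact: g0.
Qed.

Lemma has_sqrtS (T : topologicalType) (h : T -> C) (V W : set T) :
  V `<=` W -> has_sqrt h W -> has_sqrt h V.
Proof. by move=> VW [g hg]; exists g => x /VW/hg. Qed.

Lemma has_sqrt_ext (T : topologicalType) (h k : T -> C) (W : set T) :
  (forall x, W x -> h x = k x) -> has_sqrt h W -> has_sqrt k W.
Proof. by move=> hk [g hg]; exists g => x Wx; rewrite -hk //; exact: hg. Qed.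

Lemma has_sqrtM (T : topologicalType) (h k : T -> C) (W : set T) :
  has_sqrt h W -> has_sqrt k W -> has_sqrt (fun x => h x * k x) W.
Proof.
move=> [f hf] [g hg]; exists (fun x => f x * g x) => x Wx.
have [[e1 c1] [e2 c2]] := (hf x Wx, hg x Wx); split; last exact: atM.
by rewrite exprMn e1 e2.
Qed.

Lemma has_sqrt_comp (S T : topologicalType) (c : S -> T) (h : T -> C)
    (V : set S) (W : set T) :
  (forall x, V x -> W (c x) /\ {for x, continuous c}) ->
  has_sqrt h W -> has_sqrt (fun x => h (c x)) V.
Proof.
move=> hc [g hg]; exists (fun x => g (c x)) => x Vx.
have [Wcx cx] := hc x Vx; have [e cg] := hg _ Wcx; split=> //.
exact: at_comp cx cg.
Qed.

Lemma has_sqrt_glue (T : topologicalType) (h g1 g2 : T -> C) (U1 U2 : set T) (s : C) :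
  open U1 -> open U2 -> s ^+ 2 = 1 ->
  (forall x, U1 x -> g1 x ^+ 2 = h x /\ {for x, continuous g1}) ->
  (forall x, U2 x -> g2 x ^+ 2 = h x /\ {for x, continuous g2}) ->
  (forall x, U1 x -> U2 x -> g1 x = s * g2 x) ->
  has_sqrt h (U1 `|` U2).
Proof.
move=> oU1 oU2 s1 hg1 hg2 e.
exists (fun x => if `[< U1 x >] then g1 x else s * g2 x) => x [Ux|Ux].
  rewrite (asboolT Ux); split; first exact: (hg1 x Ux).1.
  apply: at_near (hg1 x Ux).2.
  have : nbhs x U1 by exact: open_nbhs_nbhs.
  by apply: filterS => y Uy; rewrite asboolT.
split.
  case: asboolP => [U1x|_]; first exact: (hg1 x U1x).1.
  by rewrite exprMn s1 mul1r (hg2 x Ux).1.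
apply: (@at_near _ _ (fun y => s * g2 y)); last first.
  exact: (atM (@at_cst T C s x) (hg2 x Ux).2).
have : nbhs x U2 by exact: open_nbhs_nbhs.
by apply: filterS => y U2y; case: asboolP => // U1y; rewrite e.
Qed.

Lemma has_sqrtU (T : topologicalType) (h : T -> C) (U1 U2 : set T) :
  open U1 -> open U2 -> connected (U1 `&` U2) ->
  (forall x, (U1 `&` U2) x -> h x != 0) ->
  has_sqrt h U1 -> has_sqrt h U2 -> has_sqrt h (U1 `|` U2).
Proof.
move=> oU1 oU2 cU h0 [g1 hg1] [g2 hg2].
have [||s s1 e] := sqrt_sign (g1 := g1) (g2 := g2) cU h0.
- by move=> x [Ux _]; exact: hg1.
- by move=> x [_ Ux]; exact: hg2.
apply: (has_sqrt_glue oU1 oU2 s1 hg1 hg2) => x U1x U2x.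
exact: e.
Qed.

(** Dividing by [h x] moves the values near [x] into the slit plane, where the principal root is
    continuous; a root of the constant [h x] is then put back. Only [V] carries a continuity
    assumption, since [h] may be discontinuous elsewhere in [O]. *)
Lemma local_sqrt (T : topologicalType) (h : T -> C) x :
  h x != 0 -> {for x, continuous h} ->
  exists2 O : set T, nbhs x O & forall V : set T, V `<=` O ->
    (forall y, V y -> {for y, continuous h}) -> has_sqrt h V.
Proof.
move=> h0 ch.
have cr : {for x, continuous (fun y => h y / h x)}.
  exact: (atM ch (@at_cst T C _ x)).
exists [set y | ~~ (h y / h x <= 0)].
  apply: (at_open cr open_slit) => /=.
  by rewrite divff // npos_ReIm Re1 ler10 andbF.
move=> V VO cV.
apply: (@has_sqrt_ext _ (fun y => h x * (h y / h x))).
  by move=> y _; rewrite mulrCA divff ?mulr1.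
apply: has_sqrtM.
  have [d hd] : exists d : C, d ^+ 2 = h x by exact: sqrt_ex.
  by exists (fun=> d) => y _; split; [exact: hd|exact: (@at_cst T C d y)].
exists (fun y => psqrt (h y / h x)) => y Vy; have Oy := VO y Vy.
split; first exact: sqr_psqrt.
apply: (@at_comp _ _ _ (fun y => h y / h x) psqrt); last exact: psqrt_continuous.
exact: (atM (cV y Vy) (@at_cst T C _ y)).
Qed.

(* A square root on a contractible set, lifted along the contraction [c]: the increments
   of [h] along a path are close to 1 when the path is cut finely enough, so their
   principal square roots multiply to a lift, independent of the subdivision. *)
Section Contractible.
Variables (T : topologicalType) (W : set T) (c : R * T -> T) (h : T -> C).
Hypothesis c_cont : forall (s : R) x, 0 <= s <= 1 -> W x -> {for (s, x), continuous c}.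
Hypothesis c_in : forall (s : R) x, 0 <= s <= 1 -> W x -> W (c (s, x)).
Hypothesis c1 : forall x, W x -> c (1, x) = x.
Variable x0 : T.
Hypothesis c0 : forall x, W x -> c (0, x) = x0.
Hypothesis oW : open W.
Hypothesis hW : forall x, W x -> h x != 0 /\ {for x, continuous h}.

Let H s x := h (c (s, x)).
Let ratio a b x := H b x / H a x.
Let good n x := forall a b : R, 0 <= a -> a <= b -> b <= 1 -> (b - a) * n%:R <= 1 ->
  ~~ (ratio a b x <= 0).
Let G d n x s := d * \prod_(i < n) psqrt (ratio (s * i%:R / n%:R) (s * i.+1%:R / n%:R) x).

Lemma lift_H0 (s : R) x : 0 <= s <= 1 -> W x -> H s x != 0.
Proof. by move=> s01 Wx; have [] := hW (c_in s01 Wx). Qed.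

Lemma lift_H_cont (s : R) x : 0 <= s <= 1 -> W x ->
  {for (s, x), continuous (fun y : R * T => H y.1 y.2)}.
Proof.
move=> s01 Wx; have [_ ch] := hW (c_in s01 Wx).
have -> : (fun y : R * T => H y.1 y.2) = fun y => h (c y).
  by apply/funext => -[].
exact: (@at_comp _ _ _ c h _ (c_cont s01 Wx) ch).
Qed.

Lemma lift_frac n (i : nat) (s : R) : (0 < n)%N -> (i <= n)%N -> 0 <= s <= 1 ->
  0 <= s * i%:R / n%:R <= 1.
Proof.
move=> n0 lein /andP[s0 s1]; have nR : (0 : R) < n%:R by rewrite ltr0n.
rewrite divr_ge0 ?mulr_ge0 //= ler_pdivrMr // mul1r.
by rewrite (le_trans (ler_wpM2r _ s1)) ?mul1r ?ler_nat.
Qed.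

Lemma lift_good_slit n x (s : R) (i : 'I_n) : W x -> good n x -> 0 <= s <= 1 ->
  ~~ (ratio (s * i%:R / n%:R) (s * i.+1%:R / n%:R) x <= 0).
Proof.
move=> Wx gn s01; have n0 : (0 < n)%N by apply: leq_trans (ltn_ord i).
have nR : (0 : R) < n%:R by rewrite ltr0n.
have /andP[? ?] := lift_frac n0 (ltnW (ltn_ord i)) s01.
have /andP[? ?] := lift_frac n0 (ltn_ord i) s01.
case/andP: s01 => s0 s1.
apply: gn => //; first by rewrite ler_pM2r ?invr_gt0 // ler_wpM2l // ler_nat.
by rewrite -mulrBl divfK ?gt_eqF // -mulrBr -natrB // subSnn mulr1.
Qed.

Lemma lift_sqr d n x (s : R) : W x -> (0 < n)%N -> good n x -> 0 <= s <= 1 ->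
  d ^+ 2 = h x0 -> G d n x s ^+ 2 = H s x.
Proof.
move=> Wx n0 gn s01 d2; rewrite exprMn d2 -prodrXl.
under eq_bigr => i _ do rewrite (sqr_psqrt (lift_good_slit i Wx gn s01)).
have nR : (n%:R : R) != 0 by rewrite pnatr_eq0 -lt0n.
suff E k : (k <= n)%N ->
    h x0 * \prod_(i < k) ratio (s * i%:R / n%:R) (s * i.+1%:R / n%:R) x =
    H (s * k%:R / n%:R) x.
  by rewrite E // mulfK.
elim: k => [|k IH] kn.
  by rewrite big_ord0 mulr1 mulr0 mul0r /H c0.
rewrite big_ord_recr /= mulrA IH 1?ltnW // /ratio mulrC divfK //.
exact: lift_H0 (lift_frac n0 (ltnW kn) s01) Wx.
Qed.

Lemma lift_ratio_cont (S : topologicalType) (a b : S -> R) (y : S -> T) z :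
  {for z, continuous a} -> {for z, continuous b} -> {for z, continuous y} ->
  0 <= a z <= 1 -> 0 <= b z <= 1 -> W (y z) ->
  {for z, continuous (fun z => ratio (a z) (b z) (y z))}.
Proof.
move=> ca cb cy a01 b01 Wy.
have K (e : S -> R) : {for z, continuous e} -> 0 <= e z <= 1 ->
    {for z, continuous (fun z => H (e z) (y z))}.
  move=> ce e01.
  exact: (@at_comp _ _ _ (fun z => (e z, y z)) (fun y : R * T => H y.1 y.2) _
    (at_pair ce cy) (lift_H_cont e01 Wy)).
exact: (atM (K _ cb b01) (atV (K _ ca a01) (lift_H0 a01 Wy))).
Qed.

Lemma lift_G_cont (S : topologicalType) d n (s : S -> R) (y : S -> T) z :
  {for z, continuous s} -> {for z, continuous y} -> (0 < n)%N ->
  0 <= s z <= 1 -> W (y z) -> good n (y z) ->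
  {for z, continuous (fun z => G d n (y z) (s z))}.
Proof.
move=> cs cy n0 s01 Wy gn.
apply: (atM (@at_cst S C d z)).
apply: at_prod => i.
have cm k : {for z, continuous (fun z => s z * k%:R / n%:R)}.
  by move=> A; apply: cvgM; [apply: cvgM => //|]; exact: cvg_cst.
apply: (@at_comp _ _ _ (fun z => ratio (s z * i%:R / n%:R) (s z * i.+1%:R / n%:R) (y z)) psqrt).
  apply: lift_ratio_cont; [exact: cm|exact: cm|exact: cy| | |exact: Wy].
    exact: (lift_frac n0 (ltnW (ltn_ord i)) s01).
  exact: (lift_frac n0 (ltn_ord i) s01).
exact/psqrt_continuous/lift_good_slit.
Qed.

(** Both products are continuous roots of [h] along the path of [x], and both equal [d] at time 0,
    where every ratio is 1. So the sign between them is 1 all along the path. *)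
Lemma lift_indep d n m x : W x -> (0 < n)%N -> (0 < m)%N -> good n x -> good m x ->
  d ^+ 2 = h x0 -> G d n x 1 = G d m x 1.
Proof.
move=> Wx n0 m0 gn gm d2.
have [||||s _ e] := @sqrt_sign R `[0, 1] (H^~ x) (G d n x) (G d m x).
- exact: segment_connected.
- by move=> s /=; rewrite in_itv /= => s01; exact: lift_H0.
- move=> s /=; rewrite in_itv /= => s01; split; first exact: lift_sqr.
  exact: (@lift_G_cont R d n id (fun=> x) s (@at_id R s) (@at_cst R T x s) n0 s01 Wx gn).
- move=> s /=; rewrite in_itv /= => s01; split; first exact: lift_sqr.
  exact: (@lift_G_cont R d m id (fun=> x) s (@at_id R s) (@at_cst R T x s) m0 s01 Wx gm).
have G0 k : G d k x 0 = d.
  rewrite /G big1 ?mulr1 // => i _; rewrite !mul0r /ratio divff ?psqrt1 //.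
  by rewrite lift_H0 // lexx ler01.
have z01 : `[0, 1]%classic (0 : R) by rewrite /= in_itv /= lexx ler01.
have o01 : `[0, 1]%classic (1 : R) by rewrite /= in_itv /= lexx ler01.
have d0 : d != 0.
  by rewrite -sqrf_eq0 d2 -(c0 Wx) -/(H 0 x) lift_H0 // lexx ler01.
have := e 0 z01; rewrite !G0 => /esym ds.
have s1 : s = 1 by apply: (mulIf d0); rewrite ds mul1r.
by rewrite (e 1 o01) s1 mul1r.
Qed.

(** On the diagonal of the parameter square the ratio is 1, so it avoids the slit near each pair
    [(a0, a0)], also for nearby points. Compactness of the segment makes one [n] serve all
    parameters and a whole neighbourhood of [x]. *)
Lemma lift_good_near x : W x ->
  exists2 n, (0 < n)%N & \forall y \near x, good n y.
Proof.
move=> Wx.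
pose P (i : nat * T) (a : R) := forall b : R, 0 <= a -> a <= b -> b <= 1 ->
  (b - a) * i.1%:R <= 1 -> ~~ (ratio a b i.2 <= 0).
have : \forall i \near filter_prod \oo (nbhs x), `[0, 1] `<=` P i.
  have /compact_near_coveringP := @segment_compact R 0 1; apply.
  move=> a0 /=; rewrite in_itv /= => a01.
  have cr : {for ((a0, a0), x),
      continuous (fun z : R * R * T => ratio z.1.1 z.1.2 z.2)}.
    have f1 : {for ((a0, a0), x), continuous (@fst (R * R) T)} by exact: cvg_fst.
    have f2 : {for ((a0, a0), x), continuous (@snd (R * R) T)} by exact: cvg_snd.
    have g1 : {for (a0, a0), continuous (@fst R R)} by exact: cvg_fst.
    have g2 : {for (a0, a0), continuous (@snd R R)} by exact: cvg_snd.
    exact: (@lift_ratio_cont _ (fun z => z.1.1) (fun z => z.1.2) snd ((a0, a0), x)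
      (at_comp f1 g1) (at_comp f1 g2) f2 a01 a01 Wx).
  have := at_open cr open_slit.
  rewrite /= /ratio divff ?lift_H0 // npos_ReIm Re1 ler10 andbF => /(_ isT).
  move=> [[A O] /= [[[A1 A2] /= [nA1 nA2] sA] nO] sAO].
  have /nbhs_ballP[e /= e0 eA] : nbhs a0 (A1 `&` A2) by exact: filterI.
  have e20 : 0 < e / 2 by rewrite divr_gt0.
  (* For [n > 2 / e] the step [b - a] is below [e / 2]; with [a] within [e / 2] of [a0], both ends
     lie within [e] of [a0]. *)
  pose N := Num.truncn (2 / e).
  exists (ball a0 (e / 2), [set i | (N < i.1)%N /\ O i.2]).
    split; first exact: nbhsx_ballx.
    exists ([set n | (N < n)%N], O); last by move=> [].
    by split=> //; exists N.+1.
  move=> [a [n y]] /= [ha [hn Oy]] b a_ge0 ab b_le1 hab.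
  apply: (sAO ((a, b), y)); split=> //=; apply: sA; split=> /=.
    have [] // := eA a; move: ha; rewrite /ball /=; lra.
  have [] // := eA b; move: ha; rewrite /ball /= => ha.
  have nR : (0 : R) < n%:R by rewrite ltr0n (leq_ltn_trans _ hn).
  have nN : 2 / e < n%:R.
    by rewrite (lt_le_trans (truncnS_gt _)) // ler_nat.
  have : b - a < e / 2.
    rewrite -(ltr_pM2r nR); apply: le_lt_trans hab _.
    by rewrite mulrC -ltr_pdivrMr // invf_div mul1r.
  have := ler_normB (a0 - a) (b - a); rewrite (ger0_norm (x := b - a)) ?subr_ge0 //.
  by rewrite [a0 - a - (b - a)](_ : _ = a0 - b); [lra|ring].
move=> [[S O] /= [nS nO] sSO].
have [N _ hN] := nS.
exists N.+1 => //; apply: filterS nO => y Oy a b a0 ab b1 hab.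
have SO : (S `*` O) (N.+1, y) by split; [exact: (hN N.+1 (leqnSn N))|exact: Oy].
apply: (sSO _ SO a _ b a0 ab b1 hab).
by rewrite /= in_itv /= a0 (le_trans ab b1).
Qed.

Lemma contractible_sqrt : has_sqrt h W.
Proof.
have [d d2] := sqrt_ex (h x0).
have ex x : exists n, W x -> (0 < n)%N /\ good n x.
  have [Wx|nWx] := pselect (W x); last by exists 0%N.
  by have [n n0 /nbhs_singleton gn] := lift_good_near Wx; exists n.
have [N hN] := choice ex.
have o01 : 0 <= (1 : R) <= 1 by rewrite ler01 lexx.
exists (fun x => G d (N x) x 1) => x Wx; have [n0 gn] := hN x Wx.
split; first by rewrite (lift_sqr Wx n0 gn o01 d2) /H c1.
(* [N] is chosen pointwise, without continuity. Near [x] a fixed [m] is fine enough, and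
   [lift_indep] identifies the two products there. *)
have [m m0 gm] := lift_good_near Wx.
apply: (@at_near _ _ (fun y => G d m y 1)); last first.
  exact: (@lift_G_cont T d m (fun=> 1) id x (@at_cst T R 1 x) (@at_id T x) m0 o01 Wx
    (nbhs_singleton gm)).
have Wn : nbhs x W by exact: open_nbhs_nbhs.
apply: filterS2 Wn gm => y Wy gy; have [Ny gNy] := hN y Wy.
exact: lift_indep.
Qed.

End Contractible.

End ComplexSqrt.

(** * Planar domains with finitely many punctures, and polydiscs *)

Section Plane.
Variable R : realType.
Local Notation C := (Cx R).
Local Notation toC := (@toC R).
Local Notation Re := (@Re R).
Local Notation Im := (@Im R).
Local Notation iC := (@iC R).

Lemma star_connected (T : topologicalType) (W : set T) (c : R * T -> T) (x0 : T) :
  (forall (s : R) x, 0 <= s <= 1 -> W x -> {for (s, x), continuous c}) ->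
  (forall (s : R) x, 0 <= s <= 1 -> W x -> W (c (s, x))) ->
  (forall x, W x -> c (1, x) = x) -> (forall x, W x -> c (0, x) = x0) ->
  connected W.
Proof.
move=> cc cin c1 c0.
have z01 : `[0, 1]%classic (0 : R) by rewrite /= in_itv /= lexx ler01.
have o01 : `[0, 1]%classic (1 : R) by rewrite /= in_itv /= lexx ler01.
have -> : W = \bigcup_(x in W) ((fun s => c (s, x)) @` `[0, 1]).
  apply/seteqP; split=> [x Wx|_ [x Wx [s s01 <-]]].
    by exists x => //; exists 1 => //; exact: c1.
  by apply: cin => //; move: s01; rewrite /= in_itv.
apply: bigcup_connected.
  by exists x0 => x Wx; exists 0 => //; exact: c0.
move=> x Wx; apply: connected_continuous_connected; first exact: segment_connected.
apply: continuous_in_subspaceT => s /set_mem /=; rewrite in_itv /= => s01.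
exact: (@at_comp R _ _ (fun s => (s, x)) c s (at_pair (@at_id R s) (@at_cst R _ x s))
  (cc s x s01 Wx)).
Qed.

Definition convexC (X : set C) := forall x y (t : R), X x -> X y -> 0 <= t <= 1 ->
  X (x + toC t * (y - x)).

Lemma affine_cont (x y : C) (t : R) : {for t, continuous (fun t => x + toC t * (y - x))}.
Proof.
exact: (atD (@at_cst R C x t) (atM (@real_complex_continuous R t) (@at_cst R C (y - x) t))).
Qed.

Lemma segment_connectedC (x y : C) :
  connected ((fun t => x + toC t * (y - x)) @` `[0, 1]).
Proof.
apply: connected_continuous_connected; first exact: segment_connected.
by apply: continuous_in_subspaceT => t _; exact: affine_cont.
Qed.

Lemma pos_avoid (s : seq R) (e : R) : 0 < e ->
  exists2 t, 0 < t < e & t \notin s.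
Proof.
move=> e0.
suff [e' e'0 [e'e he']] : exists2 e', 0 < e' & e' <= e /\ forall x, x \in s -> ~~ (0 < x < e').
  exists (e' / 2); first by apply/andP; split; lra.
  by apply: contraPN (he' (e' / 2)) => xs /(_ xs) /negP; apply; apply/andP; split; lra.
elim: s => [|x s [e' e'0 [e'e he']]]; first by exists e.
have [x0|x0] := ltP 0 x.
  exists (Num.min x e'); first by rewrite lt_min x0.
  split; first by rewrite ge_min e'e orbT.
  move=> y; rewrite inE => /orP[/eqP->|/he']; first by rewrite lt_min ltxx andbF.
  by apply: contra; rewrite lt_min => /and3P[-> _ ->].
exists e' => //; split=> // y; rewrite inE => /orP[/eqP->|/he'//].
by rewrite ltNge x0.
Qed.

(** A point [q] is joined to a base point [p] by a broken line whose corner [r t] lies on the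
    perpendicular bisector of the segment from [p] to [q]. For small [t] it stays in [X], because
    [X] is open and convex. *)
Lemma punctured_connected (X A : set C) :
  open X -> convexC X -> finite_set A -> connected (X `\` A).
Proof.
move=> oX cX /finite_seqP[s As].
have [[p XAp]|XA0] := pselect (exists p, (X `\` A) p); last first.
  rewrite (_ : X `\` A = set0); first exact: connected0.
  by apply/seteqP; split=> // x XAx; apply: XA0; exists x.
suff H q : (X `\` A) q -> exists2 K : set C, K `<=` X `\` A & [/\ connected K, K p & K q].
  have ex q : exists K : set C,
      (X `\` A) q -> [/\ K `<=` X `\` A, connected K, K p & K q].
    have [/H[K KXA [? ? ?]]|?] := pselect ((X `\` A) q); last by exists set0.
    by exists K.
  have [F HF] := choice ex.
  have -> : X `\` A = \bigcup_(q in X `\` A) F q.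
    apply/seteqP; split=> [q XAq|q [r XAr Fq]]; last by have [K _ _ _] := HF r XAr; exact: K.
    by exists q => //; have [] := HF q XAq.
  apply: bigcup_connected; last by move=> q /HF[].
  by exists p => q /HF[].
move=> [Xq Aq]; have [->|qp] := eqVneq q p.
  by exists [set p] => [_ ->//|]; split=> //; exact: connected1.
have [Xp Ap] := XAp.
have d0 : q - p != 0 by rewrite subr_eq0.
have d0' : p - q != 0 by rewrite subr_eq0 eq_sym.
pose h : C := toC (1 / 2).
pose r (t : R) : C := p + (h + toC t * iC) * (q - p).
have r'E t : r t = q + (h - toC t * iC) * (p - q).
  have hh : h + h = 1 by rewrite /h -[LHS]rmorphD -splitr [LHS]rmorph1.
  rewrite /r; apply/eqP; rewrite -subr_eq0; apply/eqP.
  rewrite [LHS](_ : _ = (h + h - 1) * (q - p)); first by rewrite hh subrr mul0r.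
  by ring.
have Xr0 : X (r 0).
  rewrite /r toC0 mul0r addr0; apply: cX => //.
  by rewrite divr_ge0 ?ler01 ?ler0n //= ler_pdivrMr ?ltr0n // mul1r ler1n.
have cr : {for 0, continuous r}.
  apply: (atD (@at_cst R C p 0)).
  refine (atM (atD (@at_cst R C h 0) _) (@at_cst R C _ 0)).
  exact: (atM (@real_complex_continuous R 0) (@at_cst R C iC 0)).
have [e /= e0 eX] : nbhs_ball (0 : R) (r @^-1` X).
  by apply/nbhs_ballP; exact: (at_open cr oX Xr0).
(* The paths [p -- r t -- q] pairwise meet only in [p] and [q], so all but finitely
   many of them avoid [A]. *)
pose bad := [seq Im ((a - p) / (q - p)) / (2 * Re ((a - p) / (q - p))) | a <- s] ++
  [seq - Im ((a - q) / (p - q)) / (2 * Re ((a - q) / (p - q))) | a <- s].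
have [t /andP[t0 te]] := pos_avoid bad e0; rewrite mem_cat negb_or => /andP[b1 b2].
have Xr : X (r t) by apply: eX; rewrite /ball /= sub0r normrN gtr0_norm.
pose K1 := (fun u => p + toC u * (r t - p)) @` `[0, 1].
pose K2 := (fun u => q + toC u * (r t - q)) @` `[0, 1].
have z01 : `[0, 1]%classic (0 : R) by rewrite /= in_itv /= lexx ler01.
have o01 : `[0, 1]%classic (1 : R) by rewrite /= in_itv /= lexx ler01.
have Reh : Re h = 1 / 2 by [].
have Imh : Im h = 0 by [].
(* The slope seen from an end point recovers the parameter of the path; seen from [q] the parameter
   is [- t]. Each puncture thus excludes at most one [t] on either half. *)
have core (u tt : R) : u != 0 ->
    Im (toC u * (h + toC tt * iC)) / (2 * Re (toC u * (h + toC tt * iC))) = tt.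
  move=> u0; rewrite !(ReM, ImM, ReD, ImD, Re_toC, Im_toC, Reh, Imh, Re_iC, Im_iC).
  by field.
have K1A a : K1 a -> ~ A a.
  move=> [u _ <-]; have [->|u0] := eqVneq u 0; first by rewrite toC0 mul0r addr0.
  rewrite As => /= as_; move/negP: b1; apply; apply/mapP.
  exists (p + toC u * (r t - p)) => //.
  have -> : (p + toC u * (r t - p) - p) / (q - p) = toC u * (h + toC t * iC).
    by rewrite /r; field.
  by rewrite core.
have K2A a : K2 a -> ~ A a.
  move=> [u _ <-]; have [->|u0] := eqVneq u 0; first by rewrite toC0 mul0r addr0.
  rewrite As => /= as_; move/negP: b2; apply; apply/mapP.
  exists (q + toC u * (r t - q)) => //.
  have -> : (q + toC u * (r t - q) - q) / (p - q) = toC u * (h + toC (- t) * iC).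
    by rewrite r'E /toC rmorphN; field.
  by rewrite mulNr core // opprK.
exists (K1 `|` K2).
  move=> a [Ka|Ka]; split; [|exact: K1A| |exact: K2A].
    by case: Ka => u /=; rewrite in_itv /= => u01 <-; exact: cX.
  by case: Ka => u /=; rewrite in_itv /= => u01 <-; exact: cX.
split; last 2 first.
- by left; exists 0 => //; rewrite toC0 mul0r addr0.
- by right; exists 0 => //; rewrite toC0 mul0r addr0.
apply: connectedU; [|exact: segment_connectedC|exact: segment_connectedC].
exists (r t); split; exists 1 => //; rewrite toC1 mul1r; ring.
Qed.

(** The points up to which [P] holds, starting from [a], form a nonempty subset of the segment that
    is open and closed in it. The margin [e] at each end makes successive intervals overlap, as
    gluing demands. *)
Lemma cousin (P : R -> R -> Prop) (a b : R) : a <= b ->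
  (forall x, a <= x <= b -> exists2 e, 0 < e & P (x - e) (x + e)) ->
  (forall u v u' v', P u v -> u <= u' -> v' <= v -> P u' v') ->
  (forall u v u' v', u <= u' -> u' < v -> v <= v' -> P u v -> P u' v' -> P u v') ->
  exists2 e, 0 < e & P (a - e) (b + e).
Proof.
move=> ab Ploc Pmono Pglue.
pose S : set R := [set x | exists2 e, 0 < e & P (a - e) (x + e)].
suff e : [set` `[a, b]] `&` S = [set` `[a, b]].
  by have [] : ([set` `[a, b]] `&` S) b by rewrite e /= in_itv /= ab lexx.
apply: segment_connected.
- exists a; split; first by rewrite /= in_itv /= ab lexx.
  by apply: Ploc; rewrite lexx ab.
- exists S => //; rewrite openE => x [e e0 Pe].
  exists (e / 2) => /=; first by rewrite divr_gt0.
  move=> y; rewrite /ball /= => xy.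
  exists (e / 2); first by rewrite divr_gt0.
  by apply: Pmono Pe _ _; move: xy; rewrite ltr_norml => /andP[? ?]; lra.
exists ([set` `[a, b]] `&` S); last by rewrite setIA setIid.
move=> x clx.
have abx : x \in `[a, b] by apply: interval_closed; have /closureI [] := clx.
split=> //; have [d d0 Pd] := Ploc x abx.
have [y [[aby [e e0 Pe]] xy]] := clx _ (nbhsx_ballx x d d0).
have {}xy : `|x - y| < d by [].
have [yx xy'] : y < x + d /\ x - d < y by move: xy; rewrite ltr_norml => /andP[? ?]; lra.
(* In this case the interval around [x] already extends to the left of [a], and no gluing takes
   place. *)
have [ax|ax] := ltP (x - d) a.
  pose e1 := Num.min d (a - (x - d)).
  exists e1; first by rewrite lt_min d0 subr_gt0.
  have h1 : e1 <= d by rewrite ge_min lexx.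
  have h2 : e1 <= a - (x - d) by rewrite ge_min lexx orbT.
  by apply: Pmono Pd _ _; lra.
pose e1 := Num.min e (x + d - y).
have e10 : 0 < e1 by rewrite lt_min e0; lra.
have h1 : e1 <= e by rewrite ge_min lexx.
have h2 : e1 <= x + d - y by rewrite ge_min lexx orbT.
have Pe1 : P (a - e1) (y + e1) by apply: Pmono Pe _ _; lra.
have Pg : P (a - e1) (x + d) by apply: Pglue Pe1 Pd; lra.
exists (Num.min e1 d); first by rewrite lt_min e10.
have h3 : Num.min e1 d <= e1 by rewrite ge_min lexx.
have h4 : Num.min e1 d <= d by rewrite ge_min lexx orbT.
by apply: Pmono Pg _ _; lra.
Qed.

Definition rect (u v u' v' : R) : set C := [set z | u < Re z < v /\ u' < Im z < v'].

Lemma rect_open u v u' v' : open (rect u v u' v').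
Proof.
have -> : rect u v u' v' = (Re @^-1` [set` `]u, v[]) `&` (Im @^-1` [set` `]u', v'[]).
  by apply/seteqP; split=> z /=; rewrite !in_itv.
apply: openI; apply: open_comp => [x _|].
- exact: Re_continuous.
- exact: interval_open.
- exact: Im_continuous.
- exact: interval_open.
Qed.

Lemma conv_gt (u x y t : R) : u < x -> u < y -> 0 <= t <= 1 -> u < x + t * (y - x).
Proof. by move=> ux uy /andP[t0 t1]; have [xy|yx] := leP x y; nra. Qed.

Lemma conv_lt (v x y t : R) : x < v -> y < v -> 0 <= t <= 1 -> x + t * (y - x) < v.
Proof. by move=> ux uy /andP[t0 t1]; have [xy|yx] := leP x y; nra. Qed.

Lemma rect_convex u v u' v' : convexC (rect u v u' v').
Proof.
move=> x y t [/andP[? ?] /andP[? ?]] [/andP[? ?] /andP[? ?]] t01.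
rewrite /rect /= !(ReD, ImD, ReM, ImM, ReN, ImN, Re_toC, Im_toC) !mul0r subr0 addr0.
by rewrite !conv_gt ?conv_lt.
Qed.

Lemma rect_nbhs (z : C) (O : set C) : nbhs z O ->
  exists2 e, 0 < e & rect (Re z - e) (Re z + e) (Im z - e) (Im z + e) `<=` O.
Proof.
move=> /nbhs_ballP[e' /pos_toC[e e0 ->] eO].
exists (e / 2) => [|y [/andP[? ?] /andP[? ?]]]; first by rewrite divr_gt0.
apply: eO; rewrite /ball /= [e](_ : _ = 2 * (e / 2)); last by field.
by apply: norm_lt_ReIm; rewrite ?divr_gt0 // ?ReB ?ImD ?ImN ltr_norml; apply/andP; split; lra.
Qed.

Lemma finite_closedC (A : set C) : finite_set A -> closed A.
Proof.
apply: (iffLR (@accessible_finite_set_closed C)).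
exact/hausdorff_accessible/(@norm_hausdorff C C).
Qed.

(* Cousin's lemma is applied in the two directions in turn; two overlapping rectangles
   are glued along their intersection, which stays connected without [A]. *)
Lemma plane_sqrt (h : C -> C) (A : set C) : finite_set A ->
  (forall z : C, ~ A z -> h z != 0) ->
  (forall z : C, exists2 O : set C, nbhs z O & has_sqrt h (O `\` A)) ->
  forall u v u' v', has_sqrt h (rect u v u' v' `\` A).
Proof.
move=> fA h0 hloc u v u' v'.
have oA X : open X -> open (X `\` A).
  by move=> oX; rewrite setDE; exact: openI oX (closed_openC (finite_closedC fA)).
pose Q a b c d := has_sqrt h (rect a b c d `\` A).
have Qmono a b c d a1 b1 c1 d1 : a <= a1 -> b1 <= b -> c <= c1 -> d1 <= d ->
    Q a b c d -> Q a1 b1 c1 d1.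
  move=> ? ? ? ?; apply: has_sqrtS => z [[/andP[? ?] /andP[? ?]] ?]; split=> //.
  by split; apply/andP; split; lra.
have Qcut X Y Z : open X -> open Y -> convexC (X `&` Y) -> Z `<=` X `|` Y ->
    has_sqrt h (X `\` A) -> has_sqrt h (Y `\` A) -> has_sqrt h (Z `\` A).
  move=> oX oY cXY ZXY hX hY.
  apply: (@has_sqrtS _ _ _ _ ((X `\` A) `|` (Y `\` A))).
    by move=> z [/ZXY[]]; [left|right].
  apply: has_sqrtU => //; try exact: oA.
    have -> : (X `\` A) `&` (Y `\` A) = (X `&` Y) `\` A.
      by apply/seteqP; split=> z; [move=> [[? ?] []]|move=> [[]]].
    by apply: punctured_connected => //; exact: openI.
  by move=> z [[_ /h0]].
have [uv|uv] := leP u v; last first.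
  exists (fun=> 0) => z [[/andP[h1 h2]]]; exfalso; lra.
have [uv'|uv'] := leP u' v'; last first.
  exists (fun=> 0) => z [[_ /andP[h1 h2]]]; exfalso; lra.
have strip y : exists2 e, 0 < e & Q u v (y - e) (y + e).
  pose P a b := exists2 e, 0 < e & Q a b (y - e) (y + e).
  have [] := @cousin P u v uv.
  - move=> x _; have [O nO hO] := hloc (toC x + toC y * iC).
    have [e e0 eO] := rect_nbhs nO; exists e => //; exists e => //.
    apply: has_sqrtS hO => z [rz ?]; split=> //; apply: eO; move: rz.
    by rewrite Re_mk Im_mk.
  - move=> a b a1 b1 [e e0 hQ] ? ?; exists e => //.
    by apply: Qmono hQ.
  - move=> a b a1 b1 h1 h2 h3 [e e0 hQ] [e' e'0 hQ'].
    pose e1 := Num.min e e'.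
    have h4 : e1 <= e by rewrite ge_min lexx.
    have h5 : e1 <= e' by rewrite ge_min lexx orbT.
    exists e1; first by rewrite lt_min e0.
    apply: (Qcut (rect a b (y - e1) (y + e1)) (rect a1 b1 (y - e1) (y + e1))).
    + exact: rect_open.
    + exact: rect_open.
    + have -> : rect a b (y - e1) (y + e1) `&` rect a1 b1 (y - e1) (y + e1) =
          rect a1 b (y - e1) (y + e1).
        apply/seteqP; split=> z; rewrite /rect /=.
          by move=> [[/andP[? ?] ?] [/andP[? ?] ?]]; split=> //; apply/andP.
        move=> [/andP[? ?] ?]; split; split=> //; apply/andP; split; lra.
      exact: rect_convex.
    + move=> z [/andP[? ?] ?]; have [?|?] := ltP (Re z) b; [left|right].
        by split=> //; apply/andP.
      by split=> //; apply/andP; split; lra.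
    + by apply: Qmono hQ; lra.
    + by apply: Qmono hQ'; lra.
  move=> e e0 [e' e'0 hQ]; exists e' => //.
  by apply: Qmono hQ; lra.
have [] := @cousin (Q u v) u' v' uv'.
- by move=> y _; exact: strip.
- by move=> a b a1 b1 hQ ? ?; apply: Qmono hQ.
- move=> a b a1 b1 h1 h2 h3 hQ hQ'.
  apply: (Qcut (rect u v a b) (rect u v a1 b1)) => //.
  + exact: rect_open.
  + exact: rect_open.
  + have -> : rect u v a b `&` rect u v a1 b1 = rect u v a1 b.
      apply/seteqP; split=> z; rewrite /rect /=.
        by move=> [[? /andP[? ?]] [? /andP[? ?]]]; split=> //; apply/andP.
      move=> [? /andP[? ?]]; split; split=> //; apply/andP; split; lra.
    exact: rect_convex.
  + move=> z [? /andP[? ?]]; have [?|?] := ltP (Im z) b; [left|right].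
      by split=> //; apply/andP.
    by split=> //; apply/andP; split; lra.
by move=> e e0 hQ; apply: Qmono hQ; lra.
Qed.

(** For a root [g] of the identity, [k z = i g(-z) / g(z)] squares to 1, hence is constant on a
    punctured square. But [k z] times [k (- z)] is [i ^ 2 = -1], while constancy makes it 1. *)
Lemma no_sqrt_id (O : set C) : nbhs 0 O -> ~ has_sqrt (@id C) (O `\ 0).
Proof.
move=> nO [g hg]; have [e e0 eO] := rect_nbhs nO.
rewrite Re0 Im0 !sub0r !add0r in eO.
pose X := rect (- e) e (- e) e.
have Xn z : (X `\ 0) z -> (X `\ 0) (- z).
  move=> [[/andP[h1 h2] /andP[h3 h4]] z0]; split.
    by rewrite /X /rect /= ReN ImN; split; apply/andP; split; lra.
  by move=> /eqP; rewrite oppr_eq0 => /eqP.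
have hX z : (X `\ 0) z -> [/\ z != 0, g z ^+ 2 = z & {for z, continuous g}].
  move=> [Xz z0]; have [] := hg z _; first by split=> //; exact: eO.
  by split=> //; exact/eqP.
have cX : connected (X `\ 0).
  by apply: punctured_connected; [exact: rect_open|exact: rect_convex|exact: finite_set1].
pose k z := g (- z) / g z * iC.
have iC2 : iC ^+ 2 = -1.
  by apply: complex_ext; rewrite expr2 ?ReM ?ImM ?ReN ?ImN ?Re1 ?Im1 Re_iC Im_iC; ring.
have g0 z : (X `\ 0) z -> g z != 0.
  by move=> /hX[z0 e2 _]; rewrite -sqrf_eq0 e2.
have hk z : (X `\ 0) z -> k z ^+ 2 = 1 /\ {for z, continuous k}.
  move=> Xz; have [z0 e2 cg] := hX z Xz; have [_ e2' cg'] := hX _ (Xn z Xz).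
  split; first by rewrite !exprMn iC2 exprVn e2 e2' mulNr divff // mulrNN mulr1.
  refine (atM (atM _ (atV cg (g0 z Xz))) (@at_cst C C iC z)).
  exact: (@at_comp _ _ _ (fun z => - z) g z (atN (@at_id C z)) cg').
pose z := toC (e / 2).
have Xz : (X `\ 0) z.
  split; last by move/eqP; rewrite toC_eq0 gt_eqF // divr_gt0.
  by split; rewrite /z ?Re_toC ?Im_toC; apply/andP; split; lra.
have := connected_sqr1 cX hk Xz (Xn z Xz) => kk.
have : k z * k (- z) = -1.
  rewrite /k opprK mulrACA -expr2 iC2 [X in X * _](_ : _ = 1) ?mul1r //.
  by have := g0 _ Xz; have := g0 _ (Xn z Xz) => ? ?; field; apply/andP.
rewrite -kk -expr2 (hk z Xz).1 => /eqP; rewrite -addr_eq0 -mulr2n.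
by rewrite pnatr_eq0.
Qed.


Definition polydisc (e : R) : set (C * C) :=
  rect (- e) e (- e) e `*` rect (- e) e (- e) e.

Lemma polydisc_open e : open (polydisc e).
Proof.
apply: openI; apply: open_comp => [x _|].
- exact: cvg_fst.
- exact: rect_open.
- exact: cvg_snd.
- exact: rect_open.
Qed.

(* The segment from [(p, 0)] to [z.2], at time [z.1]. *)
Definition lineC2 (p : C) (z : R * (C * C)) : C * C :=
  (p + toC z.1 * (z.2.1 - p), toC z.1 * z.2.2).

Lemma lineC2_cont (p : C) z : {for z, continuous (lineC2 p)}.
Proof.
have f1 : {for z, continuous (@fst R (C * C))} by exact: cvg_fst.
have f2 : {for z, continuous (@snd R (C * C))} by exact: cvg_snd.
have g1 : {for z.2, continuous (@fst C C)} by exact: cvg_fst.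
have g2 : {for z.2, continuous (@snd C C)} by exact: cvg_snd.
have ct : {for z, continuous (fun z : R * (C * C) => toC z.1)}.
  exact: (at_comp f1 (@real_complex_continuous R z.1)).
apply: at_pair; last exact: (atM ct (at_comp f2 g2)).
apply: (atD (@at_cst _ C p z)).
exact: (atM ct (atD (at_comp f2 g1) (@at_cst _ C (- p) z))).
Qed.

Lemma lineC2_polydisc (e : R) (p : C) (s : R) (x y : C) :
  0 < e -> `|Re p| < e -> `|Im p| < e -> 0 <= s <= 1 ->
  polydisc e (x, y) -> polydisc e (lineC2 p (s, (x, y))).
Proof.
move=> e0 p1 p2 s01 [/= Dx Dy].
have Dp : rect (- e) e (- e) e p by split; rewrite -ltr_norml.
have D0 : rect (- e) e (- e) e 0 by split; rewrite ?Re0 ?Im0 oppr_lt0 e0.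
have := rect_convex D0 Dy s01; rewrite subr0 add0r => Dsy.
by split; [exact: rect_convex Dp Dx s01|exact: Dsy].
Qed.

(** Star-shaped about [(p, 0)]. The centre is left free because the sets considered omit the
    origin. *)
Definition starC2 (W : set (C * C)) := exists p : C,
  forall s x y, 0 <= s <= 1 -> W (x, y) -> W (lineC2 p (s, (x, y))).

Lemma lineC2_0 (p : C) x : lineC2 p (0, x) = (p, 0).
Proof. by rewrite /lineC2 /= toC0 !mul0r addr0. Qed.

Lemma lineC2_1 (p : C) x : lineC2 p (1, x) = x.
Proof. by case: x => x y; rewrite /lineC2 /= toC1 !mul1r addrC subrK. Qed.

Lemma starC2_connected W : starC2 W -> connected W.
Proof.
move=> [p hp]; apply: (@star_connected _ W (lineC2 p) (p, 0)).
- by move=> s x _ _; exact: lineC2_cont.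
- by move=> s [x y]; exact: hp.
- by move=> x _; exact: lineC2_1.
- by move=> x _; exact: lineC2_0.
Qed.

Lemma starC2_sqrt (W : set (C * C)) (h : C * C -> C) : starC2 W -> open W ->
  (forall x, W x -> h x != 0 /\ {for x, continuous h}) -> has_sqrt h W.
Proof.
move=> [p hp] oW hW; apply: (@contractible_sqrt R _ W (lineC2 p) h _ _ _ (p, 0)) => //.
- by move=> s x _ _; exact: lineC2_cont.
- by move=> s [x y]; exact: hp.
- by move=> x _; exact: lineC2_1.
- by move=> x _; exact: lineC2_0.
Qed.

(* Off either half of the real axis both functions have square roots; these differ by
   opposite signs on the upper and lower half-planes, and the signs cancel in the product. *)
Lemma slit_product_sqrt (e : R) (h k : C * C -> C) : 0 < e ->
  (forall z, polydisc e z -> z.1 != 0 ->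
    [/\ h z != 0, {for z, continuous h}, k z != 0 & {for z, continuous k}]) ->
  ~ has_sqrt h (polydisc e `&` [set z | z.1 != 0]) ->
  ~ has_sqrt k (polydisc e `&` [set z | z.1 != 0]) ->
  has_sqrt (fun z => h z * k z) (polydisc e `&` [set z | z.1 != 0]).
Proof.
move=> e0 hk nh nk.
pose W (P : set C) := polydisc e `&` [set z | P z.1].
pose P1 : set C := [set x | ~~ (x <= 0)].
pose P2 : set C := [set x | ~~ (0 <= x)].
pose U1 : set C := [set x | 0 < Im x].
pose U2 : set C := [set x | Im x < 0].
have oW P : open P -> open (W P).
  move=> oP; apply: openI; first exact: polydisc_open.
  by apply: open_comp => // x _; exact: cvg_fst.
have oP1 : open P1 by exact: open_slit.
have oP2 : open P2.
  have -> : P2 = -%R @^-1` P1 by apply/seteqP; split=> x; rewrite /P1 /P2 /= oppr_le0.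
  by apply: open_comp => // x _; exact: (atN (@at_id C x)).
have star P (p : C) : `|Re p| < e -> `|Im p| < e ->
    (forall s x, 0 <= s <= 1 -> P x -> P (p + toC s * (x - p))) -> starC2 (W P).
  move=> p1 p2 hP; exists p => s x y s01 [Dx Px]; split.
    exact: lineC2_polydisc.
  exact: hP.
have ne2 : `|e / 2| < e by rewrite gtr0_norm ?divr_gt0 //; lra.
have n0 : `|0 : R| < e by rewrite normr0.
have s1 : starC2 (W P1).
  apply: (star _ (toC (e / 2))); rewrite ?Re_toC ?Im_toC // => s x /andP[s0 s1].
  rewrite /P1 /= !npos_ReIm !negb_and -!ltNge.
  rewrite !(ReD, ImD, ReM, ImM, ReN, ImN, Re_toC, Im_toC) !mul0r !(subr0, addr0, add0r).
  have [->|s0'] := eqVneq s 0; first by rewrite !mul0r addr0 divr_gt0 // orbT.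
  rewrite mulf_eq0 (negPf s0') /= => /orP[->//|x0]; apply/orP; right.
  by apply: conv_gt; rewrite ?divr_gt0 // s0.
have s2 : starC2 (W P2).
  apply: (star _ (toC (- (e / 2)))); rewrite ?Re_toC ?Im_toC ?normrN // => s x /andP[s0 s1'].
  rewrite /P2 /= !nneg_ReIm !negb_and -!ltNge.
  rewrite !(ReD, ImD, ReM, ImM, ReN, ImN, Re_toC, Im_toC) !mul0r !(subr0, addr0, add0r).
  have [->|s0'] := eqVneq s 0; first by rewrite !mul0r addr0 oppr_lt0 divr_gt0 // orbT.
  rewrite mulf_eq0 (negPf s0') /= => /orP[->//|x0]; apply/orP; right.
  by apply: conv_lt; rewrite ?oppr_lt0 ?divr_gt0 // s0.
have cU1 : connected (W U1).
  apply/starC2_connected/(star _ (toC 0 + toC (e / 2) * iC));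
    rewrite ?Re_mk ?Im_mk // => s x s01.
  rewrite /U1 /= !(ReM, ImM, ImD, ReD, ImN, ReN, Re_mk, Im_mk, Re_toC, Im_toC, Re_iC, Im_iC).
  rewrite !(mul0r, mulr1, add0r, addr0) => x0; apply: conv_gt => //.
  by rewrite divr_gt0.
have cU2 : connected (W U2).
  apply/starC2_connected/(star _ (toC 0 + toC (- (e / 2)) * iC));
    rewrite ?Re_mk ?Im_mk ?normrN // => s x s01.
  rewrite /U2 /= !(ReM, ImM, ImD, ReD, ImN, ReN, Re_mk, Im_mk, Re_toC, Im_toC, Re_iC, Im_iC).
  rewrite !(mul0r, mulr1, add0r, addr0) => x0; apply: conv_lt => //.
  by rewrite oppr_lt0 divr_gt0.
have neq0 x : x != 0 <-> P1 x \/ P2 x.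
  rewrite /P1 /P2 /=; split; last first.
    by case; apply: contraNneq => ->; rewrite lexx.
  move=> x0; have [x_le|] := boolP (x <= 0); last by left.
  by right; apply: contra x0 => x_ge; rewrite eq_le x_le.
have WE : polydisc e `&` [set z | z.1 != 0] = W P1 `|` W P2.
  apply/seteqP; split=> [z [Dz /neq0[]]|z [] [Dz Pz]]; [by left|by right| |].
    by split=> //; apply/neq0; left.
  by split=> //; apply/neq0; right.
have signs (f : C * C -> C) :
    (forall z, polydisc e z -> z.1 != 0 -> f z != 0 /\ {for z, continuous f}) ->
    ~ has_sqrt f (polydisc e `&` [set z | z.1 != 0]) ->
    exists g1 g2 (s : C), [/\ s ^+ 2 = 1,
      forall z, W P1 z -> g1 z ^+ 2 = f z /\ {for z, continuous g1},
      forall z, W P2 z -> g2 z ^+ 2 = f z /\ {for z, continuous g2},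
      forall z, W U1 z -> g1 z = s * g2 z & forall z, W U2 z -> g1 z = - s * g2 z].
  move=> hf nf.
  have [g1 hg1] : has_sqrt f (W P1).
    apply: starC2_sqrt => //; first exact: oW.
    by move=> z [Dz Pz]; apply: hf => //; apply/neq0; left.
  have [g2 hg2] : has_sqrt f (W P2).
    apply: starC2_sqrt => //; first exact: oW.
    by move=> z [Dz Pz]; apply: hf => //; apply/neq0; right.
  have U1P z : W U1 z -> W P1 z /\ W P2 z.
    move=> [Dz]; rewrite /U1 /= => Uz.
    by split; split=> //; rewrite /P1 /P2 /= ?npos_ReIm ?nneg_ReIm gt_eqF.
  have U2P z : W U2 z -> W P1 z /\ W P2 z.
    move=> [Dz]; rewrite /U2 /= => Uz.
    by split; split=> //; rewrite /P1 /P2 /= ?npos_ReIm ?nneg_ReIm lt_eqF.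
  have f0 z : W P1 z -> f z != 0.
    by move=> [Dz Pz]; have [] := hf z Dz; [apply/neq0; left|].
  have [|||s s_1 hs] := @sqrt_sign R _ (W U1) f g1 g2 cU1.
  - by move=> z /U1P[/f0].
  - by move=> z /U1P[/hg1].
  - by move=> z /U1P[_ /hg2].
  have [|||t t_1 ht] := @sqrt_sign R _ (W U2) f g1 g2 cU2.
  - by move=> z /U2P[/f0].
  - by move=> z /U2P[/hg1].
  - by move=> z /U2P[_ /hg2].
  exists g1, g2, s; split=> //.
  have /eqP : t ^+ 2 = s ^+ 2 by rewrite t_1.
  rewrite eqf_sqr => /orP[]/eqP ts; last by move=> z /ht ->; rewrite ts.
  (* Equal signs on the two half-planes would let [g1] and [s * g2] be glued to a root of [f]; so
     the signs are opposite. *)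
  exfalso; apply: nf; rewrite WE; apply: (has_sqrt_glue _ _ s_1 hg1 hg2); try exact: oW.
  move=> z [Dz P1z] [_ P2z]; have [Iz|Iz|Iz] := ltgtP (Im z.1) 0.
  - by rewrite ht ?ts.
  - by rewrite hs.
  - move: P1z P2z; rewrite /P1 /P2 /= npos_ReIm nneg_ReIm Iz eqxx /= -!ltNge => h1 h2.
    by have := lt_trans h1 h2; rewrite ltxx.
have [g1 [g2 [s [s_1 hg1 hg2 hs hs']]]] :=
  signs h (fun z Dz z0 => let: And4 a b c d := hk z Dz z0 in conj a b) nh.
have [f1 [f2 [t [t_1 hf1 hf2 ht ht']]]] :=
  signs k (fun z Dz z0 => let: And4 a b c d := hk z Dz z0 in conj c d) nk.
rewrite WE.
apply: (@has_sqrt_glue _ _ _ (fun z => g1 z * f1 z) (fun z => g2 z * f2 z) _ _ (s * t)).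
- exact: oW.
- exact: oW.
- by rewrite exprMn s_1 t_1 mul1r.
- move=> z Wz; have [[e1 c1] [e2 c2]] := (hg1 z Wz, hf1 z Wz).
  by split; [rewrite exprMn e1 e2|exact: (atM c1 c2)].
- move=> z Wz; have [[e1 c1] [e2 c2]] := (hg2 z Wz, hf2 z Wz).
  by split; [rewrite exprMn e1 e2|exact: (atM c1 c2)].
move=> z [Dz P1z] [_ P2z]; have [Iz|Iz|Iz] := ltgtP (Im z.1) 0.
- by rewrite hs' // ht' //; ring.
- by rewrite hs // ht //; ring.
- move: P1z P2z; rewrite /P1 /P2 /= npos_ReIm nneg_ReIm Iz eqxx /= -!ltNge => h1 h2.
  by have := lt_trans h1 h2; rewrite ltxx.
Qed.

End Plane.

Lemma ord3_cases (k : 'I_3) : [\/ k = 0, k = 1 | k = ord_max].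
Proof.
by case: k => [[|[|[|//]]] ?]; [constructor 1|constructor 2|constructor 3]; apply: val_inj.
Qed.

(** * The projective plane *)

Section ProjectiveGeometry.
Local Open Scope quotient_scope.
Variable K : numFieldType.
Local Notation i2 := (ord_max : 'I_3).
Implicit Types (u v w : 'rV[K]_3) (P Q : proj_plane K).

Definition dot u v := \sum_(i < 3) u 0 i * v 0 i.

(** The value depends on the chosen representative of [P]. Only its vanishing and the quotients of
    two forms at the same point are meaningful. *)
Definition form u P := dot u (hcoords P).

Lemma lineE u P : line u P = (form u P = 0). Proof. by []. Qed.

Definition vec3 (a b c : K) : 'rV[K]_3 := \row_(i < 3) [:: a; b; c]`_i.

Definition cross u v := vec3 (u 0 1 * v 0 i2 - u 0 i2 * v 0 1)
  (u 0 i2 * v 0 0 - u 0 0 * v 0 i2) (u 0 0 * v 0 1 - u 0 1 * v 0 0).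

Lemma dotE u v : dot u v = u 0 0 * v 0 0 + u 0 1 * v 0 1 + u 0 i2 * v 0 i2.
Proof.
rewrite /dot !big_ord_recl big_ord0 addr0 addrA.
by congr (_ + u _ _ * v _ _ + u _ _ * v _ _); apply: val_inj.
Qed.

Lemma row3_ext u v : u 0 0 = v 0 0 -> u 0 1 = v 0 1 -> u 0 i2 = v 0 i2 -> u = v.
Proof.
move=> e0 e1 e2; apply/rowP => i.
have [->|->|->] := ord3_cases i.
- exact: e0.
- exact: e1.
- exact: e2.
Qed.

Lemma vec3_0 a b c : vec3 a b c 0 0 = a. Proof. by rewrite mxE. Qed.
Lemma vec3_1 a b c : vec3 a b c 0 1 = b. Proof. by rewrite mxE. Qed.
Lemma vec3_2 a b c : vec3 a b c 0 i2 = c. Proof. by rewrite mxE. Qed.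
Definition vec3E := (vec3_0, vec3_1, vec3_2).

Lemma dotDr u v w : dot u (v + w) = dot u v + dot u w.
Proof. by rewrite !dotE !mxE; ring. Qed.
Lemma dotZr u a v : dot u (a *: v) = a * dot u v.
Proof. by rewrite !dotE !mxE; ring. Qed.
Lemma dotZl u a v : dot (a *: u) v = a * dot u v.
Proof. by rewrite !dotE !mxE; ring. Qed.

Lemma row_neq0 u : u != 0 -> exists i, u 0 i != 0.
Proof.
move=> u0; apply/existsP; apply: contraNT u0 => /existsPn h.
by apply/eqP/rowP => i; rewrite mxE; apply/eqP; have := h i; rewrite negbK.
Qed.

Lemma dot_delta u i : dot u (delta_mx 0 i) = u 0 i.
Proof.
rewrite /dot (bigD1 i) //= mxE !eqxx mulr1 big1 ?addr0 // => j ji.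
by rewrite mxE (negPf ji) andbF mulr0.
Qed.

Lemma hcoords_neq0 P : hcoords P != 0.
Proof. by rewrite /hcoords; case: (repr P) => v /= /set_mem. Qed.

Lemma homog_hcoords P : homog (hcoords_neq0 P) = P.
Proof.
rewrite /homog -[RHS]reprK; congr (\pi_(proj_plane K) _).
exact: val_inj.
Qed.

Lemma homog_congr u v (u0 : u != 0) (v0 : v != 0) k :
  k != 0 -> u = k *: v -> homog u0 = homog v0.
Proof.
by move=> k0 e; apply/(@eqquotP _ (proportional_equiv K))/asboolP; exists k.
Qed.

Lemma form_homog v (v0 : v != 0) : exists2 k, k != 0 & forall u, form u (homog v0) = k * dot u v.
Proof.
have [k k0 e] := hcoords_homog v0.
by exists k => // u; rewrite /form e dotZr.
Qed.

Lemma form_homog_neq0 u v (v0 : v != 0) : (form u (homog v0) != 0) = (dot u v != 0).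
Proof. by have [k k0 ->] := form_homog v0; rewrite mulf_eq0 (negPf k0). Qed.

Lemma form_homog_eq0 u v (v0 : v != 0) : (form u (homog v0) == 0) = (dot u v == 0).
Proof. by have [k k0 ->] := form_homog v0; rewrite mulf_eq0 (negPf k0). Qed.

Lemma form_homog_ratio u w v (v0 : v != 0) :
  form u (homog v0) / form w (homog v0) = dot u v / dot w v.
Proof.
have [k k0 e] := form_homog v0; rewrite !e.
by rewrite invfM mulrACA divff // mul1r.
Qed.

Lemma at_row3 (T : topologicalType) (f : T -> 'rV[K]_3) x :
  (forall i, {for x, continuous (fun y => f y 0 i)}) -> {for x, continuous f}.
Proof.
move=> cf A [B nB BA].
have : nbhs x (fun y => forall i, B 0 i (f y 0 i)).
  by apply: filter_forall => i; apply: cf; exact: nB.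
by apply: filterS => y Bf; apply: BA => i j; rewrite (ord1 i).
Qed.

Lemma dot_cont u v : {for v, continuous (dot u)}.
Proof.
have cc i : {for v, continuous (fun v => v 0 i)} by exact: coord_continuous.
have -> : dot u = fun v => u 0 0 * v 0 0 + u 0 1 * v 0 1 + u 0 i2 * v 0 i2.
  by apply/funext => w; rewrite dotE.
by apply: (atD (atD (atM (@at_cst _ K (u 0 0) v) (cc 0))
  (atM (@at_cst _ K (u 0 1) v) (cc 1))) (atM (@at_cst _ K (u 0 i2) v) (cc i2))).
Qed.

Lemma homog_cont (T : topologicalType) (f : T -> 'rV[K]_3) (f0 : forall y, f y != 0) x :
  {for x, continuous f} -> {for x, continuous (fun y => homog (f0 y))}.
Proof.
move=> cf A; rewrite nbhsE => -[B [[V oV VB] Bx] BA].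
have Vx : V (f x) by move: Bx; rewrite -[B _]/((\pi_(proj_plane K) @^-1` B) _) -VB.
have := at_open cf oV Vx; apply: filterS => y Vy; apply: BA.
by rewrite -[B _]/((\pi_(proj_plane K) @^-1` B) _) -VB.
Qed.

Lemma proj_open (Z : set (proj_plane K)) (V : set 'rV[K]_3) : open V ->
  (forall v (v0 : v != 0), Z (homog v0) <-> V v) -> open Z.
Proof.
move=> oV ZV; exists V => //; apply/seteqP; split=> -[v v0] /=.
  have e : homog (set_mem v0 : v != 0) = \pi_(proj_plane K) (exist _ v v0).
    by rewrite /homog; congr (\pi _); exact: val_inj.
  by move=> Vv; rewrite -e; apply/ZV.
have e : homog (set_mem v0 : v != 0) = \pi_(proj_plane K) (exist _ v v0).
  by rewrite /homog; congr (\pi _); exact: val_inj.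
by rewrite -[X in X -> _]/(Z (\pi_(proj_plane K) (exist _ v v0))) -e => /ZV.
Qed.

Lemma near_neq0 (T : topologicalType) (f : T -> K) x : {for x, continuous f} -> f x != 0 ->
  \forall y \near x, f y != 0.
Proof.
move=> cf /eqP f0.
have oZ : open (~` [set (0 : K)]).
  apply: closed_openC; apply: accessible_closed_set1.
  exact/hausdorff_accessible/(@norm_hausdorff K K).
by have := at_open cf oZ f0; apply: filterS => y /eqP.
Qed.

Lemma line_closed u : closed (line u).
Proof.
rewrite -openC; apply: (@proj_open _ [set v | dot u v != 0]).
  by rewrite openE => v /= uv; exact: near_neq0 (@dot_cont u v) uv.
move=> v v0 /=; rewrite -form_homog_neq0 /line /=.
by split=> [|/eqP]; [move/eqP|].
Qed.

(** [hcoords] chooses representatives without continuity, so the proof passes to the cone over the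
    plane, where a quotient of linear forms is continuous. *)
Lemma ratio_cont u w P : form w P != 0 ->
  {for P, continuous (fun Q => form u Q / form w Q)}.
Proof.
move=> wP A; rewrite nbhsE => -[O [oO OP] OA].
have oZ : open [set Q | form w Q != 0 /\ O (form u Q / form w Q)].
  apply: (@proj_open _ [set v | dot w v != 0 /\ O (dot u v / dot w v)]).
    rewrite openE => v /= [wv Ov]; apply: filterI; first exact: near_neq0 (@dot_cont w v) wv.
    exact: (at_open (atM (@dot_cont u v) (atV (@dot_cont w v) wv)) oO Ov).
  by move=> v v0 /=; rewrite form_homog_neq0 form_homog_ratio.
have nZ : nbhs P [set Q | form w Q != 0 /\ O (form u Q / form w Q)].
  by apply: open_nbhs_nbhs; split.
by apply: filterS nZ => Q [_ OQ]; exact: OA.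
Qed.

(** By the triple product formula the cross product of [w] with [cross u v] is a combination of
    [dot u w] and [dot v w]. It vanishes here, so the two vectors are proportional. *)
Lemma orth_cross u v w : w != 0 -> dot u w = 0 -> dot v w = 0 -> cross u v != 0 ->
  exists2 k, k != 0 & w = k *: cross u v.
Proof.
move=> w0 uw vw /row_neq0[i ci].
have H : forall j, w 0 j * cross u v 0 i = w 0 i * cross u v 0 j.
  have c0 : w 0 1 * cross u v 0 i2 = w 0 i2 * cross u v 0 1.
    apply/eqP; rewrite -subr_eq0; apply/eqP.
    transitivity (u 0 0 * dot v w - v 0 0 * dot u w); last by rewrite uw vw !mulr0 subrr.
    by rewrite !vec3E !dotE; ring.
  have c1 : w 0 0 * cross u v 0 i2 = w 0 i2 * cross u v 0 0.
    apply/eqP; rewrite -subr_eq0; apply/eqP.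
    transitivity (v 0 1 * dot u w - u 0 1 * dot v w); last by rewrite uw vw !mulr0 subrr.
    by rewrite !vec3E !dotE; ring.
  have c2 : w 0 0 * cross u v 0 1 = w 0 1 * cross u v 0 0.
    apply/eqP; rewrite -subr_eq0; apply/eqP.
    transitivity (u 0 i2 * dot v w - v 0 i2 * dot u w); last by rewrite uw vw !mulr0 subrr.
    by rewrite !vec3E !dotE; ring.
  by move=> j; have [->|->|->] := ord3_cases i; have [->|->|->] := ord3_cases j;
    rewrite ?c0 ?c1 ?c2.
have e : w = (w 0 i / cross u v 0 i) *: cross u v.
  by apply/rowP => j; rewrite mxE mulrAC -H mulfK.
exists (w 0 i / cross u v 0 i) => //.
by apply: contraNneq w0 => k0; rewrite e k0 scale0r.
Qed.

Lemma lines_meet_once u v P Q : cross u v != 0 ->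
  line u P -> line v P -> line u Q -> line v Q -> P = Q.
Proof.
move=> c0 uP vP uQ vQ; rewrite -(homog_hcoords P) -(homog_hcoords Q).
have [k k0 eP] := orth_cross (hcoords_neq0 P) uP vP c0.
have [l l0 eQ] := orth_cross (hcoords_neq0 Q) uQ vQ c0.
apply: (@homog_congr _ _ _ _ (k / l)); first by rewrite mulf_neq0 ?invr_neq0.
by rewrite eP eQ scalerA divfK.
Qed.

(** * Affine charts of the projective plane *)

Section Chart.
Variables (p b1 b2 : 'rV[K]_3).
Hypothesis D0 : dot p (cross b1 b2) != 0.
Local Notation D := (dot p (cross b1 b2)).

(** The three coforms are the basis dual to [p], [b1], [b2], by Cramer's rule. The chart covers the
    points where [coform0] does not vanish. *)
Definition coform0 := D^-1 *: cross b1 b2.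
Definition coform1 := D^-1 *: cross b2 p.
Definition coform2 := D^-1 *: cross p b1.

Definition chart_vec (z : K * K) := p + z.1 *: b1 + z.2 *: b2.

Lemma cross_perml u v : dot u (cross u v) = 0.
Proof. by rewrite dotE !vec3E; ring. Qed.

Lemma cross_permr u v : dot v (cross u v) = 0.
Proof. by rewrite dotE !vec3E; ring. Qed.

Lemma coform0_chart z : dot coform0 (chart_vec z) = 1.
Proof.
rewrite /coform0 dotZl (_ : dot _ (chart_vec z) = D) ?mulVf //.
by rewrite /chart_vec !dotE !vec3E !mxE; ring.
Qed.

Lemma coform1_chart z : dot coform1 (chart_vec z) = z.1.
Proof.
rewrite /coform1 dotZl (_ : dot _ (chart_vec z) = D * z.1) ?mulKf //.
by rewrite /chart_vec !dotE !vec3E !mxE; ring.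
Qed.

Lemma coform2_chart z : dot coform2 (chart_vec z) = z.2.
Proof.
rewrite /coform2 dotZl (_ : dot _ (chart_vec z) = D * z.2) ?mulKf //.
by rewrite /chart_vec !dotE !vec3E !mxE; ring.
Qed.

Lemma coform_decomp v :
  v = dot coform0 v *: p + dot coform1 v *: b1 + dot coform2 v *: b2.
Proof.
apply: (scalerI D0); rewrite /coform0 /coform1 /coform2 !dotZl !scalerDr !scalerA !mulVKf //.
by apply: row3_ext; rewrite !mxE !dotE !vec3E; ring.
Qed.

Lemma dot_coform u v :
  dot u v = dot coform0 v * dot u p + dot coform1 v * dot u b1 + dot coform2 v * dot u b2.
Proof.
have e := congr1 (dot u) (coform_decomp v).
by rewrite e dotDr (dotDr u (_ *: p)) !dotZr.
Qed.

Lemma chart_vec_neq0 z : chart_vec z != 0.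
Proof.
apply/eqP => e; have := coform0_chart z; rewrite e dotE !mxE !mulr0 !addr0.
by move/eqP; rewrite eq_sym oner_eq0.
Qed.

Definition chart z := homog (chart_vec_neq0 z).

Definition chart_coord P := (form coform1 P / form coform0 P, form coform2 P / form coform0 P).

Lemma chart_vec_cont (T : topologicalType) (f : T -> K * K) x :
  {for x, continuous f} -> {for x, continuous (fun y => chart_vec (f y))}.
Proof.
move=> cf; apply: at_row3 => i.
have c1 : {for x, continuous (fun y => (f y).1)}.
  by apply: (at_comp cf (g := fst)); exact: cvg_fst.
have c2 : {for x, continuous (fun y => (f y).2)}.
  by apply: (at_comp cf (g := snd)); exact: cvg_snd.
have -> : (fun y => chart_vec (f y) 0 i) =
    fun y => p 0 i + (f y).1 * b1 0 i + (f y).2 * b2 0 i.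
  by apply/funext => y; rewrite !mxE.
exact: (atD (atD (@at_cst _ K (p 0 i) x) (atM c1 (@at_cst _ K (b1 0 i) x)))
  (atM c2 (@at_cst _ K (b2 0 i) x))).
Qed.

Lemma chart_cont (T : topologicalType) (f : T -> K * K) x :
  {for x, continuous f} -> {for x, continuous (fun y => chart (f y))}.
Proof. by move=> cf; apply: homog_cont; exact: chart_vec_cont. Qed.

Lemma chart_coord_cont P : form coform0 P != 0 -> {for P, continuous chart_coord}.
Proof. by move=> f0; apply: at_pair; exact: ratio_cont. Qed.

Lemma chart_coordK P : form coform0 P != 0 -> chart (chart_coord P) = P.
Proof.
move=> f0; rewrite -[RHS]homog_hcoords.
apply: (@homog_congr _ _ _ _ (form coform0 P)^-1); first by rewrite invr_eq0.
rewrite [in RHS](coform_decomp (hcoords P)) !scalerDr !scalerA mulVf // scale1r.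
by rewrite /chart_vec /chart_coord /= ![_ / form coform0 P]mulrC.
Qed.

Lemma chartK z : chart_coord (chart z) = z.
Proof.
rewrite /chart_coord /chart !form_homog_ratio coform0_chart coform1_chart coform2_chart.
by rewrite !divr1; case: z.
Qed.

Lemma chart_coform0 z : form coform0 (chart z) != 0.
Proof. by rewrite form_homog_neq0 coform0_chart oner_eq0. Qed.

End Chart.

(** In the resulting chart [P] is the origin and the line is [z.1 = 0]. The vector [b2] is
    orthogonal to [u] by construction, and as [u] vanishes at [P] the determinant reduces to a
    product of the nonzero coordinates [m] of [u] and [k] of [P], up to sign. *)
Lemma chart_at_line u P : u != 0 -> line u P ->
  exists b1 b2, [/\ dot (hcoords P) (cross b1 b2) != 0, dot u b1 != 0 & dot u b2 = 0].
Proof.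
move=> /row_neq0[m um] uP; have [k pk] := row_neq0 (hcoords_neq0 P).
exists (delta_mx 0 m), (cross u (delta_mx 0 k)); split.
- have -> : dot (hcoords P) (cross (delta_mx 0 m) (cross u (delta_mx 0 k))) =
      dot (delta_mx 0 m) (delta_mx 0 k) * form u P
      - dot u (delta_mx 0 m) * dot (hcoords P) (delta_mx 0 k).
    by rewrite /form !dotE !vec3E; ring.
  by rewrite (_ : form u P = 0) // mulr0 sub0r oppr_eq0 !dot_delta mulf_neq0.
- by rewrite dot_delta.
- by rewrite dotE !vec3E; ring.
Qed.

Lemma cross_anti u v w : dot w (cross v u) = - dot u (cross v w).
Proof. by rewrite !dotE !vec3E; ring. Qed.

(** The line is an axis of the chart at [P0] together with one point at infinity. That point has
    coordinates [b2] and is the origin of the chart in which [b2] and [P0] have changed places. *)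
Lemma line_cases u P0 P b1 b2 (D0 : dot (hcoords P0) (cross b1 b2) != 0)
    (D1 : dot b2 (cross b1 (hcoords P0)) != 0) :
  dot u b1 != 0 -> dot u b2 = 0 -> line u P0 -> line u P ->
  (exists y, P = chart D0 (0, y)) \/ P = chart D1 (0, 0).
Proof.
move=> ub1 ub2 uP0 uP; rewrite lineE /form in uP0; rewrite lineE /form in uP.
have c1P : dot (coform1 (hcoords P0) b1 b2) (hcoords P) = 0.
  have := dot_coform D0 u (hcoords P).
  rewrite uP uP0 ub2 !mulr0 add0r addr0 => /esym/eqP.
  by rewrite mulf_eq0 (negPf ub1) orbF => /eqP.
have dec := coform_decomp D0 (hcoords P); rewrite c1P scale0r addr0 in dec.
have [c0P|c0P] := eqVneq (form (coform0 (hcoords P0) b1 b2) P) 0; last first.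
  left; exists (chart_coord (hcoords P0) b1 b2 P).2.
  rewrite -{1}(chart_coordK D0 c0P) [in LHS]/chart_coord.
  by rewrite {1}/form c1P mul0r.
rewrite /form in c0P; rewrite c0P scale0r add0r in dec.
right; rewrite -[LHS]homog_hcoords.
apply: (@homog_congr _ _ _ _ (dot (coform2 (hcoords P0) b1 b2) (hcoords P))).
  by apply: contraNneq (hcoords_neq0 P) => c2P; rewrite dec c2P scale0r.
by rewrite {1}dec /chart_vec /= !scale0r !addr0.
Qed.

Lemma chart_swap p b1 b2 (D0 : dot p (cross b1 b2) != 0) (D1 : dot b2 (cross b1 p) != 0) y :
  y != 0 -> chart D1 (0, y) = chart D0 (0, y^-1).
Proof.
move=> y0; apply: (@homog_congr _ _ _ _ y) => //.
by rewrite /chart_vec /= !scale0r !addr0 scalerDr scalerA mulfV // scale1r addrC.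
Qed.

Lemma cross0_homog u v (u0 : u != 0) (v0 : v != 0) :
  cross u v = 0 -> homog u0 = homog v0.
Proof.
move=> /rowP c0; have := (c0 0, c0 1, c0 i2); rewrite !vec3E !mxE.
move=> [[/eqP + /eqP +] /eqP]; rewrite !subr_eq0 => /eqP e0 /eqP e1 /eqP e2.
have [i vi] := row_neq0 v0.
have H j : u 0 j * v 0 i = u 0 i * v 0 j.
  by have [->|->|->] := ord3_cases i; have [->|->|->] := ord3_cases j.
have e : u = (u 0 i / v 0 i) *: v.
  by apply/rowP => j; rewrite mxE mulrAC -H mulfK.
apply: (@homog_congr _ _ _ _ (u 0 i / v 0 i)) => //.
by apply: contraNneq u0 => k0; rewrite e k0 scale0r.
Qed.

Lemma concurrent u v w : cross v w != 0 ->
  (exists X, [/\ line u X, line v X & line w X]) <-> dot u (cross v w) = 0.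
Proof.
move=> c0; split=> [[X [uX vX wX]]|uc].
  have [k k0 e] := orth_cross (hcoords_neq0 X) vX wX c0.
  move: uX; rewrite lineE /form e dotZr => /eqP.
  by rewrite mulf_eq0 (negPf k0) => /eqP.
exists (homog c0); rewrite !lineE; split; apply/eqP; rewrite form_homog_eq0.
- by rewrite uc.
- by rewrite cross_perml.
- by rewrite cross_permr.
Qed.

Lemma line_sep u v : cross u v != 0 -> exists X, line u X /\ ~ line v X.
Proof.
move=> /row_neq0[k]; have -> : cross u v 0 k = - dot v (cross u (delta_mx 0 k)).
  by rewrite -dot_delta !dotE !vec3E; ring.
rewrite oppr_eq0 => vk.
have w0 : cross u (delta_mx 0 k) != 0.
  by apply: contraNneq vk => ->; rewrite dotE !mxE !mulr0 !addr0.
exists (homog w0); split.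
  by rewrite lineE; apply/eqP; rewrite form_homog_eq0 cross_perml.
by rewrite lineE; apply/eqP; rewrite form_homog_neq0.
Qed.

End ProjectiveGeometry.

(** * Square roots near a line *)

Section LocalSquareRoots.
Variable R : realType.
Local Notation C := (Cx R).
Local Notation CP2 := (proj_plane C).

Lemma polydisc_nbhs (O : set (C * C)) : nbhs (0, 0) O ->
  exists2 e : R, 0 < e & polydisc e `<=` O.
Proof.
move=> [[A B] /= [/rect_nbhs[e e0 eA] /rect_nbhs[d d0 dB]] AB].
rewrite !(Re0, Im0) !sub0r !add0r in eA dB.
exists (Num.min e d); first by rewrite lt_min e0.
have h1 : Num.min e d <= e by rewrite ge_min lexx.
have h2 : Num.min e d <= d by rewrite ge_min lexx orbT.
move=> [x y] [[/= /andP[? ?] /andP[? ?]] [/= /andP[? ?] /andP[? ?]]]; apply: AB; split=> /=.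
  by apply: eA; split; apply/andP; split; lra.
by apply: dB; split; apply/andP; split; lra.
Qed.

Lemma polydisc0 (e : R) : 0 < e -> polydisc e ((0, 0) : C * C).
Proof. by move=> e0; split; split; rewrite /= ?Re0 ?Im0 oppr_lt0 e0. Qed.

Lemma dot_chart_vec (u p b1 b2 : 'rV[C]_3) z :
  dot u (chart_vec p b1 b2 z) = dot u p + z.1 * dot u b1 + z.2 * dot u b2.
Proof. by rewrite /chart_vec !dotDr !dotZr. Qed.

Lemma chart00 P b1 b2 (D0 : dot (hcoords P) (cross b1 b2) != 0) :
  chart D0 ((0, 0) : C * C) = P.
Proof.
rewrite -[RHS]homog_hcoords; apply: (@homog_congr _ _ _ _ _ 1); first exact: oner_neq0.
by rewrite /chart_vec /= !scale0r !addr0 scale1r.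
Qed.

(** This is [slit_product_sqrt] read in a chart where the line is [z.1 = 0]. A root on the slit
    polydisc and a root near [P] off the line correspond through the chart. *)
Lemma smooth_point_sqrt (u : 'rV[C]_3) (P : CP2) (h k : CP2 -> C) (O : set CP2) :
  u != 0 -> line u P -> nbhs P O ->
  (forall Q, O Q -> ~ line u Q ->
    [/\ h Q != 0, {for Q, continuous h}, k Q != 0 & {for Q, continuous k}]) ->
  (forall V, nbhs P V -> ~ has_sqrt h (V `\` line u)) ->
  (forall V, nbhs P V -> ~ has_sqrt k (V `\` line u)) ->
  exists2 V, nbhs P V & has_sqrt (fun Q => h Q * k Q) (V `\` line u).
Proof.
move=> u0 uP nO hk nh nk.
have [b1 [b2 [D0 ub1 ub2]]] := chart_at_line u0 uP.
pose c := chart D0; pose kap := chart_coord (hcoords P) b1 b2.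
have c0 : c (0, 0) = P by exact: chart00.
have lc z : line u (c z) <-> z.1 = 0.
  rewrite lineE; split=> [/eqP|z0]; last first.
    by apply/eqP; rewrite form_homog_eq0 dot_chart_vec z0 ub2 !mul0r mulr0 !addr0; apply/eqP.
  rewrite form_homog_eq0 dot_chart_vec ub2 [dot u (hcoords P)]uP add0r mulr0 addr0.
  by rewrite mulf_eq0 (negPf ub1) orbF => /eqP.
have cc z : {for z, continuous c} by exact: (chart_cont (@at_id (C * C)%type z)).
have [e e0 eO] : exists2 e : R, 0 < e & polydisc e `<=` c @^-1` O.
  by apply: polydisc_nbhs; apply: cc; rewrite c0.
pose f0 := coform0 (hcoords P) b1 b2.
(* The condition on [f0] removes the line at infinity of the chart: there [kap] divides by 0, takes
   the value [(0, 0)] and would fall in the polydisc. *)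
pose V : set CP2 := [set Q | form f0 Q != 0 /\ polydisc e (kap Q)].
have f0P : form f0 P != 0 by rewrite -c0; exact: chart_coform0.
have nV : nbhs P V.
  apply: filterI.
    have oL : open (~` line f0) by exact: (closed_openC (@line_closed C f0)).
    have nL : nbhs P (~` line f0) by apply: open_nbhs_nbhs; split=> //; exact/eqP.
    by apply: filterS nL => Q /eqP.
  apply: (at_open (chart_coord_cont f0P) (@polydisc_open R e)).
  by rewrite -[X in chart_coord _ _ _ X]c0 chartK; exact: polydisc0.
have back (f : CP2 -> C) :
    has_sqrt (fun z => f (c z)) (polydisc e `&` [set z | z.1 != 0]) ->
    has_sqrt f (V `\` line u).
  move=> hf; apply: (@has_sqrt_ext _ _ (fun Q => f (c (kap Q)))).
    by move=> Q [[f0Q _] _]; rewrite /c /kap chart_coordK.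
  apply: (has_sqrt_comp (c := kap) (h := fun z => f (c z)) _ hf).
  move=> Q [[f0Q eQ] lQ]; split; last exact: chart_coord_cont.
  split=> //=; apply/eqP => k0; apply: lQ.
  by rewrite -(chart_coordK D0 f0Q); apply/lc.
exists V; first exact: nV.
apply: (back (fun Q => h Q * k Q)).
apply: (@slit_product_sqrt R e (fun z => h (c z)) (fun z => k (c z)) e0).
- move=> z ez z0; have [] := hk (c z); [exact: eO|by move=> /lc /eqP; rewrite (negPf z0)|].
  move=> h0 ch k0 ck.
  by split; [exact: h0|exact: (at_comp (cc z) ch)|exact: k0|exact: (at_comp (cc z) ck)].
- by move=> /back; exact: (nh V nV).
- by move=> /back; exact: (nk V nV).
Qed.

Section Phi.
Variables (n : nat) (l : 'I_n -> 'rV[C]_3) (r : 'I_n).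

(** Dividing every factor by the same form makes the product independent of representatives. For
    even [n], another choice of [r] multiplies it by a square off the lines. *)
Definition phi (P : CP2) : C := \prod_j (form (l j) P / form (l r) P).

Definition off_lines : set CP2 := [set P | forall j, ~ line (l j) P].

Lemma phi_neq0 P : off_lines P -> phi P != 0.
Proof.
by move=> oP; apply/prodf_neq0 => j _; rewrite mulf_neq0 ?invr_neq0 //; apply/eqP; exact: oP.
Qed.

Lemma phi_cont P : off_lines P -> {for P, continuous phi}.
Proof. by move=> oP; apply: at_prod => j; apply: ratio_cont; apply/eqP; exact: oP. Qed.

(* On a transverse curve [phi] is [x] times a nonvanishing function, up to a square. *)
Lemma phi_no_sqrt k P O : ~~ odd n -> l k != 0 -> line (l k) P ->
  (forall j, j != k -> ~ line (l j) P) -> nbhs P O ->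
  ~ has_sqrt phi (O `&` off_lines).
Proof.
move=> en lk0 lkP ljP nO hphi.
have [b1 [b2 [D0 ub1 ub2]]] := chart_at_line lk0 lkP.
pose c (x : C) := chart D0 (x, 0).
pose a j := form (l j) P; pose b j := dot (l j) b1.
have cc x : {for x, continuous c}.
  by exact: (chart_cont (at_pair (@at_id C x) (@at_cst C C 0 x))).
have dl j x : dot (l j) (chart_vec (hcoords P) b1 b2 (x, 0)) = a j + x * b j.
  by rewrite dot_chart_vec mul0r addr0.
have ak : a k = 0 by exact: lkP.
have lin j (x : C) : {for x, continuous (fun x : C => a j + x * b j)}.
  exact: (atD (@at_cst C C (a j) x) (atM (@at_id C x) (@at_cst C C (b j) x))).
pose N : set C := [set x | O (c x) /\ forall j, j != k -> a j + x * b j != 0].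
have nN : nbhs (0 : C) N.
  apply: filterI; first by apply: cc; rewrite /c chart00.
  apply: (@filter_forall _ _ (fun j x => j != k -> a j + x * b j != 0) (nbhs (0 : C))) => j.
  have [->|jk] := eqVneq j k; first exact: filterE.
  have : a j + 0 * b j != 0 by rewrite mul0r addr0; apply/eqP; exact: ljP.
  by move=> /(near_neq0 (lin j 0)); apply: filterS.
have step1 : has_sqrt (fun x => phi (c x)) (N `\ 0).
  apply: (has_sqrt_comp (c := c) _ hphi) => x [[Ox hx] x0]; split; last exact: cc.
  split=> // j; rewrite lineE.
  apply/eqP; rewrite form_homog_neq0 dl; have [->|jk] := eqVneq j k; last exact: hx.
  by rewrite ak add0r mulf_neq0 //; apply/eqP.
(* As [n] is even, the denominator of [phi] is a square along the curve. Clearing it leaves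
   [x * Q x] with [Q] nonzero, and a root of this would give one of [x]. *)
have sq : has_sqrt (fun x : C => (a r + x * b r) ^+ n) (N `\ 0).
  exists (fun x => (a r + x * b r) ^+ n./2) => x _; split.
    by rewrite -exprM muln2 even_halfK.
  elim: (n./2) => [|m IH]; first exact: (@at_cst C C 1 x).
  have -> : (fun x : C => (a r + x * b r) ^+ m.+1) =
      fun x => (a r + x * b r) * (a r + x * b r) ^+ m.
    by apply/funext => y; rewrite exprS.
  exact: (atM (lin r x) IH).
pose Q (x : C) : C := b k * \prod_(j | j != k) (a j + x * b j).
have step2 : has_sqrt (fun x : C => x * Q x) (N `\ 0).
  apply: (has_sqrt_ext _ (has_sqrtM step1 sq)) => x [[Ox hx] x0].
  have rx : a r + x * b r != 0.
    have [->|] := eqVneq r k; last exact: hx.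
    by rewrite ak add0r mulf_neq0 //; apply/eqP.
  rewrite /phi; under eq_bigr => j _ do rewrite form_homog_ratio !dl.
  rewrite big_split /= prodr_const card_ord exprVn divfK ?expf_neq0 //.
  by rewrite (bigD1 k) //= ak add0r /Q mulrA.
have cQ (x : C) : {for x, continuous Q}.
  apply: (atM (@at_cst C C (b k) x)).
  have -> : (fun x : C => \prod_(j | j != k) (a j + x * b j)) =
      fun x : C => \prod_j (if j != k then a j + x * b j else 1).
    by apply/funext => y; rewrite big_mkcond.
  apply: at_prod => j; case: (j != k); [exact: lin|exact: (@at_cst C C 1 x)].
have Q0 x : N x -> Q x != 0.
  by move=> [_ hx]; rewrite mulf_neq0 //; apply/prodf_neq0.
have QN0 := Q0 _ (nbhs_singleton nN).
have cV (x : C) (Qx : Q x != 0) : {for x, continuous (fun x : C => (Q x)^-1)}.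
  exact: (@atV C C Q x (cQ x) Qx).
have [V nV hV] := @local_sqrt R C (fun x => (Q x)^-1) 0 (invr_neq0 QN0) (cV 0 QN0).
have step3 : has_sqrt (fun x : C => (Q x)^-1) ((V `&` N) `\ 0).
  by apply: hV => [x [[]]//|x [[_ Nx] _]]; exact: (cV x (Q0 _ Nx)).
apply: (@no_sqrt_id R (V `&` N)); first exact: filterI.
have step2' : has_sqrt (fun x : C => x * Q x) ((V `&` N) `\ 0).
  by apply: has_sqrtS step2 => x [[]].
apply: (has_sqrt_ext _ (has_sqrtM step2' step3)) => x [[_ Nx] _].
by rewrite mulfK ?Q0.
Qed.

End Phi.

Lemma closed_cofinite (Z B : set C) : closed Z -> finite_set B ->
  (forall y, ~ B y -> Z y) -> forall y, Z y.
Proof.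
move=> cZ /finite_seqP[s ->] hZ y; apply: cZ => O /rect_nbhs[e e0 eO].
have [t /andP[t0 te] ts] := pos_avoid [seq Re (b - y) | b <- s] e0.
exists (y + toC t); split.
  apply: hZ => /= ys; move/negP: ts; apply; apply/mapP; exists (y + toC t) => //.
  by rewrite addrAC subrr add0r.
by apply: eO; rewrite /rect /mkset ReD ImD Re_toC Im_toC; split; apply/andP; split; lra.
Qed.

(** Away from their crossings the target lines are disjoint, and each of them is closed. They
    therefore cut the connected punctured line into closed pieces, of which only one is nonempty;
    the punctures follow by closedness. *)
Lemma lines_to_lines (I : finType) (u u' : I -> 'rV[C]_3) (f g : CP2 -> CP2) :
  (forall i, u i != 0) -> (forall i j, i != j -> cross (u' i) (u' j) != 0) ->
  cancel f g -> continuous f ->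
  (forall i P, line (u i) P -> exists j, line (u' j) (f P)) ->
  forall i, exists j, forall P, line (u i) P -> line (u' j) (f P).
Proof.
move=> u0 hu' fg cf fU i.
have [[P0 uP0]|nP] := pselect (exists P, line (u i) P); last first.
  by exists i => P uP; case: nP; exists P.
have [b1 [b2 [D0 ub1 ub2]]] := chart_at_line (u0 i) uP0.
have up : dot (u i) (hcoords P0) = 0 by exact: uP0.
pose c (y : C) := chart D0 (0, y).
have cc y : {for y, continuous c}.
  by exact: (chart_cont (at_pair (@at_cst C C 0 y) (@at_id C y))).
have cfc : continuous (fun y => f (c y)).
  by move=> y; exact: (at_comp (cc y) (cf (c y))).
have uc y : line (u i) (c y).
  rewrite lineE; apply/eqP; rewrite form_homog_eq0 dot_chart_vec.
  by rewrite ub2 up mul0r mulr0 !addr0.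
pose Sing : set CP2 := \bigcup_(p in [set p : I * I | p.1 != p.2])
  (line (u' p.1) `&` line (u' p.2)).
have fSing : finite_set Sing.
  apply: bigcup_finite => [|[j k] /= jk]; first exact: finite_finset.
  have [[Q [jQ kQ]]|nQ] := pselect (exists Q, (line (u' j) `&` line (u' k)) Q).
    apply: (@sub_finite_set _ _ [set Q]); last exact: finite_set1.
    move=> Q' [jQ' kQ'] /=; exact: (lines_meet_once (hu' _ _ jk)).
  apply: (@sub_finite_set _ _ set0); last exact: finite_set0.
  by move=> Q hQ; case: nQ; exists Q.
(* The target lines have finitely many crossings, and [f] is injective, so only finitely many points
   of the line are sent to crossings. *)
pose B : set C := [set y | Sing (f (c y))].
have fB : finite_set B.
  apply: (@finite_preimage _ _ Sing (fun y => f (c y))) => //.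
  move=> x y _ _ /(can_inj fg)/(congr1 (chart_coord (hcoords P0) b1 b2)).
  by rewrite /c !chartK => -[].
have cB : connected (setT `\` B).
  by apply: punctured_connected => //; exact: openT.
have [y0 By0] : exists y0, ~ B y0.
  have /finite_seqP[s Bs] := fB.
  have [t _ ts] := pos_avoid [seq Re b | b <- s] (ltr01 : 0 < 1 :> R).
  exists (toC t); rewrite Bs => /= tB; move/negP: ts; apply; apply/mapP.
  by exists (toC t) => //; rewrite Re_toC.
have [j ju] := fU i _ (uc y0).
pose Z j := [set y | line (u' j) (f (c y))].
have cZ k : closed (Z k).
  by apply: (@preimage_closed _ _ (fun y => f (c y))) => [y _|]; [exact: cfc|exact: line_closed].
have TB : (setT `\` B) `&` Z j = setT `\` B.
  apply: cB; first by exists y0.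
  - exists (~` \bigcup_(k in [set k | k != j]) Z k).
      apply: closed_openC; apply: closed_bigcup => [|k _]; first exact: finite_finset.
      exact: cZ.
    apply/seteqP; split=> y [[_ By]].
      move=> jy; split=> //; move=> [k /= kj ky]; apply: By.
      by exists (k, j).
    move=> nk; split=> //; have [k ky] := fU i _ (uc y).
    have [<-//|kj] := eqVneq k j; case: nk; by exists k.
  - by exists (Z j).
have allZ y : Z j y.
  apply: (closed_cofinite (cZ j) fB) => z Bz.
  by have [] : ((setT `\` B) `&` Z j) z by rewrite TB.
exists j => P uP.
have D0' : dot b2 (cross b1 (hcoords P0)) != 0.
  by rewrite cross_anti oppr_eq0.
(* A second chart reaches the one point of the line that [c] misses; its other points are known
   already. *)
pose c' (y : C) := chart D0' (0, y).
have cc' y : {for y, continuous c'}.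
  by exact: (chart_cont (at_pair (@at_cst C C 0 y) (@at_id C y))).
have cZ' : closed [set y | line (u' j) (f (c' y))].
  apply: (@preimage_closed _ _ (fun y => f (c' y))) => [y _|]; last exact: line_closed.
  exact: (at_comp (cc' y) (cf (c' y))).
have c'Z y : line (u' j) (f (c' y)).
  apply: (closed_cofinite cZ' (finite_set1 0)) => {}y /eqP y0'.
  by rewrite /= [c' y](chart_swap D0 D0' y0'); exact: allZ.
by have [[y ->]|->] := line_cases D0 D0' ub1 ub2 uP0 uP; [exact: allZ|exact: c'Z].
Qed.

End LocalSquareRoots.

(** * A disc bounded by the triangle *)

Section Disc.
Variable R : realType.
Local Notation C := (Cx R).
Local Notation CP2 := (proj_plane C).
Local Notation i2 := (ord_max : 'I_3).
Local Notation toC := (@toC R).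
Local Notation Re := (@Re R).
Local Notation Im := (@Im R).
Local Notation iC := (@iC R).

Definition cvec (v : 'rV[R]_3) : 'rV[C]_3 := vec3 (toC (v 0 0)) (toC (v 0 1)) (toC (v 0 i2)).

Lemma cvec_eq0 (v : 'rV[R]_3) : (cvec v == 0) = (v == 0).
Proof.
apply/eqP/eqP => [/rowP h|->]; last by apply: row3_ext; rewrite !vec3E !mxE toC0.
have := (h 0, h 1, h i2); rewrite !vec3E !mxE => -[[/eqP + /eqP +] /eqP].
by rewrite !toC_eq0 => /eqP h0 /eqP h1 /eqP h2; apply: row3_ext; rewrite mxE.
Qed.

Lemma dot_cvec (u v : 'rV[R]_3) : dot (cvec u) (cvec v) = toC (dot u v).
Proof. by rewrite !dotE !vec3E /toC !rmorphD !rmorphM. Qed.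

Lemma cross_cvec (u v : 'rV[R]_3) : cross (cvec u) (cvec v) = cvec (cross u v).
Proof.
by apply: row3_ext; rewrite !vec3E /toC !rmorphB !rmorphM.
Qed.

(* [vtx m] is the vertex with index [m], as the equation of its dual line, and [corner m]
   is the intersection of the lines dual to the other two vertices: both have the
   coordinates of the vertex. *)
Definition vtx (m : 'I_3) : 'rV[C]_3 := vec3 (m == 1)%:R (m == i2)%:R (m == 0)%:R.

Lemma vtx_neq0 m : vtx m != 0.
Proof.
apply/eqP => /rowP e; have := (e 0, e 1, e i2); rewrite /vtx !vec3E !mxE.
have [->|->|->] := ord3_cases m.
- by case=> _ /eqP; rewrite oner_eq0.
- by case=> -[/eqP]; rewrite oner_eq0.
- by case=> -[_ /eqP]; rewrite oner_eq0.
Qed.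

Definition corner m : CP2 := homog (vtx_neq0 m).

(* The disc is the image of the unit square.  Its sides [Im z = 0], [Re z = 1] and
   [Im z = 1] run along the triangle and the side [Re z = 0] collapses to a corner.  A
   real line avoiding the corners meets it in at most one point, since the factors [i] and
   [1 + i] split the equation of the line into two real ones (see [disc_line]). *)
Definition disc_vec (z : C) : 'rV[C]_3 :=
  vec3 (toC (Re z) * (1 - toC (Im z))) (iC * (toC (Re z) * toC (Im z)))
    ((1 + iC) * (1 - toC (Re z))).

Lemma iC_neq0 : iC != 0 :> C.
Proof. by apply/eqP => /(congr1 Im); rewrite Im_iC Im0 => /eqP; rewrite oner_eq0. Qed.

Lemma onei_neq0 : 1 + iC != 0 :> C.
Proof.
apply/eqP => /(congr1 Im); rewrite ImD Im_iC Im1 Im0 add0r => /eqP.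
by rewrite oner_eq0.
Qed.

Lemma disc_vec_neq0 z : disc_vec z != 0.
Proof.
apply/eqP => /rowP e; have := (e 0, e 1, e i2); rewrite /disc_vec !vec3E !mxE.
move=> [[h0 h1] /eqP]; rewrite mulf_eq0 (negPf onei_neq0) /= subr_eq0 => /eqP h2.
move: h0 h1; rewrite -h2 !mul1r => /eqP; rewrite subr_eq0 => /eqP <-.
by rewrite mulr1 => /eqP; rewrite (negPf iC_neq0).
Qed.

Definition disc z : CP2 := homog (disc_vec_neq0 z).

Lemma disc_cont z : {for z, continuous disc}.
Proof.
apply: homog_cont; apply: at_row3 => i.
have cX : {for z, continuous (fun z : C => toC (Re z))}.
  exact: (at_comp (@Re_continuous R z) (@real_complex_continuous R (Re z))).
have cY : {for z, continuous (fun z : C => toC (Im z))}.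
  exact: (at_comp (@Im_continuous R z) (@real_complex_continuous R (Im z))).
have cst (a : C) : {for z, continuous (fun _ : C => a)} by exact: at_cst.
have [->|->|->] := ord3_cases i.
- have -> : (fun y => disc_vec y 0 0) = fun y => toC (Re y) * (1 - toC (Im y)).
    by apply/funext => y; rewrite vec3E.
  exact: (atM cX (atD (cst 1) (atN cY))).
- have -> : (fun y => disc_vec y 0 1) = fun y => iC * (toC (Re y) * toC (Im y)).
    by apply/funext => y; rewrite vec3E.
  exact: (atM (cst iC) (atM cX cY)).
- have -> : (fun y => disc_vec y 0 i2) = fun y => (1 + iC) * (1 - toC (Re y)).
    by apply/funext => y; rewrite vec3E.
  exact: (atM (cst (1 + iC)) (atD (cst 1) (atN cX))).
Qed.

Lemma disc_line (v : 'rV[R]_3) z : line (cvec v) (disc z) <->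
  v 0 0 * (Re z * (1 - Im z)) + v 0 i2 * (1 - Re z) = 0 /\
  v 0 1 * (Re z * Im z) + v 0 i2 * (1 - Re z) = 0.
Proof.
set a := _ + _; set b := v 0 1 * _ + _.
have e : dot (cvec v) (disc_vec z) = toC a + toC b * iC.
  rewrite dotE !vec3E /a /b /toC !(rmorphD, rmorphM, rmorphB, rmorph1).
  by ring.
rewrite lineE; split=> [/eqP|[a0 b0]].
  rewrite form_homog_eq0 e => /eqP e0.
  by split; [rewrite -(Re_mk a b) e0|rewrite -(Im_mk a b) e0].
by apply/eqP; rewrite form_homog_eq0 e a0 b0 toC0 mul0r addr0.
Qed.

(** Consequently the boundary of the square, and with it the triangle, stays off the surrounding
    lines, all of whose coefficients are nonzero. *)
Lemma disc_line_inner (v : 'rV[R]_3) z : v 0 0 != 0 -> v 0 1 != 0 -> v 0 i2 != 0 ->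
  line (cvec v) (disc z) -> [/\ Re z != 0, Re z != 1, Im z != 0 & Im z != 1].
Proof.
move=> v0 v1 v2 /disc_line[h1 h2]; split; apply/eqP => e; move: h1 h2; rewrite e.
- by rewrite !(mul0r, mulr0, subr0, mulr1, add0r) => /eqP; rewrite (negPf v2).
- rewrite subrr !mul1r !mulr0 !addr0 => /eqP; rewrite mulf_eq0 (negPf v0) /= subr_eq0 => /eqP <-.
  by rewrite mulr1 => /eqP; rewrite (negPf v1).
- rewrite subr0 !(mulr0, mulr1, add0r) => + h2; rewrite h2 addr0 => /eqP.
  rewrite mulf_eq0 (negPf v0) /= => /eqP r0; move: h2; rewrite r0 subr0 mulr1 => /eqP.
  by rewrite (negPf v2).
- rewrite subrr !(mulr0, mulr1, add0r) => h2; rewrite h2 addr0 => /eqP.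
  rewrite mulf_eq0 (negPf v1) /= => /eqP r0; move: h2; rewrite r0 subr0 mulr1 => /eqP.
  by rewrite (negPf v2).
Qed.

(** The difference of the two real equations, divided by [Re z], gives
    [v 0 0 = (v 0 0 + v 0 1) * Im z], which fixes [Im z]. The second equation is then linear in
    [Re z] and fixes it, since [v 0 i2] is nonzero. *)
Lemma disc_line_once (v : 'rV[R]_3) z z' : v 0 0 != 0 -> v 0 1 != 0 -> v 0 i2 != 0 ->
  line (cvec v) (disc z) -> line (cvec v) (disc z') -> z = z'.
Proof.
move=> v0 v1 v2 hz hz'.
have [s0 _ _ _] := disc_line_inner v0 v1 v2 hz.
have [s0' _ _ _] := disc_line_inner v0 v1 v2 hz'.
move: hz hz' => /disc_line[h1 h2] /disc_line[h1' h2'].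
have tE w : Re w != 0 ->
    v 0 0 * (Re w * (1 - Im w)) + v 0 i2 * (1 - Re w) = 0 ->
    v 0 1 * (Re w * Im w) + v 0 i2 * (1 - Re w) = 0 ->
    v 0 0 = (v 0 0 + v 0 1) * Im w.
  move=> w0 k1 k2; apply: (mulIf w0); apply/eqP; rewrite -subr_eq0; apply/eqP.
  by rewrite -[RHS](subrr (0 : R)) -{1}k1 -k2; ring.
have t1 := tE z s0 h1 h2; have t2 := tE z' s0' h1' h2'.
have v01 : v 0 0 + v 0 1 != 0.
  by apply/eqP => e; move: v0; rewrite t1 e mul0r eqxx.
have et : Im z = Im z' by apply: (mulfI v01); rewrite -t1 -t2.
apply: complex_ext => //.
have sE w : v 0 1 * (Re w * Im w) + v 0 i2 * (1 - Re w) = 0 ->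
    Re w * (v 0 i2 - v 0 1 * Im w) = v 0 i2.
  by move=> k; apply/eqP; rewrite -subr_eq0; apply/eqP; rewrite -[RHS]oppr0 -k; ring.
have e1 := sE z h2; have e2 := sE z' h2'.
have d0 : v 0 i2 - v 0 1 * Im z != 0.
  by apply/eqP => e; move: v2; rewrite -e1 e mulr0 eqxx.
by apply: (mulIf d0); rewrite e1 et e2.
Qed.

(** The point has coordinates [a], [i b], [(1 + i) c] with [a], [b], [c] real and nonzero. It is not
    real, so only one real line passes through it. *)
Lemma disc_line_cross (u v : 'rV[R]_3) z : v 0 0 != 0 -> v 0 1 != 0 -> v 0 i2 != 0 ->
  line (cvec v) (disc z) -> line (cvec u) (disc z) -> cross u v = 0.
Proof.
move=> v0 v1 v2 hz hu; have [s0 s1 t0 t1] := disc_line_inner v0 v1 v2 hz.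
move: hz hu => /disc_line[h1 h2] /disc_line[k1 k2].
have a0 : Re z * (1 - Im z) != 0 by rewrite mulf_neq0 // subr_eq0 eq_sym.
have b0 : Re z * Im z != 0 by rewrite mulf_neq0.
have c0 : 1 - Re z != 0 by rewrite subr_eq0 eq_sym.
move: a0 b0 c0 h1 h2 k1 k2; set a := _ * (1 - _); set b := _ * _; set c := 1 - _.
move=> a0 b0 c0 h1 h2 k1 k2.
apply: row3_ext; rewrite !vec3E !mxE.
- apply: (mulIf b0); rewrite mul0r.
  transitivity ((u 0 1 * b + u 0 i2 * c) * v 0 i2 - u 0 i2 * (v 0 1 * b + v 0 i2 * c)).
    by ring.
  by rewrite h2 k2 mul0r mulr0 subrr.
- apply: (mulIf a0); rewrite mul0r.
  transitivity (u 0 i2 * (v 0 0 * a + v 0 i2 * c) - (u 0 0 * a + u 0 i2 * c) * v 0 i2).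
    by ring.
  by rewrite h1 k1 mul0r mulr0 subrr.
- apply: (mulIf b0); rewrite mul0r; apply: (mulIf a0); rewrite mul0r.
  transitivity ((u 0 0 * a + u 0 i2 * c) * (v 0 1 * b + v 0 i2 * c)
    - (u 0 1 * b + u 0 i2 * c) * (v 0 0 * a + v 0 i2 * c)
    - c * (a * (u 0 0 * v 0 i2 - u 0 i2 * v 0 0) - b * (u 0 1 * v 0 i2 - u 0 i2 * v 0 1))).
    by ring.
  have -> : a * (u 0 0 * v 0 i2 - u 0 i2 * v 0 0) =
      (u 0 0 * a + u 0 i2 * c) * v 0 i2 - u 0 i2 * (v 0 0 * a + v 0 i2 * c) by ring.
  have -> : b * (u 0 1 * v 0 i2 - u 0 i2 * v 0 1) =
      (u 0 1 * b + u 0 i2 * c) * v 0 i2 - u 0 i2 * (v 0 1 * b + v 0 i2 * c) by ring.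
  by rewrite h1 h2 k1 k2; ring.
Qed.

Lemma form_vtx_corner i m : (form (vtx i) (corner m) == 0) = (i != m).
Proof.
rewrite form_homog_eq0 dotE !vec3E.
by have [->|->|->] := ord3_cases i; have [->|->|->] := ord3_cases m;
  rewrite /= ?(mulr0, mul0r, mulr1, addr0, add0r) ?eqxx ?oner_eq0.
Qed.

Lemma vtx_corner i m : i != m -> line (vtx i) (corner m).
Proof. by rewrite -form_vtx_corner => /eqP. Qed.

Lemma form_corner u m : (form (cvec u) (corner m) == 0) =
  ((if m == 1 then u 0 0 else if m == i2 then u 0 1 else u 0 i2) == 0).
Proof.
rewrite form_homog_eq0 dotE !vec3E.
by have [->|->|->] := ord3_cases m;
  rewrite /= ?(mulr0, mul0r, mulr1, addr0, add0r) toC_eq0.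
Qed.

Lemma cross_vtx i k : i != k -> cross (vtx i) (vtx k) != 0.
Proof.
have [->|->|->] := ord3_cases i; have [->|->|->] := ord3_cases k => //= _; apply/eqP => /rowP e;
  have := (e 0, e 1, e i2); rewrite !vec3E !mxE /= ?(mulr0, mul0r, mulr1, subr0, sub0r);
  case=> -[] /eqP; rewrite ?oppr_eq0 ?oner_eq0 // => _ /eqP; rewrite ?oppr_eq0 ?oner_eq0 //.
  all: by move=> ? /eqP; rewrite ?oppr_eq0 ?oner_eq0.
Qed.

Lemma disc_corner z m k : k != 0 -> disc_vec z = k *: vtx m -> disc z = corner m.
Proof. by move=> k0 e; exact: (homog_congr _ _ k0 e). Qed.

Lemma disc0 t : disc (toC t * iC) = corner 0.
Proof.
have e1 : Re (toC t * iC) = 0 by have := Re_mk 0 t; rewrite toC0 add0r.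
apply: (disc_corner onei_neq0); apply: row3_ext;
  rewrite [RHS]mxE /disc_vec /vtx !vec3E e1 toC0 /=.
- by rewrite mul0r mulr0.
- by rewrite mul0r !mulr0.
- by rewrite subr0.
Qed.

Lemma disc_1 : disc 1 = corner 1.
Proof.
apply: (@disc_corner _ _ 1 (oner_neq0 _)); apply: row3_ext;
  rewrite [RHS]mxE /disc_vec /vtx !vec3E ?Re1 ?Im1 ?toC0 ?toC1 /=.
- by rewrite subr0.
- by rewrite !mulr0.
- by rewrite subrr !mulr0.
Qed.

Lemma disc_1i : disc (1 + iC) = corner i2.
Proof.
apply: (@disc_corner _ _ iC iC_neq0); apply: row3_ext;
  rewrite [RHS]mxE /disc_vec /vtx !vec3E ?ReD ?ImD ?Re1 ?Im1 ?Re_iC ?Im_iC ?addr0 ?add0r ?toC0 ?toC1 /=.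
- by rewrite subrr !mulr0.
- by rewrite !mulr1.
- by rewrite subrr !mulr0.
Qed.

Lemma disc_i : disc iC = corner 0.
Proof. by rewrite -(disc0 1) toC1 mul1r. Qed.

Lemma disc_00 : disc 0 = corner 0.
Proof. by rewrite -(disc0 0) toC0 mul0r. Qed.

Lemma disc_side i z : [\/ i = i2 /\ Im z = 0, i = 0 /\ Re z = 1 | i = 1 /\ Im z = 1] ->
  line (vtx i) (disc z).
Proof.
move=> h; rewrite lineE; apply/eqP; rewrite form_homog_eq0 dotE !vec3E; apply/eqP.
case: h => -[-> ->] /=; rewrite ?toC0 ?toC1 ?subrr ?(mulr0, mul0r, addr0, add0r) //.
Qed.

End Disc.

(** * Transfer of the holonomy along a homeomorphism *)

Section Transfer.
Variable R : realType.
Local Notation C := (Cx R).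
Local Notation CP2 := (proj_plane C).
Local Notation i2 := (ord_max : 'I_3).
Local Notation toC := (@toC R).
Local Notation Re := (@Re R).
Local Notation Im := (@Im R).
Local Notation iC := (@iC R).
Local Notation vtx := (@vtx R).
Local Notation corner := (@corner R).
Local Notation disc := (@disc R).
Variables (n : nat) (e e' : 'I_n -> 'rV[R]_3) (r : 'I_n).
Hypothesis n_even : ~~ odd n.
Hypotheses (e_nz : forall j i, e j 0 i != 0) (e'_nz : forall j i, e' j 0 i != 0).
Hypothesis e_cross : forall j k, j != k -> cross (e j) (e k) != 0.
Local Notation l := (fun j => cvec (e j)).
Local Notation l' := (fun j => cvec (e' j)).
Variables (f g : CP2 -> CP2) (tau : 'I_3 -> 'I_3) (rho : 'I_n -> 'I_n).
Hypotheses (fK : cancel f g) (gK : cancel g f) (cf : continuous f) (cg : continuous g).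
Hypothesis tau_inj : injective tau.
Hypothesis rho_surj : forall k, exists j, rho j = k.
Hypothesis fV : forall i P, line (vtx i) P -> line (vtx (tau i)) (f P).
Hypothesis fS : forall j P, line (l j) P <-> line (l' (rho j)) (f P).
Variables (q q' : 'I_3 -> CP2 -> C).
Hypothesis q_sqrt : forall i P, off_lines l P ->
  {for P, continuous (q i)} /\ (line (vtx i) P -> q i P ^+ 2 = phi l r P).
Hypothesis q'_sqrt : forall i P, off_lines l' P ->
  {for P, continuous (q' i)} /\ (line (vtx i) P -> q' i P ^+ 2 = phi l' r P).

Lemma f_off P : off_lines l P <-> off_lines l' (f P).
Proof.
split=> h j; last by move=> /fS; exact: h.
by have [k <-] := rho_surj j; move=> /fS; exact: h.
Qed.

Definition psi P := phi l r P * phi l' r (f P).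

Lemma psi_neq0 P : off_lines l P -> psi P != 0.
Proof. by move=> oP; rewrite mulf_neq0 // phi_neq0 //; apply/f_off. Qed.

Lemma psi_cont P : off_lines l P -> {for P, continuous psi}.
Proof.
move=> oP; apply: (atM (@phi_cont R n l r P oP)).
exact: (at_comp (@cf P) (@phi_cont R n l' r (f P) ((f_off P).1 oP))).
Qed.

(** Near [P] neither factor has a root off the line: composed with [g], a root of [phi' o f] would
    become a root of [phi'] near [f P], a point on exactly one surrounding line. *)
Lemma psi_sqrt_near j P : line (l j) P -> (forall k, k != j -> ~ line (l k) P) ->
  exists2 V, nbhs P V & has_sqrt psi (V `\` line (l j)) /\
    forall Q, V Q -> ~ line (l j) Q -> off_lines l Q.
Proof.
move=> lP lkP.
pose O : set CP2 := ~` \bigcup_(k in [set k | k != j]) line (l k).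
have oO : open O.
  apply: closed_openC; apply: closed_bigcup => [|k _]; first exact: finite_finset.
  exact: line_closed.
have nO : nbhs P O by apply: open_nbhs_nbhs; split=> // -[k /= /lkP].
have Ooff Q : O Q -> ~ line (l j) Q -> off_lines l Q.
  move=> OQ jQ k; have [->//|kj] := eqVneq k j.
  by move=> lQ; apply: OQ; exists k.
have l0 : l j != 0.
  by rewrite cvec_eq0; apply: contraNneq (e_nz j 0) => ->; rewrite mxE.
have l'0 k : l' k != 0.
  by rewrite cvec_eq0; apply: contraNneq (e'_nz k 0) => ->; rewrite mxE.
have [|V nV|V nV|V nV hV] :=
  @smooth_point_sqrt R (l j) P (phi l r) (fun Q => phi l' r (f Q)) O l0 lP nO.
- move=> Q OQ jQ; have oQ := Ooff Q OQ jQ; have oQ' := (f_off Q).1 oQ; split.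
  + exact: phi_neq0.
  + exact: (@phi_cont R n l r Q oQ).
  + exact: phi_neq0.
  + exact: (at_comp (@cf Q) (@phi_cont R n l' r (f Q) oQ')).
- move=> hV; apply: (@phi_no_sqrt R n l r j P (V `&` O)) => //; first exact: filterI.
  by apply: has_sqrtS hV => Q [[VQ _] oQ]; split=> //; exact: oQ.
- move=> hV; apply: (@phi_no_sqrt R n l' r (rho j) (f P) (g @^-1` V)) => //.
  + exact/fS.
  + move=> k kj; have [k' k'E] := rho_surj k; rewrite -k'E => /fS.
    by apply: lkP; apply: contraNneq kj => <-; rewrite k'E.
  + by apply: cg; rewrite fK.
  apply: (has_sqrt_ext _ (has_sqrt_comp (c := g) (V := (g @^-1` V) `&` off_lines l') _ hV)).
    by move=> Q _; rewrite gK.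
  move=> Q [VQ oQ]; split; last exact: cg.
  by split=> //; move=> /fS; rewrite gK; exact: oQ.
exists (V `&` O); first exact: filterI.
split; last by move=> Q [_]; exact: Ooff.
by apply: has_sqrtS hV => Q [[VQ _] jQ].
Qed.

Let A : set C := [set z | exists j, line (l j) (disc z)].

Lemma A_finite : finite_set A.
Proof.
have -> : A = \bigcup_(j in [set: 'I_n]) [set z | line (l j) (disc z)].
  by apply/seteqP; split=> z [j]; exists j.
apply: bigcup_finite => [|j _]; first exact: finite_finset.
have [[e0 e1] e2] := (e_nz j 0, e_nz j 1, e_nz j i2).
have [[z hz]|nz] := pselect (exists z, line (l j) (disc z)).
  apply: (@sub_finite_set _ _ [set z]); last exact: finite_set1.
  by move=> z' hz' /=; exact: (disc_line_once e0 e1 e2 hz').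
apply: (@sub_finite_set _ _ set0); last exact: finite_set0.
by move=> z hz; case: nz; exists z.
Qed.

Lemma notA_off z : ~ A z -> off_lines l (disc z).
Proof. by move=> Az j lz; apply: Az; exists j. Qed.

Lemma boundary_notA z : [|| Re z == 0, Re z == 1, Im z == 0 | Im z == 1] -> ~ A z.
Proof.
move=> h [j lz]; have [[e0 e1] e2] := (e_nz j 0, e_nz j 1, e_nz j i2).
have [a b c d] := disc_line_inner e0 e1 e2 lz.
by move: h; rewrite (negPf a) (negPf b) (negPf c) (negPf d).
Qed.

(** The open rectangle contains the closed unit square, so the root is continuous in the whole plane
    at every point of the sides. *)
Lemma psi_disc_sqrt : has_sqrt (fun z => psi (disc z)) (rect (-1) 2 (-1) 2 `\` A).
Proof.
apply: plane_sqrt; first exact: A_finite.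
  by move=> z /notA_off; exact: psi_neq0.
have cont z : ~ A z -> {for z, continuous (fun z => psi (disc z))}.
  by move=> /notA_off /psi_cont cz; exact: (at_comp (@disc_cont R z) cz).
move=> z; have [[j lz]|Az] := pselect (A z).
  have [[e0 e1] e2] := (e_nz j 0, e_nz j 1, e_nz j i2).
  have [|V nV [hV Voff]] := psi_sqrt_near lz.
    move=> k kj lkz; have := disc_line_cross e0 e1 e2 lz lkz.
    by apply/eqP; exact: e_cross.
  exists (disc @^-1` V); first exact: (@disc_cont R z _ nV).
  apply: (has_sqrt_comp (c := disc) _ hV) => y [Vy Ay]; split; last exact: disc_cont.
  by split=> //; exact: notA_off.
have [O nO hO] := @local_sqrt R C (fun z => psi (disc z)) z (psi_neq0 (notA_off Az)) (cont z Az).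
by exists O => //; apply: hO => [y []//|y [_]]; exact: cont.
Qed.

Lemma off_corner m : off_lines l (corner m).
Proof.
move=> j; apply/eqP; rewrite -[X in X != 0]/(form (l j) (corner m)) form_corner.
by do 2?case: ifP.
Qed.

Lemma f_corner m : f (corner m) = corner (tau m).
Proof.
have [i [k [im km ik]]] : exists i k, [/\ i != m, k != m & i != k].
  by have [->|->|->] := ord3_cases m; [exists 1, i2|exists 0, i2|exists 0, 1].
have ti x y : x != y -> tau x != tau y by move=> xy; apply: contra xy => /eqP/tau_inj ->.
apply: (lines_meet_once (cross_vtx R (ti _ _ ik))).
- exact/fV/vtx_corner.
- exact/fV/vtx_corner.
- exact/vtx_corner/ti.
- exact/vtx_corner/ti.
Qed.

Let G i P := q i P * q' (tau i) (f P).

(** On a side, [G i] is an explicit root of [psi], so a root [H] coming from the disc differs from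
    it by one and the same sign at both ends. *)
Lemma side_sign (H : C -> C) i (x y : C) :
  (forall z, (rect (-1) 2 (-1) 2 `\` A) z ->
     H z ^+ 2 = psi (disc z) /\ {for z, continuous H}) ->
  (forall t, 0 <= t <= 1 -> let z := x + toC t * (y - x) in
     [/\ rect (-1) 2 (-1) 2 z, ~ A z & line (vtx i) (disc z)]) ->
  exists2 s : C, s ^+ 2 = 1 & H x = s * G i (disc x) /\ H y = s * G i (disc y).
Proof.
move=> hH hside.
pose z t := x + toC t * (y - x).
have cz t : {for t, continuous z} by exact: affine_cont.
have z01 : `[0, 1]%classic (0 : R) by rewrite /= in_itv /= lexx ler01.
have o01 : `[0, 1]%classic (1 : R) by rewrite /= in_itv /= lexx ler01.
have [||||s s1 hs] := @sqrt_sign R R `[0, 1] (fun t => psi (disc (z t)))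
    (fun t => H (z t)) (fun t => G i (disc (z t))).
- exact: segment_connected.
- move=> t /=; rewrite in_itv /= => /hside[_ /notA_off oz _]; exact: psi_neq0.
- move=> t /=; rewrite in_itv /= => /hside[rz nAz _].
  have [e1 c1] := hH (z t) (conj rz nAz).
  by split; [exact: e1|exact: (at_comp (cz t) c1)].
- move=> t /=; rewrite in_itv /= => /hside[_ /notA_off oz lz].
  have oz' := (f_off _).1 oz.
  have [c1 e1] := q_sqrt i oz; have [c2 e2] := q'_sqrt (tau i) oz'.
  split; first by rewrite exprMn e1 // e2 //; exact: fV.
  have cdz := at_comp (cz t) (@disc_cont R (z t)).
  apply: (atM (at_comp cdz c1)).
  exact: (at_comp (at_comp cdz (@cf _)) c2).
have zx : z 0 = x by rewrite /z toC0 mul0r addr0.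
have zy : z 1 = y by rewrite /z toC1 mul1r addrC subrK.
by exists s => //; rewrite -{1 2}zx -{1 2}zy (hs 0 z01) (hs 1 o01) zx zy.
Qed.

(** The corner [m] lies on the two sides other than [m], and each factor compares the roots of these
    sides there. The relabelling [s] lets the image triangle be traversed in the order of the
    original one. *)
Definition holonomy (p : 'I_3 -> CP2 -> C) (s : 'I_3 -> 'I_3) :=
  p (s 0) (corner (s i2)) / p (s 1) (corner (s i2)) *
  (p (s 1) (corner (s 0)) / p (s i2) (corner (s 0))) *
  (p (s i2) (corner (s 1)) / p (s 0) (corner (s 1))).

Lemma holonomy_transfer : holonomy q id * holonomy q' tau = 1.
Proof.
have [H hH] := psi_disc_sqrt.
have [a a1 [a0x a0y]] : exists2 s : C, s ^+ 2 = 1 &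
    H 0 = s * G i2 (disc 0) /\ H 1 = s * G i2 (disc 1).
  apply: side_sign => // t /andP[t0 t1]; rewrite /= add0r subr0 mulr1; split.
  - by rewrite /rect /mkset Re_toC Im_toC; split; apply/andP; split; lra.
  - by apply: boundary_notA; rewrite Im_toC eqxx !orbT.
  - by apply: disc_side; constructor 1.
have [b b1 [b0x b0y]] : exists2 s : C, s ^+ 2 = 1 &
    H 1 = s * G 0 (disc 1) /\ H (1 + iC) = s * G 0 (disc (1 + iC)).
  apply: side_sign => // t /andP[t0 t1]; cbv zeta.
  have -> : 1 + toC t * (1 + iC - 1) = toC 1 + toC t * iC by rewrite toC1; ring.
  split.
  - by rewrite /rect /mkset Re_mk Im_mk; split; apply/andP; split; lra.
  - by apply: boundary_notA; rewrite Re_mk eqxx !orbT.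
  - by apply: disc_side; constructor 2; rewrite Re_mk.
have [c c1 [c0x c0y]] : exists2 s : C, s ^+ 2 = 1 &
    H iC = s * G 1 (disc iC) /\ H (1 + iC) = s * G 1 (disc (1 + iC)).
  apply: side_sign => // t /andP[t0 t1]; cbv zeta.
  have -> : iC + toC t * (1 + iC - iC) = toC t + toC 1 * iC by rewrite toC1; ring.
  split.
  - by rewrite /rect /mkset Re_mk Im_mk; split; apply/andP; split; lra.
  - by apply: boundary_notA; rewrite Im_mk eqxx !orbT.
  - by apply: disc_side; constructor 3; rewrite Im_mk.
have z01 : `[0, 1]%classic (0 : R) by rewrite /= in_itv /= lexx ler01.
have o01 : `[0, 1]%classic (1 : R) by rewrite /= in_itv /= lexx ler01.
(* The fourth side of the square collapses to a corner, where [psi] is constant. So [H] is constant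
   along it, and the three sides close up to a loop. *)
have H0i : H iC = H 0.
  have hd (t : R) : 0 <= t <= 1 -> H (toC t * iC) ^+ 2 = psi (corner 0) /\
      {for t, continuous (fun t => H (toC t * iC))}.
    move=> /andP[t0 t1]; have [|e1 ct] := hH (toC t * iC).
      have eR : Re (toC t * iC) = 0 by have := Re_mk 0 t; rewrite toC0 add0r.
      have eI : Im (toC t * iC) = t by have := Im_mk 0 t; rewrite toC0 add0r.
      split; last by apply: boundary_notA; rewrite eR eqxx.
      by rewrite /rect /mkset eR eI; split; apply/andP; split; lra.
    split; first by rewrite e1 disc0.
    exact: (at_comp (atM (@real_complex_continuous R t) (@at_cst R C iC t)) ct).
  have [||||s s1 hs] := @sqrt_sign R R `[0, 1] (fun=> psi (corner 0))
      (fun t => H (toC t * iC)) (fun=> H 0).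
  - exact: segment_connected.
  - by move=> t _; apply: psi_neq0; exact: off_corner.
  - by move=> t /=; rewrite in_itv /= => /hd.
  - move=> t _; split; last exact: (@at_cst R C (H 0) t).
    have [] := hd 0; first by rewrite lexx ler01.
    by rewrite toC0 mul0r.
  have e0 := hs 0 z01; have e1 := hs 1 o01.
  by rewrite toC0 mul0r in e0; rewrite toC1 mul1r in e1; rewrite e1 -e0.
rewrite disc_00 in a0x; rewrite disc_1 in a0y b0x; rewrite disc_1i in b0y c0y.
rewrite disc_i in c0x.
have G0 i m : i != m -> G i (corner m) != 0.
  move=> im; have oc := @off_corner m; have oc' := (f_off _).1 oc.
  have [_ e1] := q_sqrt i oc; have [_ e2] := q'_sqrt (tau i) oc'.
  rewrite -sqrf_eq0 exprMn e1 ?e2; last exact: vtx_corner.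
    exact: psi_neq0.
  exact/fV/vtx_corner.
have s0 (s : C) : s ^+ 2 = 1 -> s != 0.
  by move=> h; rewrite -sqrf_eq0 h oner_eq0.
have -> : holonomy q id * holonomy q' tau =
    G 0 (corner i2) / G 1 (corner i2) * (G 1 (corner 0) / G i2 (corner 0)) *
    (G i2 (corner 1) / G 0 (corner 1)).
  by rewrite /holonomy mulrACA (mulrACA (_ / _)) !mulf_div /G !f_corner.
have e1 : G 0 (corner i2) = c / b * G 1 (corner i2).
  by apply: (mulfI (s0 b b1)); rewrite -b0y c0y; field; exact: s0.
have e2 : G 1 (corner 0) = a / c * G i2 (corner 0).
  by apply: (mulfI (s0 c c1)); rewrite -c0x H0i a0x; field; exact: s0.
have e3 : G i2 (corner 1) = b / a * G 0 (corner 1).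
  by apply: (mulfI (s0 a a1)); rewrite -a0y b0x; field; exact: s0.
rewrite e1 e2 e3 !mulfK ?G0 //.
by have := (s0 a a1, s0 b b1, s0 c c1) => -[[? ?] ?]; field; apply/and3P.
Qed.

End Transfer.

(** * Combinatorics and stability *)

Section Combinatorics.

Definition decode (n : nat) : 'I_3 + 'I_14 :=
  if (n < 3)%N then inl (inord n) else inr (inord (n - 3)).

Lemma codeK : cancel code decode.
Proof.
move=> [i|j]; rewrite /decode /code.
  by rewrite ltn_ord inord_val.
by rewrite ltnNge leq_addr /= addKn inord_val.
Qed.

Lemma decodeK n : (n < 17)%N -> code (decode n) = n.
Proof.
move=> n17; rewrite /decode; have [n3|n3] := ltnP n 3; rewrite /code inordK //.
  by rewrite subnKC.
by rewrite ltn_subLR.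
Qed.

(* The collinear triples, by codes: V_i has code i - 1 and S_j has code j + 2. *)
Definition triples : seq (seq nat) :=
  [:: [:: 0; 3; 7]; [:: 0; 4; 16]; [:: 0; 5; 8]; [:: 0; 6; 11]; [:: 0; 9; 10];
      [:: 0; 12; 13]; [:: 0; 14; 15];
      [:: 1; 3; 6]; [:: 1; 4; 13]; [:: 1; 5; 9]; [:: 1; 7; 15]; [:: 1; 8; 10];
      [:: 1; 11; 12]; [:: 1; 14; 16];
      [:: 2; 3; 10]; [:: 2; 4; 5]; [:: 2; 6; 12]; [:: 2; 7; 14]; [:: 2; 8; 9];
      [:: 2; 11; 13]; [:: 2; 15; 16]]%N.

(** Only triples with increasing codes are tested, 680 in all; accordingly [combinatorics_triples]
    sorts the codes of a given triple. *)
Definition zcomb_check (a b c : int) : bool :=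
  all (fun k => all (fun l => all (fun n =>
    zcol a b c n l k ==> ([:: n; l; k] \in triples)) (iota 0 l)) (iota 0 k)) (iota 0 17)
  && all (fun t => [&& uniq t, all (ltn^~ 17) t & zcol a b c (nth 0 t 0) (nth 0 t 1) (nth 0 t 2)])%N
    triples.

Lemma zcomb_sign a b c :
  a \in [:: -1; 1 : int] -> b \in [:: -1; 1 : int] -> c \in [:: -1; 1 : int] ->
  zcomb_check a b c.
Proof. by rewrite !inE => /orP[]/eqP-> /orP[]/eqP-> /orP[]/eqP->; vm_compute. Qed.

Definition triple_set (t : seq nat) : {set 'I_3 + 'I_14} := [set x in map decode t]%SET.

Lemma set3_seq (T : finType) (p q s : T) : [set p; q; s]%SET = [set x in [:: p; q; s]]%SET.
Proof. by apply/setP => x; rewrite !inE orbA. Qed.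

Variable R : realType.

Lemma combinatorics_triples (a b c : R) ha hb hc T :
  (T \in combinatorics (E_config a b c ha hb hc)) = (T \in map triple_set triples).
Proof.
rewrite inE; have [[[k hk ka] [l hl lb]] [n hn nc]] :=
  (sign_int ha, sign_int hb, sign_int hc).
have /andP[h1 h2] := zcomb_sign hk hl hn.
have col p q s : `[< collinear (E_pt a b c p) (E_pt a b c q) (E_pt a b c s) >]
    = zcol k l n (code p) (code q) (code s) by rewrite ka lb nc collinear_E_pt.
apply/asboolP/mapP => [[p [q [s [u -> [v v0 [vp vq vs]]]]]]|[t tt ->]].
  pose t := sort leq (map code [:: p; q; s]).
  have pt : perm_eq t (map code [:: p; q; s]) by apply/permPl/perm_sort.
  have lt : sorted ltn t.
    rewrite ltn_sorted_uniq_leq sort_uniq (map_inj_uniq code_inj) u.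
    by apply: sort_sorted; exact: leq_total.
  have T_t : [set p; q; s]%SET = triple_set t.
    rewrite set3_seq; apply/setP => x; rewrite !inE (perm_mem (perm_map decode pt)).
    by rewrite /= !codeK !inE.
  have vt n' : n' \in t -> line v (E_pt a b c (decode n')) /\ (n' < 17)%N.
    rewrite (perm_mem pt) !inE => n'E; split.
      by case/or3P: n'E => /eqP->; rewrite codeK.
    by case/or3P: n'E => /eqP->; have := code_iota p; have := code_iota q;
      have := code_iota s; rewrite !mem_iota.
  rewrite T_t; exists t => //.
  have : size t = 3%N by rewrite (perm_size pt).
  case: t {pt T_t} lt vt => [|x [|y [|z [|//]]]] //= /and3P[xy yz _] vt _.
  have [vx x17] := vt x (mem_head _ _).
  have [vy y17] : line v (E_pt a b c (decode y)) /\ (y < 17)%N.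
    by apply: vt; rewrite !inE eqxx orbT.
  have [vz z17] : line v (E_pt a b c (decode z)) /\ (z < 17)%N.
    by apply: vt; rewrite !inE eqxx !orbT.
  have := col (decode x) (decode y) (decode z); rewrite !decodeK // asboolT; last by exists v.
  move=> /esym zc.
  have zi : z \in iota 0 17 by rewrite mem_iota.
  have yi : y \in iota 0 z by rewrite mem_iota.
  have xi : x \in iota 0 y by rewrite mem_iota.
  by have := allP (allP (allP h1 _ zi) _ yi) _ xi; rewrite zc.
have /and3P[ut lt zt] := allP h2 t tt.
have /eqP : size t == 3%N by apply: (allP (isT : all (fun t => size t == 3%N) triples)).
case: t tt ut lt zt => [|x [|y [|z [|//]]]] //= tt ut /and4P[x17 y17 z17 _] zt _.
exists (decode x), (decode y), (decode z); split.
- rewrite -[X in is_true X]/(uniq [:: decode x; decode y; decode z]).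
  by rewrite -(map_inj_uniq code_inj) /= !decodeK.
- by rewrite set3_seq.
- by apply/asboolP; rewrite col !decodeK.
Qed.

Lemma triple_set3 k l n : triple_set [:: k; l; n] = [set decode k; decode l; decode n]%SET.
Proof. by rewrite set3_seq. Qed.

Lemma card_code (P : pred nat) : #|[set q | P (code q)]%SET| = count P (iota 0 17).
Proof.
rewrite -sum1_card; under eq_bigl do rewrite inE.
rewrite (iotaD 0 3 14) count_cat big_sumType; congr addn.
  by rewrite -sum1_count -[iota 0 3]/(index_iota 0 3) big_mkord.
rewrite -[iota _ 14]/(iota (3 + 0) 14) iotaDl count_map -sum1_count.
by rewrite -[iota 0 14]/(index_iota 0 14) big_mkord.
Qed.

Definition neighbours (S : {set {set 'I_3 + 'I_14}}) p : {set 'I_3 + 'I_14} :=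
  [set q | (q != p) && [exists T in S, (p \in T) && (q \in T)]]%SET.

(** Two of the triples share at most one point, so the neighbours are twice as many as the triples
    through [p]: seven through a vertex, three through a surrounding-point. *)
Lemma card_neighbours (a b c : R) ha hb hc p :
  #|neighbours (combinatorics (E_config a b c ha hb hc)) p| =
  if p is inl _ then 14%N else 6%N.
Proof.
pose nb k l := (l != k) && has (fun t => (k \in t) && (l \in t)) triples.
have -> : neighbours (combinatorics (E_config a b c ha hb hc)) p =
    [set q | nb (code p) (code q)]%SET.
  apply/setP => q; rewrite !inE /nb (inj_eq code_inj); congr andb.
  have mt t x : t \in triples -> (x \in triple_set t) = (code x \in t).
    move=> tt; rewrite inE -(mem_map code_inj) -map_comp map_id_in // => y yt /=.
    have /allP/(_ t tt)/allP/(_ y yt) : all (all (ltn^~ 17)) triples by [].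
    exact: decodeK.
  apply/existsP/hasP => [[T /andP[]]|[t tt /andP[pt qt]]].
    by rewrite combinatorics_triples => /mapP[t tt ->]; rewrite !mt //; exists t.
  exists (triple_set t); rewrite combinatorics_triples map_f //= !mt //.
  by rewrite pt qt.
rewrite card_code.
have : all (fun k => count (nb k) (iota 0 17) == if (k < 3)%N then 14%N else 6%N) (iota 0 17).
  by vm_compute.
move=> /allP/(_ _ (code_iota p))/eqP ->; by case: p => [i|j] //=; rewrite ltn_ord.
Qed.

Lemma neighbours_perm (S : {set {set 'I_3 + 'I_14}}) (f : {perm 'I_3 + 'I_14}) p :
  [set f @: T | T : {set 'I_3 + 'I_14} in S]%SET = S ->
  neighbours S (f p) = [set f q | q in neighbours S p]%SET.
Proof.
move=> fS.
have memf (T : {set 'I_3 + 'I_14}) x : (f x \in [set f y | y in T]%SET) = (x \in T).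
  by rewrite mem_imset //; exact: perm_inj.
apply/setP => q; rewrite -[q](permKV f); move: (_ q) => {}q.
rewrite mem_imset ?inE; last exact: perm_inj.
rewrite (inj_eq perm_inj); congr andb.
apply/existsP/existsP => [[T /and3P[]]|[T /and3P[TS pT qT]]].
  rewrite -{1}fS => /imsetP[T' T'S ->]; rewrite !memf => pT qT.
  by exists T'; rewrite T'S pT.
exists [set f y | y in T]%SET; rewrite !memf pT qT !andbT.
by rewrite -fS; apply/imsetP; exists T.
Qed.

(* Vertices lie on seven collinear triples, surrounding-points on three. *)
Lemma E_config_stable (a b c : R) ha hb hc : stable (E_config a b c ha hb hc).
Proof.
move=> f fS.
have fp p : (f p \in vertices 3 14) = (p \in vertices 3 14).
  have vE x : (x \in vertices 3 14) = if x is inl _ then true else false.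
    by case: x => [i|j]; apply/imsetP; [exists i|case].
  have := congr1 (fun A : {set _} => #|A|) (neighbours_perm p fS).
  rewrite card_imset; last exact: perm_inj.
  by rewrite !card_neighbours !vE; case: (f p) => ?; case: (p).
apply/setP => x; rewrite -[x](permKV f) mem_imset ?fp //; exact: perm_inj.
Qed.

End Combinatorics.

(** * The holonomy of the configuration *)

Section Pairs.
Variable R : realType.
Local Notation C := (Cx R).
Local Notation CP2 := (proj_plane C).
Local Notation i2 := (ord_max : 'I_3).
Local Notation toC := (@toC R).
Local Notation vtx := (@vtx R).
Local Notation corner := (@corner R).

(* [pairs i] lists the pairs of surrounding-points (numbered from 0) aligned with the
   vertex [i], that is, whose dual lines meet on the line dual to it. *)
Definition pairs (i : 'I_3) : seq (nat * nat) :=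
  nth [::] [::
    [:: (0, 4); (1, 13); (2, 5); (3, 8); (6, 7); (9, 10); (11, 12)];
    [:: (0, 3); (1, 10); (2, 6); (4, 12); (5, 7); (8, 9); (11, 13)];
    [:: (0, 7); (1, 2); (3, 9); (4, 11); (5, 6); (8, 10); (12, 13)]]%N i.

(* The position of the nonzero coordinate of the vertex [m]. *)
Definition corner_coord (m : 'I_3) : 'I_3 := if m == 1 then 0 else if m == i2 then 1 else i2.

Lemma prod_pairs (F : 'I_14 -> C) i :
  \prod_j F j = \prod_(p <- pairs i) (F (inord p.1) * F (inord p.2)).
Proof.
transitivity (\prod_(0 <= j < 14) F (inord j)).
  by rewrite big_mkord; apply: eq_bigr => j _; rewrite inord_val.
rewrite (perm_big (flatten [seq [:: p.1; p.2] | p <- pairs i])); last first.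
  by have [->|->|->] := ord3_cases i.
rewrite big_flatten big_map; apply: eq_bigr => p _.
by rewrite big_cons big_seq1.
Qed.

Lemma swap_ratio (K : fieldType) (x1 x2 y1 y2 p1 p2 : K) : x1 * y2 = x2 * y1 ->
  (x1 * p1 + x2 * p2) * y1 = (y1 * p1 + y2 * p2) * x1.
Proof.
move=> e; apply/eqP; rewrite -subr_eq0; apply/eqP.
transitivity (p2 * (x2 * y1 - x1 * y2)); first by ring.
by rewrite e subrr mulr0.
Qed.

(** [corner_coord] shifts indices cyclically by -1. On the line dual to the vertex [i] the
    coordinate [corner_coord i] vanishes, which leaves [i] and [corner_coord (corner_coord i)]; two
    forms with proportional coefficients there are proportional along the line. *)
Lemma form_on_line (u v : 'rV[R]_3) i P : line (vtx i) P ->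
  u 0 i * v 0 (corner_coord (corner_coord i)) = u 0 (corner_coord (corner_coord i)) * v 0 i ->
  form (cvec u) P * toC (v 0 i) = form (cvec v) P * toC (u 0 i).
Proof.
rewrite lineE /form dotE !vec3E => iP.
have tM (x y : R) : toC x * toC y = toC (x * y) by rewrite [RHS]rmorphM.
rewrite !dotE !vec3E; have [ii|ii|ii] := ord3_cases i; subst i; rewrite /corner_coord /= => e;
  move: iP; rewrite /= ?(mul0r, mul1r, addr0, add0r) => ->; rewrite !(mulr0, addr0, add0r);
  move: e => /(congr1 toC); rewrite -!tM => e.
- exact: swap_ratio.
- exact: swap_ratio.
- by rewrite ![toC _ * hcoords P 0 0 + _]addrC; exact: swap_ratio.
Qed.

Lemma dot_cvec_vtx (u : 'rV[R]_3) m : dot (cvec u) (vtx m) = toC (u 0 (corner_coord m)).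
Proof.
rewrite dotE !vec3E /corner_coord; have [->|->|->] := ord3_cases m;
  by rewrite /= ?(mulr0, mulr1, addr0, add0r).
Qed.

Variables (e : 'I_14 -> 'rV[R]_3) (s : R).
Hypothesis e_nz : forall j i, e j 0 i != 0.
Local Notation l := (fun j => cvec (e j)).
Hypothesis e_pairs : forall i p, p \in pairs i ->
  e (inord p.1) 0 i * e (inord p.2) 0 (corner_coord (corner_coord i)) =
  e (inord p.1) 0 (corner_coord (corner_coord i)) * e (inord p.2) 0 i.
Let N i m := \prod_(p <- pairs i) e (inord p.1) 0 (corner_coord m).
Hypothesis N_sign : N 0 i2 * N 1 0 * N i2 1 = s * (N 1 i2 * N i2 0 * N 0 1).

(** On the side [i] paired forms are proportional. So [phi] is a constant times the square of the
    product of the first members of the pairs over [l 0], and [kap i] is a root of that constant. In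
    the holonomy the [kap i] cancel, leaving the products [N i m] of coordinates. *)
Lemma vertex_sqrt : exists q : 'I_3 -> CP2 -> C,
  (forall i P, off_lines l P ->
    {for P, continuous (q i)} /\ (line (vtx i) P -> q i P ^+ 2 = phi l 0 P)) /\
  holonomy q id = toC s.
Proof.
have [kap hkap] := choice (fun i : 'I_3 => sqrt_ex
  (\prod_(p <- pairs i) (toC (e (inord p.2) 0 i) / toC (e (inord p.1) 0 i)))).
have t0 j i : toC (e j 0 i) != 0 by rewrite toC_eq0.
exists (fun i P => kap i * \prod_(p <- pairs i) (form (l (inord p.1)) P / form (l 0) P)).
split=> [i P oP|].
  split=> [|iP].
    apply: (atM (@at_cst _ C (kap i) P)); apply: at_prod => p; apply: ratio_cont.
    by apply/eqP; exact: oP.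
  rewrite exprMn hkap -prodrXl -big_split /= /phi (prod_pairs _ i).
  rewrite !big_seq; apply: eq_bigr => p pp.
  have h := form_on_line iP (e_pairs pp).
  have -> : form (l (inord p.2)) P =
      form (l (inord p.1)) P * toC (e (inord p.2) 0 i) / toC (e (inord p.1) 0 i).
    by rewrite h mulfK.
  have f0 : form (l 0) P != 0 by apply/eqP; exact: oP.
  by field; rewrite f0 t0.
(* There are seven pairs on each side, so the two roots compared at a corner share the denominator
   with exponent 7, which cancels. *)
have qc i m : kap i * \prod_(p <- pairs i) (form (l (inord p.1)) (corner m) / form (l 0) (corner m))
    = kap i * toC (N i m) / toC (e 0 0 (corner_coord m)) ^+ 7.
  rewrite -mulrA; congr (_ * _).
  under eq_bigr => p _ do rewrite form_homog_ratio !dot_cvec_vtx.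
  rewrite prodf_div /N /toC rmorph_prod; congr (_ / _).
  rewrite big_const_seq count_predT iter_mulr_1.
  by have [->|->|->] := ord3_cases i.
have k0 i : kap i != 0.
  rewrite -sqrf_eq0 hkap prodf_seq_neq0; apply/allP => x _.
  by rewrite mulf_neq0 ?invr_neq0.
have tN i m : toC (N i m) != 0 by rewrite toC_eq0 prodf_seq_neq0; apply/allP => x _; exact: e_nz.
have NC : toC (N 0 i2) * toC (N 1 0) * toC (N i2 1) =
    toC s * (toC (N 1 i2) * toC (N i2 0) * toC (N 0 1)).
  by rewrite /toC -!rmorphM N_sign.
rewrite /holonomy !qc; transitivity
  (toC (N 0 i2) * toC (N 1 0) * toC (N i2 1) / (toC (N 1 i2) * toC (N i2 0) * toC (N 0 1))).
  by field; rewrite !k0 !tN !t0.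
by rewrite NC mulfK // !mulf_neq0.
Qed.

End Pairs.

Section HolonomyPerm.
Variable R : realType.
Local Notation C := (Cx R).
Local Notation CP2 := (proj_plane C).
Local Notation i2 := (ord_max : 'I_3).
Local Notation corner := (@corner R).

(** Each quotient at a corner squares to 1 and so equals its inverse. Permuting the triangle only
    reorders the quotients and inverts some of them. *)
Lemma holonomy_perm (p : 'I_3 -> CP2 -> C) (tau : 'I_3 -> 'I_3) : injective tau ->
  (forall m i k, i != m -> k != m -> p i (corner m) != 0 /\
     p i (corner m) ^+ 2 = p k (corner m) ^+ 2) ->
  holonomy p tau = holonomy p id.
Proof.
move=> ti hp.
have swap m i k : i != m -> k != m ->
    p i (corner m) / p k (corner m) = p k (corner m) / p i (corner m).
  move=> im km; have [i0 ik] := hp m i k im km; have [k0 _] := hp m k i km im.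
  by apply/eqP; rewrite eqr_div // -!expr2 ik.
have A : p 1 (corner i2) / p 0 (corner i2) = p 0 (corner i2) / p 1 (corner i2) by exact: swap.
have B : p i2 (corner 0) / p 1 (corner 0) = p 1 (corner 0) / p i2 (corner 0) by exact: swap.
have D : p 0 (corner 1) / p i2 (corner 1) = p i2 (corner 1) / p 0 (corner 1) by exact: swap.
have n01 : tau 0 != tau 1 by apply/eqP => /ti.
have n02 : tau 0 != tau i2 by apply/eqP => /ti.
have n12 : tau 1 != tau i2 by apply/eqP => /ti.
rewrite /holonomy; move: n01 n02 n12.
by have [->|->|->] := ord3_cases (tau 0); have [->|->|->] := ord3_cases (tau 1);
  have [->|->|->] := ord3_cases (tau i2) => //= _ _ _; rewrite ?A ?B ?D; ring.
Qed.

End HolonomyPerm.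

(** * The sign of the holonomy, computed in Z[sqrt 2] *)

Section Coordinates.
Local Notation i2 := (ord_max : 'I_3).

Definition zx (a b c : int) n i := nth z0 (nth [::] (zcoords a b c) (3 + n)) i.

Definition zprod (a b c : int) (ps : seq (nat * nat)) i :=
  foldr (fun p x => zmul (zx a b c p.1 i) x) (zi 1) ps.

(** These are the hypotheses of [vertex_sqrt]. Each of [a], [b], [c] enters one coordinate of each
    of three points, and reversing it negates three of the six products in the last condition; hence
    the factor [a * b * c]. *)
Definition zsign_check (a b c : int) : bool :=
  [&& all (fun n => all (fun i => zx a b c n i != z0) (iota 0 3)) (iota 0 14),
      all (fun i : 'I_3 => all (fun p => [&& p.1 < 14, p.2 < 14 &
        zmul (zx a b c p.1 i) (zx a b c p.2 (corner_coord (corner_coord i))) ==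
        zmul (zx a b c p.1 (corner_coord (corner_coord i))) (zx a b c p.2 i)]%N) (pairs i))
      [:: 0; 1; i2]
    & zmul (zmul (zprod a b c (pairs 0) (corner_coord i2)) (zprod a b c (pairs 1) (corner_coord 0)))
           (zprod a b c (pairs i2) (corner_coord 1)) ==
      zmul (zi (a * b * c))
        (zmul (zmul (zprod a b c (pairs 1) (corner_coord i2))
                    (zprod a b c (pairs i2) (corner_coord 0)))
           (zprod a b c (pairs 0) (corner_coord 1)))].

Lemma zsign_sign a b c :
  a \in [:: -1; 1 : int] -> b \in [:: -1; 1 : int] -> c \in [:: -1; 1 : int] ->
  zsign_check a b c.
Proof. by rewrite !inE => /orP[]/eqP-> /orP[]/eqP-> /orP[]/eqP->; vm_compute. Qed.

End Coordinates.

(** * Duality and the roots attached to a configuration *)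

Section Config.
Variable R : realType.
Local Notation C := (Cx R).
Local Notation CP2 := (proj_plane C).
Local Notation i2 := (ord_max : 'I_3).
Local Notation toC := (@toC R).

Lemma det3_dot (u v w : 'rV[R]_3) : det3 u v w = dot u (cross v w).
Proof. by rewrite det3E dotE !vec3E; ring. Qed.

Section Coords.
Variables (a b c : R).
Hypotheses (ha : a \in [:: -1; 1]) (hb : b \in [:: -1; 1]) (hc : c \in [:: -1; 1]).
Local Notation E := (E_coords a b c).

Lemma E_cross p q : p != q -> cross (E p) (E q) != 0.
Proof.
move=> pq; apply/eqP => c0; move/eqP: pq; apply.
apply: (E_pt_inj ha hb hc).
exact: (cross0_homog (E_coords_neq0 a b c p) (E_coords_neq0 a b c q) c0).
Qed.

Lemma cvec_E_neq0 p : cvec (E p) != 0 :> 'rV[C]_3.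
Proof. by rewrite cvec_eq0 E_coords_neq0. Qed.

Lemma cvec_E_vtx i : cvec (E (inl i)) = vtx R i.
Proof.
have -> : E (inl i) = row3 (i == 1)%:R (i == i2)%:R (i == 0)%:R.
  by have [->|->|->] := ord3_cases i.
rewrite /cvec /row3 !mxE /=.
by have [->|->|->] := ord3_cases i; rewrite ?toC0 ?toC1.
Qed.

(** Both sides say that the determinant of the three coordinate vectors vanishes, once over the
    reals and once over the complex numbers. *)
Lemma collinear_concurrent p q s : q != s ->
  collinear (E_pt a b c p) (E_pt a b c q) (E_pt a b c s) <->
  exists X : CP2, [/\ line (cvec (E p)) X, line (cvec (E q)) X & line (cvec (E s)) X].
Proof.
move=> qs; rewrite concurrent cross_cvec ?cvec_eq0 ?E_cross // dot_cvec -det3_dot.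
rewrite /E_pt collinear_homog; split=> [->|/eqP]; first exact: toC0.
by rewrite toC_eq0 => /eqP.
Qed.

Lemma zx_ev k l n j i : a = k%:~R -> b = l%:~R -> c = n%:~R -> (j < 14)%N ->
  E (inr (inord j)) 0 i = ev R (zx k l n j i).
Proof. by move=> -> -> -> j14; rewrite E_coords_ev /zx /code inordK. Qed.

Lemma zprod_ev k l n ps i : a = k%:~R -> b = l%:~R -> c = n%:~R ->
  all (fun p => p.1 < 14)%N ps ->
  \prod_(p <- ps) E (inr (inord p.1)) 0 i = ev R (zprod k l n ps i).
Proof.
move=> ak bl cn; elim: ps => [|p ps IH] /=.
  by rewrite big_nil /ev /= mul0r addr0.
by move=> /andP[p14 /IH e]; rewrite big_cons e evM (zx_ev i ak bl cn p14).
Qed.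

Lemma E_nz j i : E (inr j) 0 i != 0.
Proof.
have [[[k hk ak] [l hl bl]] [n hn cn]] := (sign_int ha, sign_int hb, sign_int hc).
have /and3P[h1 _ _] := zsign_sign hk hl hn.
rewrite -[j]inord_val (zx_ev i ak bl cn (ltn_ord j)) ev_eq0.
have j14 : (j : nat) \in iota 0 14 by rewrite mem_iota /= ltn_ord.
have ii : (i : nat) \in iota 0 3 by rewrite mem_iota /= ltn_ord.
exact: (allP (allP h1 j j14) i ii).
Qed.

Lemma config_sqrt : exists q : 'I_3 -> CP2 -> C,
  (forall i P, off_lines (fun j => cvec (E (inr j))) P ->
    {for P, continuous (q i)} /\
    (line (vtx R i) P -> q i P ^+ 2 = phi (fun j => cvec (E (inr j))) 0 P)) /\
  holonomy q id = toC (a * b * c).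
Proof.
have [[[k hk ak] [l hl bl]] [n hn cn]] := (sign_int ha, sign_int hb, sign_int hc).
have /and3P[h1 h2 /eqP h3] := zsign_sign hk hl hn.
have i3 i : i \in [:: 0; 1; i2] by have [->|->|->] := ord3_cases i.
have hp i p : p \in pairs i -> [&& (p.1 < 14)%N, (p.2 < 14)%N &
    zmul (zx k l n p.1 i) (zx k l n p.2 (corner_coord (corner_coord i))) ==
    zmul (zx k l n p.1 (corner_coord (corner_coord i))) (zx k l n p.2 i)].
  by move=> pp; exact: (allP (allP h2 i (i3 i)) p pp).
apply: (@vertex_sqrt R (fun j => E (inr j))).
- exact: E_nz.
- move=> i p pp; have /and3P[p1 p2 /eqP e] := hp i p pp.
  by rewrite !(zx_ev _ ak bl cn p1) !(zx_ev _ ak bl cn p2) -!evM e.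
have lt i : all (fun p => p.1 < 14)%N (pairs i).
  by apply/allP => p /hp /and3P[].
rewrite !(zprod_ev _ ak bl cn (lt _)) -!evM h3 !evM; congr (_ * _).
by rewrite ak bl cn -!intrM /ev /= mul0r addr0.
Qed.

End Coords.

(** * Configurations whose dual arrangements are homeomorphic *)

Section Homeo.
Variables (a b c a' b' c' : R).
Hypotheses (ha : a \in [:: -1; 1]) (hb : b \in [:: -1; 1]) (hc : c \in [:: -1; 1]).
Hypotheses (ha' : a' \in [:: -1; 1]) (hb' : b' \in [:: -1; 1]) (hc' : c' \in [:: -1; 1]).
Local Notation E := (E_coords a b c).
Local Notation E' := (E_coords a' b' c').
Variables (f g : CP2 -> CP2).
Hypotheses (fK : cancel f g) (gK : cancel g f) (cf : continuous f) (cg : continuous g).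
Hypothesis fU : forall P, (exists p, line (cvec (E p)) P) <-> (exists p, line (cvec (E' p)) (f P)).

(** Applied to [f] and to [g], [lines_to_lines] gives maps of indices in both directions. They are
    inverse to each other because a line contained in another line of the arrangement coincides with
    it. *)
Lemma homeo_lines : exists s : {perm 'I_3 + 'I_14},
  forall p P, line (cvec (E p)) P <-> line (cvec (E' (s p))) (f P).
Proof.
have /choice[s hs] : forall p, exists s : 'I_3 + 'I_14,
    forall P, line (cvec (E p)) P -> line (cvec (E' s)) (f P).
  apply: (@lines_to_lines R _ (fun p => cvec (E p)) (fun p => cvec (E' p)) f g).
  - exact: cvec_E_neq0.
  - by move=> p q pq; rewrite cross_cvec cvec_eq0 E_cross.
  - exact: fK.
  - exact: cf.
  - by move=> p P lP; apply/fU; exists p.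
have /choice[t ht] : forall p, exists t : 'I_3 + 'I_14,
    forall P, line (cvec (E' p)) P -> line (cvec (E t)) (g P).
  apply: (@lines_to_lines R _ (fun p => cvec (E' p)) (fun p => cvec (E p)) g f).
  - exact: cvec_E_neq0.
  - by move=> p q pq; rewrite cross_cvec cvec_eq0 E_cross.
  - exact: gK.
  - exact: cg.
  - by move=> p P lP; apply/fU; rewrite gK; exists p.
have sK : cancel s t.
  move=> p; apply/eqP; apply/negPn/negP => np.
  have [|X [lX nX]] := @line_sep C (cvec (E p)) (cvec (E (t (s p)))).
    by rewrite cross_cvec cvec_eq0 E_cross // eq_sym.
  by apply: nX; rewrite -[X]fK; apply: ht; exact: hs.
exists (perm (can_inj sK)) => p P; rewrite permE; split; first exact: hs.
by move=> /ht; rewrite fK sK.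
Qed.

Lemma homeo_sign : a * b * c * (a' * b' * c') = 1.
Proof.
have [s hs] := homeo_lines.
(* Stability speaks of permutations of a single configuration. It applies to [s] because the
   combinatorics does not depend on the three signs. *)
have comb' : combinatorics (E_config a' b' c' ha' hb' hc') =
    combinatorics (E_config a b c ha hb hc).
  by apply/setP => T; rewrite !combinatorics_triples.
have scomb : [set s @: T | T : {set 'I_3 + 'I_14} in combinatorics (E_config a b c ha hb hc)]%SET
    = combinatorics (E_config a b c ha hb hc).
  apply/eqP; rewrite eqEcard card_imset ?leqnn ?andbT; last exact/imset_inj/perm_inj.
  apply/fintype.subsetP => _ /imsetP[T + ->]; rewrite -{2}comb' !inE.
  move=> [p [q [r [u -> col]]]]; exists (s p), (s q), (s r).
  have qr : q != r by move: u => /and3P[_]; rewrite inE.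
  split.
  - by rewrite -[[:: s p; s q; s r]]/(map s [:: p; q; r]) map_inj_uniq //; exact: perm_inj.
  - by rewrite !imsetU !imset_set1.
  have [X [Xp Xq Xr]] := (collinear_concurrent ha hb hc p qr).1 col.
  have qs : s q != s r by rewrite (inj_eq perm_inj).
  apply/(collinear_concurrent ha' hb' hc' (s p) qs); exists (f X).
  by split; apply/hs.
have sV := E_config_stable scomb.
have /choice[tau htau] i : exists k : 'I_3, s (inl i) = inl k.
  have : s (inl i) \in vertices 3 14.
    by rewrite -sV imset_f // imset_f.
  by case/imsetP => k _ ->; exists k.
have vE x : (x \in vertices 3 14) = if x is inl _ then true else false.
  by case: x => [i|j]; apply/imsetP; [exists i|case].
have /choice[rho hrho] j : exists k : 'I_14, s (inr j) = inr k.
  have : s (inr j) \notin vertices 3 14.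
    by rewrite -sV mem_imset ?vE //; exact: perm_inj.
  by rewrite vE; case: (s (inr j)) => // k _; exists k.
have tau_inj : injective tau.
  move=> i k e; suff /perm_inj[] : s (inl i) = s (inl k) by [].
  by rewrite !htau e.
have rho_surj k : exists j, rho j = k.
  case e : (s^-1%g (inr k)) => [i|j].
    by have := permKV s (inr k); rewrite e htau.
  by exists j; have := permKV s (inr k); rewrite e hrho => -[].
have [q [q_sqrt q_hol]] := config_sqrt ha hb hc.
have [q' [q'_sqrt q'_hol]] := config_sqrt ha' hb' hc'.
have fV i P : line (vtx R i) P -> line (vtx R (tau i)) (f P).
  rewrite -(cvec_E_vtx a b c) => /hs; by rewrite htau cvec_E_vtx.
have fS j P : line (cvec (E (inr j))) P <-> line (cvec (E' (inr (rho j)))) (f P).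
  by rewrite -hrho; exact: hs.
have e_cross j k : j != k -> cross (E (inr j)) (E (inr k)) != 0.
  by move=> jk; apply: E_cross.
have := @holonomy_transfer R 14 (fun j => E (inr j)) (fun j => E' (inr j)) 0 isT
  (E_nz ha hb hc) (E_nz ha' hb' hc') e_cross f g tau rho fK gK cf cg tau_inj
  rho_surj fV fS q q' q_sqrt q'_sqrt.
(* [f] may permute the sides by [tau]; the holonomy of the target does not depend on this order. *)
rewrite holonomy_perm // => [|m i k im km]; last first.
  have om := @off_corner R 14 (fun j => E' (inr j)) (E_nz ha' hb' hc') m.
  have [_ qi] := q'_sqrt i _ om; have [_ qk] := q'_sqrt k _ om.
  rewrite qi ?qk; try exact: vtx_corner.
  by split=> //; rewrite -sqrf_eq0 qi ?phi_neq0 //; exact: vtx_corner.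
rewrite q_hol q'_hol => e.
by have := congr1 (@Re R) e; rewrite Re1 -[toC _ * _]rmorphM Re_toC.
Qed.

End Homeo.

End Config.

(* The dual arrangement and the conclusion *)
Transparent Cx.

(** [hcoords] returns the given coordinates up to a nonzero real factor, and rescaling an equation
    leaves its line unchanged. *)
Lemma dual_line_cvec (R : realType) (a b c : R) ha hb hc p :
  dual_line (pt (E_config a b c ha hb hc) p) =
  line (cvec (E_coords a b c p)) :> set (proj_plane (Cx R)).
Proof.
apply/seteqP; rewrite /dual_line /=.
have [k k0 ->] := hcoords_homog (E_coords_neq0 a b c p).
have tk0 : toC k != 0 by rewrite toC_eq0.
have -> : map_mx (real_complex R) (k *: E_coords a b c p) =
    toC k *: cvec (E_coords a b c p) :> 'rV[Cx R]_3.
  by apply: row3_ext; rewrite !mxE /= -rmorphM.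
suff lk X : line (toC k *: cvec (E_coords a b c p)) X <-> line (cvec (E_coords a b c p)) X.
  by split=> X /lk.
rewrite !lineE /form.
by rewrite dotZl; split=> [/eqP|->]; rewrite ?mulr0 // mulf_eq0 (negPf tk0) => /eqP.
Qed.

Lemma dual_union (R : realType) (a b c : R) ha hb hc (X : proj_plane (Cx R)) :
  (\bigcup_(L in dual_arrangement (E_config a b c ha hb hc)) L) X <->
  exists p, line (cvec (E_coords a b c p)) X.
Proof.
split=> [[_ [p _ <-]]|[p]]; first by rewrite dual_line_cvec; exists p.
rewrite -(dual_line_cvec ha hb hc) => pX.
by exists (dual_line (pt (E_config a b c ha hb hc) p)) => //; exists p.
Qed.

Local Close Scope classical_set_scope.

Theorem theorem5p4 (R : realType) (alpha beta gamma : R)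
    (ha : alpha \in [:: -1; 1]) (hb : beta \in [:: -1; 1]) (hc : gamma \in [:: -1; 1]) :
  [/\ combinatorics (E_config alpha beta gamma ha hb hc) =
        [set [set Vx 1; Sp 1; Sp 5]; [set Vx 1; Sp 2; Sp 14];
             [set Vx 1; Sp 3; Sp 6]; [set Vx 1; Sp 4; Sp 9];
             [set Vx 1; Sp 7; Sp 8]; [set Vx 1; Sp 10; Sp 11];
             [set Vx 1; Sp 12; Sp 13];
             [set Vx 2; Sp 1; Sp 4]; [set Vx 2; Sp 2; Sp 11];
             [set Vx 2; Sp 3; Sp 7]; [set Vx 2; Sp 5; Sp 13];
             [set Vx 2; Sp 6; Sp 8]; [set Vx 2; Sp 9; Sp 10];
             [set Vx 2; Sp 12; Sp 14];
             [set Vx 3; Sp 1; Sp 8]; [set Vx 3; Sp 2; Sp 3];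
             [set Vx 3; Sp 4; Sp 10]; [set Vx 3; Sp 5; Sp 12];
             [set Vx 3; Sp 6; Sp 7]; [set Vx 3; Sp 9; Sp 11];
             [set Vx 3; Sp 13; Sp 14]]%SET,
      stable (E_config alpha beta gamma ha hb hc)
    & forall (alpha' beta' gamma' : R) (ha' : alpha' \in [:: -1; 1])
        (hb' : beta' \in [:: -1; 1]) (hc' : gamma' \in [:: -1; 1]),
        alpha * beta * gamma != alpha' * beta' * gamma' ->
        ~ homeomorphic_pairs
            (dual_arrangement (E_config alpha beta gamma ha hb hc))
            (dual_arrangement (E_config alpha' beta' gamma' ha' hb' hc'))].
Proof.
split; [|exact: E_config_stable|].
  by apply/setP => T; rewrite combinatorics_triples [map _ _]/= !triple_set3 !inE -!orbA.
move=> a' b' c' ha' hb' hc' neq [f [g [fK gK cf cg fU]]].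
have fL (P : proj_plane (Cx R)) : (exists p, line (cvec (E_coords alpha beta gamma p)) P) <->
    (exists p, line (cvec (E_coords a' b' c' p)) (f P)).
  rewrite -(dual_union ha hb hc) -(dual_union ha' hb' hc') -fU.
  by split=> [?|[Q UQ /(can_inj fK) <-] //]; exists P.
have e := @homeo_sign R _ _ _ _ _ _ ha hb hc ha' hb' hc' f g fK gK cf cg fL.
have s2 (x : R) : x \in [:: -1; 1] -> x * x = 1.
  by rewrite !inE => /orP[]/eqP ->; rewrite ?mulrNN mulr1.
have s1 : (a' * b' * c') * (a' * b' * c') = 1.
  by rewrite mulrACA (mulrACA a') (s2 _ ha') (s2 _ hb') (s2 _ hc') !mulr1.
by move/eqP: neq; apply; rewrite -[LHS]mulr1 -s1 mulrA e mul1r.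
Qed.
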